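(* Let $a_1\in\mathbb{C}$ with $a_1\neq 0$, $a_0\in\mathbb{B}_N$, and let $A$ be a symmetric $N\times N$ complex matrix such that $\varphi(z)=\frac{a_0-Az}{1-\langle z,\overline{a_0}\rangle}$ is a self-map of $\mathbb{B}_N$. Let $\psi(z)=\frac{a_1}{(1-\langle z,\overline{a_0}\rangle)^N}$. If $a_0\in\mathbb{B}_N\setminus\{0\}$, then $W_{\psi,\varphi}$ is unitary on $H^2(\mathbb{B}_N)$ if and only if $$a_1=\lambda(1-|a_0|^2)^{N/2}\text{ for some }\lambda\in\mathbb{C}\text{ with }|\lambda|=1,\quad \overline{A}A-\overline{a_0}a_0^{T}=(1-|a_0|^2)I_N,\quad A\overline{a_0}-a_0=0.$$ In particular, if $a_0=0$, then $W_{\psi,\varphi}$ is unitary on $H^2(\mathbb{B}_N)$ if and only if $\psi(z)=\lambda$ for some $\lambda\in\mathbb{C}$ with $|\lambda|=1$ and $\varphi(z)=-Az$ where $A$ is a unitary and symmetric matrix.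
   Context: $\mathbb{B}_N$ is the open unit ball of $\mathbb{C}^N$, $S_N$ its boundary sphere with normalized surface measure $\sigma$, and $\langle\cdot,\cdot\rangle$ is the Euclidean inner product on $\mathbb{C}^N$ (linear in the first variable). $H^2(\mathbb{B}_N)$ is the Hardy space of holomorphic $f$ on $\mathbb{B}_N$ with $\sup_{0<r<1}\int_{S_N}|f(r\zeta)|^2d\sigma(\zeta)<\infty$, a Hilbert space with reproducing kernel $K_w(z)=(1-\langle z,w\rangle)^{-N}$. $W_{\psi,\varphi}f=\psi\cdot(f\circ\varphi)$. Vectors are column vectors; bars denote entrywise conjugation; ''symmetric'' means equal to the transpose; $I_N$ is the identity matrix. *)

(* Defs.v *)
From HB Require Import structures.
From mathcomp Require Import all_boot all_order all_algebra.
From mathcomp Require Import complex.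
From mathcomp Require Import all_classical all_reals all_analysis.
From mathcomp Require Import measurable_realfun.

Set Implicit Arguments.
Unset Strict Implicit.
Unset Printing Implicit Defensive.

Import Order.TTheory GRing.Theory Num.Theory.
Import numFieldTopology.Exports numFieldNormedType.Exports.

Local Open Scope classical_set_scope.
Local Open Scope complex_scope.
Local Open Scope ring_scope.

Section pushforward_measure.
Context d1 d2 (T1 : measurableType d1) (T2 : measurableType d2) (R : realType).

(* The library's measure structure on [pushforward mu f] cannot be inferred,
   since it depends on the measurability proof; here it is passed explicitly. *)
Definition mpushforward (mu : {measure set T1 -> \bar R}) (f : T1 -> T2)
    (mf : measurable_fun setT f) : {measure set T2 -> \bar R} :=
  ltac:(refine [the {measure set T2 -> \bar R} of pushforward mu f]; exact: mf).

End pushforward_measure.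

Section surface_measure.
Variable R : realType.

Local Notation RT n := (n.-tuple (measurableTypeR R)).

Definition tuple_rcons n (p : RT n * measurableTypeR R) : RT n.+1 :=
  [tuple of rcons p.1 p.2].

Lemma measurable_tuple_rcons n : measurable_fun setT (@tuple_rcons n).
Proof.
apply/measurable_fun_tnthP => i /=.
have [ilt|ige] := ltnP i n.
  rewrite (_ : _ \o _ = (fun p : RT n => tnth p (Ordinal ilt)) \o fst).
    by apply: measurableT_comp => //; exact: measurable_tnth.
  apply/funext => -[t x] /=.
  by rewrite !(tnth_nth 0) /= nth_rcons size_tuple ilt.
rewrite (_ : _ \o _ = snd) //.
apply/funext => -[t x] /=.
have -> : i = ord_max by apply/val_inj/eqP; rewrite eqn_leq ige -ltnS ltn_ord.
by rewrite (tnth_nth 0) /= nth_rcons size_tuple ltnn eqxx.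
Qed.

(* Lebesgue measure on R^n, as an iterated product measure *)
Fixpoint lebesgue_tuple n : {measure set (RT n) -> \bar R} :=
  match n with
  | 0%N => \d_ ([tuple] : RT 0)
  | m.+1 => mpushforward
              [the {measure set _ -> \bar R} of
                 (lebesgue_tuple m \x lebesgue_measure)%E]
              (@measurable_tuple_rcons m)
  end.

Definition tuple_norm n (x : RT n) : R := Num.sqrt (\sum_(i < n) tnth x i ^+ 2).

Definition tuple_ball n : set (RT n) := [set x | tuple_norm x < 1].

Definition tuple_sphere n : set (RT n) := [set x | tuple_norm x = 1].

Arguments tuple_ball n : clear implicits.
Arguments tuple_sphere n : clear implicits.

(* x / |x|, with 0 sent to 0 *)
Definition tuple_dir n (x : RT n) : RT n :=
  [tuple tnth x i / tuple_norm x | i < n].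

Lemma measurable_tuple_norm n : measurable_fun setT (@tuple_norm n).
Proof.
rewrite (_ : @tuple_norm n = (@powR R ^~ 2^-1) \o
    (fun x : RT n => \sum_(i < n) tnth x i ^+ 2)).
  apply: measurableT_comp; first exact: measurable_powR.
  by apply: measurable_sum => i; apply: measurable_funX; exact: measurable_tnth.
by apply/funext => x /=; rewrite powR12_sqrt// sumr_ge0// => i _; exact: sqr_ge0.
Qed.

Lemma measurable_tuple_ball n : measurable (tuple_ball n).
Proof.
rewrite (_ : tuple_ball n = setT `&` (@tuple_norm n) @^-1` [set` `]-oo, 1[]).
  by apply: measurable_tuple_norm.
by apply/seteqP; split => x; rewrite /tuple_ball /= in_itv /= => // -[].
Qed.

Lemma measurable_tuple_dir n : measurable_fun setT (@tuple_dir n).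
Proof.
apply/measurable_fun_tnthP => i.
rewrite (_ : _ \o _ = (fun x : RT n => tnth x i * (tuple_norm x) `^ (-1))).
  apply: measurable_funM; first exact: measurable_tnth.
  apply: (measurableT_comp (measurable_powR (R := R) (-1))).
  exact: measurable_tuple_norm.
by apply/funext => x /=; rewrite tnth_mktuple powR_inv1// sqrtr_ge0.
Qed.

(* Normalized surface measure of the unit sphere of R^n, given by polar
   coordinates: the measure of E is the proportion of the volume of the ball
   occupied by the cone {t x | x in E, 0 < t < 1}. *)
Definition surface_measure n : {measure set (RT n) -> \bar R} :=
  mscale (`|(fine (lebesgue_tuple n (tuple_ball n)))^-1|%:nng)
    (mpushforward
       [the {measure set _ -> \bar R} of
          mrestr (lebesgue_tuple n) (@measurable_tuple_ball n)]
       (@measurable_tuple_dir n)).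

End surface_measure.

Section ball.
Variables (R : realType) (N : nat).

Local Notation C := R[i].
Local Notation CN := 'cV[C]_N.

Definition dotc (z w : CN) : C := \sum_(j < N) z j 0 * (w j 0)^*.

Definition enorm (z : CN) : R := Num.sqrt (complex.Re (dotc z z)).

Definition unit_ball : set CN := [set z | enorm z < 1].

(* C^N = R^(2N): real parts are the first N coordinates, imaginary parts the
   last N ones. *)
Definition complex_vector (x : (N + N).-tuple (measurableTypeR R)) : CN :=
  \col_(j < N) ((tnth x (lshift N j) : R) +i* (tnth x (rshift N j) : R)).

End ball.

(* Frechet differentiability over the scalars K; for K = C this is
   holomorphy when D is open. *)
Definition holomorphic_on (K : numFieldType) n (D : set 'cV[K]_n)
    (f : 'cV[K]_n -> K) : Prop :=
  forall z, D z -> differentiable (f : _ -> K^o) z.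

Section hardy.
Variables (R : realType) (N : nat).

Local Notation C := R[i].
Local Notation CN := 'cV[C]_N.
Local Notation B := (@unit_ball R N).
Local Notation sigma := (@surface_measure R (N + N)).
Local Notation S := (@tuple_sphere R (N + N)).

Definition hardy (f : CN -> C) : Prop :=
  holomorphic_on B f /\
  (ereal_sup [set \int[sigma]_(x in S)
      ((complex.Re `|f (r%:C *: complex_vector x)| ^+ 2)%:E) |
    r in [set r : R | 0 < r < 1]%R] < +oo)%E.

Definition sphere_integral (F : CN -> C) : C :=
  (Rintegral sigma S (fun x => complex.Re (F (complex_vector x)))) +i*
  (Rintegral sigma S (fun x => complex.Im (F (complex_vector x)))).

(* The inner product of H^2: the limit of the integrals of f(r.) conj(g(r.))
   as r increases to 1. *)
Definition hardy_dot (f g : CN -> C) : C :=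
  let I (r : R) :=
    sphere_integral (fun z => f (r%:C *: z) * (g (r%:C *: z))^*) in
  lim (complex.Re (I r) @[r --> 1^'-]) +i* lim (complex.Im (I r) @[r --> 1^'-]).

(* Elements of H^2 are functions on the ball: they are represented by functions
   on C^N, whose values outside the ball are irrelevant. *)
Definition eq_on_ball (f g : CN -> C) : Prop := forall z, B z -> f z = g z.

(* T is the adjoint of W, and T W = W T = I on H^2.  Linearity and boundedness
   of W on H^2 follow from these conditions. *)
Definition hardy_unitary (W : (CN -> C) -> (CN -> C)) : Prop :=
  (forall f, hardy f -> hardy (W f)) /\
  exists T : (CN -> C) -> (CN -> C),
    [/\ forall f, hardy f -> hardy (T f),
        forall f g, hardy f -> hardy g ->
          hardy_dot (W f) g = hardy_dot f (T g),
        forall f, hardy f -> eq_on_ball (T (W f)) f &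
        forall f, hardy f -> eq_on_ball (W (T f)) f].

Definition weighted_composition (psi : CN -> C) (phi : CN -> CN)
    (f : CN -> C) : CN -> C := fun z => psi z * f (phi z).

Definition conj_mx m n (A : 'M[C]_(m, n)) : 'M[C]_(m, n) := map_mx Num.conj A.

Definition frac_map (a0 : CN) (A : 'M[C]_N) (z : CN) : CN :=
  (1 - dotc z (conj_mx a0))^-1 *: (a0 - A *m z).

Definition kernel_weight (a0 : CN) (a1 : C) (z : CN) : C :=
  a1 / (1 - dotc z (conj_mx a0)) ^+ N.

End hardy.

(* Main.v *)
(* The kernels K_u(z) = (1 - <z,u>)^-N reproduce the values of functions on the
   ball, and W maps K_u to a multiple of K_v, where v is the image of u under
   the map with conjugate data.  If W is unitary, comparing
   <W K_u, W K_w> = <K_u, K_w> gives a polynomial identity whose expansion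
   yields the three conditions.  Conversely, these conditions make W invertible,
   with as inverse T the operator of the same form with conjugate data.  The
   reproducing property applied twice shows that T is adjoint to W on dilated
   functions; taking W f_rho as test function, the means of |W f_rho|^2 are
   bounded by those of |f|^2, so that W, and likewise T, is a contraction.
   Thus W is isometric, and polarization makes T its adjoint.

   The reproducing property reduces to the computation of the moments of
   |<z,w>|^(2n) on the sphere and to the expansion of holomorphic functions on
   complex lines, obtained from Cauchy's formula (Goursat's lemma).  Orthogonality
   relations come from averages over roots of unity acting by unitary maps. *)

Require Import Defs.
From HB Require Import structures.
From mathcomp Require Import all_boot all_order all_algebra.
From mathcomp Require Import complex.
From mathcomp Require Import all_classical all_reals all_analysis.
From mathcomp Require Import measurable_realfun ring lra.
From mathcomp Require Import cyclic separable cyclotomic.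

Set Implicit Arguments.
Unset Strict Implicit.
Unset Printing Implicit Defensive.

Import Order.TTheory GRing.Theory Num.Theory.
Import numFieldTopology.Exports numFieldNormedType.Exports.

Local Open Scope classical_set_scope.
Local Open Scope complex_scope.
Local Open Scope ring_scope.

(** * Modulus and bounded integrals of complex functions *)

(** Elements of the Hardy space are known only inside the ball, and [hardy_dot] is a limit of means
    over spheres of radius r < 1. Everything is therefore proved at fixed radii, and limits are
    taken by dominated convergence of uniformly bounded integrands. Dilating both factors by r
    reproduces f at r ^ 2 w instead of w, which is the origin of the squared radii below; they are
    reconciled by the fact that the mean of f(r z) conj g(s z) depends only on r s. The obstacle in
    the sufficiency is that W f is not known beforehand to have bounded means. For a dilation of f
    this is clear, since the dilation is bounded on the whole ball, and that is why the estimate is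
    made there first. Of the surface measure only its finite positive mass and its unitary
    invariance enter. Double integrals are exchanged through polynomial expansions of the kernel,
    and averages over the circle are replaced by averages over M-th roots of unity, with an error
    geometric in M. *)

Section complex_modulus.
Variable R : realType.
Implicit Types z w : R[i].

(** The norm of [R[i]] takes its values in [R[i]]; estimates, square roots and limits are carried
    out with its real value. *)
Definition cabs z : R := complex.Re `|z|.

Lemma normr_cabs z : `|z| = (cabs z)%:C.
Proof. by rewrite /cabs normc_def. Qed.

Lemma cabsE z : cabs z = Num.sqrt (complex.Re z ^+ 2 + complex.Im z ^+ 2).
Proof. by rewrite /cabs normc_def. Qed.

Lemma cabs_ge0 z : 0 <= cabs z.
Proof. by rewrite cabsE sqrtr_ge0. Qed.

Lemma cabsM z w : cabs (z * w) = cabs z * cabs w.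
Proof. by apply: (@complexI R); rewrite rmorphM -!normr_cabs normrM. Qed.

Lemma cabsD z w : cabs (z + w) <= cabs z + cabs w.
Proof. by rewrite -lecR rmorphD -!normr_cabs ler_normD. Qed.

Lemma cabsN z : cabs (- z) = cabs z.
Proof. by rewrite /cabs normrN. Qed.

Lemma cabsB z w : cabs (z - w) <= cabs z + cabs w.
Proof. by rewrite (le_trans (cabsD _ _))// cabsN. Qed.

Lemma cabs0 : cabs 0 = 0.
Proof. by rewrite /cabs normr0. Qed.

Lemma cabs1 : cabs 1 = 1.
Proof. by rewrite /cabs normr1. Qed.

Lemma cabs_eq0 z : (cabs z == 0) = (z == 0).
Proof. by rewrite -(inj_eq (@complexI R)) -normr_cabs normr_eq0. Qed.

Lemma cabs_gt0 z : (0 < cabs z) = (z != 0).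
Proof. by rewrite lt_def cabs_ge0 andbT cabs_eq0. Qed.

Lemma cabsX z n : cabs (z ^+ n) = cabs z ^+ n.
Proof. by elim: n => [|n IH]; rewrite ?expr0 ?cabs1// !exprS cabsM IH. Qed.

Lemma cabsV z : cabs z^-1 = (cabs z)^-1.
Proof. by apply: (@complexI R); rewrite fmorphV -!normr_cabs normfV. Qed.

Lemma cabsJ z : cabs (Num.conj z) = cabs z.
Proof. by rewrite /cabs norm_conjC. Qed.

Lemma cabsR (x : R) : cabs x%:C = `|x|.
Proof. by rewrite cabsE /= expr0n addr0 sqrtr_sqr. Qed.

Lemma cabs_nat n : cabs n%:R = n%:R.
Proof. by rewrite /cabs normr_nat -(rmorph_nat (real_complex R)). Qed.

Lemma ler_Re z : `|complex.Re z| <= cabs z.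
Proof. by rewrite -lecR -normr_cabs normc_ge_Re. Qed.

Lemma ler_Im z : `|complex.Im z| <= cabs z.
Proof.
rewrite cabsE -sqrtr_sqr ler_wsqrtr//.
by rewrite lerDr sqr_ge0.
Qed.

Lemma cabs_le_ReIm z : cabs z <= `|complex.Re z| + `|complex.Im z|.
Proof.
rewrite {1}[z]complexE; apply: (le_trans (cabsD _ _)).
by rewrite cabsM !cabsR [cabs 'i%C]cabsE /= expr0n add0r expr1n sqrtr1 mul1r.
Qed.

Lemma cabs_sum (I : Type) (s : seq I) (P : pred I) (F : I -> R[i]) :
  cabs (\sum_(i <- s | P i) F i) <= \sum_(i <- s | P i) cabs (F i).
Proof.
elim/big_ind2: _ => [|x1 x2 y1 y2 h1 h2|//]; first by rewrite cabs0.
exact: le_trans (cabsD _ _) (lerD h1 h2).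
Qed.

Lemma cabs_sqr z : z * Num.conj z = (cabs z ^+ 2)%:C.
Proof. by rewrite -normCK normr_cabs rmorphXn. Qed.

Lemma cabs_dist z w : `|cabs z - cabs w| <= cabs (z - w).
Proof.
rewrite ler_norml; apply/andP; split.
  rewrite lerBrDl lerBlDr -(cabsN (z - w)) opprB.
  by apply: le_trans (cabsD _ _); rewrite addrC subrK.
by rewrite lerBlDr; apply: le_trans (cabsD _ _); rewrite subrK.
Qed.

Lemma cReD z w : complex.Re (z + w) = complex.Re z + complex.Re w.
Proof. by case: z; case: w. Qed.
Lemma cImD z w : complex.Im (z + w) = complex.Im z + complex.Im w.
Proof. by case: z; case: w. Qed.
Lemma cReN z : complex.Re (- z) = - complex.Re z.
Proof. by case: z. Qed.
Lemma cImN z : complex.Im (- z) = - complex.Im z.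
Proof. by case: z. Qed.
Lemma cReM z w : complex.Re (z * w)
  = complex.Re z * complex.Re w - complex.Im z * complex.Im w.
Proof. by case: z; case: w. Qed.
Lemma cImM z w : complex.Im (z * w)
  = complex.Re z * complex.Im w + complex.Im z * complex.Re w.
Proof. by case: z; case: w. Qed.
Lemma cReJ z : complex.Re (Num.conj z) = complex.Re z.
Proof. by case: z. Qed.
Lemma cImJ z : complex.Im (Num.conj z) = - complex.Im z.
Proof. by case: z. Qed.
Lemma complex_eqP z w :
  complex.Re z = complex.Re w -> complex.Im z = complex.Im w -> z = w.
Proof. by case: z => a b; case: w => c d /= -> ->. Qed.

End complex_modulus.

Section bounded_measurable.
Context d (T : measurableType d) (R : realType).
Variables (D : set T).
Hypothesis mD : measurable D.
Implicit Types h k : T -> R[i].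

(** Boundedness stands in for integrability: on a set of finite measure it implies it, and it is
    stable under products. *)
Definition bmeas h := [/\ measurable_fun D (fun x => complex.Re (h x)),
  measurable_fun D (fun x => complex.Im (h x)) &
  exists M : R, forall x, D x -> cabs (h x) <= M].

Lemma bmeas_bound h : bmeas h -> exists2 M : R, 0 <= M & forall x, D x -> cabs (h x) <= M.
Proof.
move=> [_ _ [M hM]]; exists `|M| => // x Dx.
by rewrite (le_trans (hM x Dx))// ler_norm.
Qed.

Lemma bmeas_cst c : bmeas (fun=> c).
Proof.
by split; [exact: measurable_cst|exact: measurable_cst|exists (cabs c)].
Qed.

Lemma bmeasD h k : bmeas h -> bmeas k -> bmeas (fun x => h x + k x).
Proof.
move=> bh bk; have [M _ hM] := bmeas_bound bh; have [N _ kN] := bmeas_bound bk.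
case: bh bk => h1 h2 _ [k1 k2 _]; split.
- by under eq_fun do rewrite cReD; exact: measurable_funD.
- by under eq_fun do rewrite cImD; exact: measurable_funD.
- by exists (M + N) => x Dx; rewrite (le_trans (cabsD _ _))// lerD ?hM ?kN.
Qed.

Lemma bmeasM h k : bmeas h -> bmeas k -> bmeas (fun x => h x * k x).
Proof.
move=> bh bk; have [M M0 hM] := bmeas_bound bh; have [N N0 kN] := bmeas_bound bk.
case: bh bk => h1 h2 _ [k1 k2 _]; split.
- under eq_fun do rewrite cReM.
  by apply: measurable_funB; apply: measurable_funM.
- under eq_fun do rewrite cImM.
  by apply: measurable_funD; apply: measurable_funM.
- by exists (M * N) => x Dx; rewrite cabsM ler_pM ?cabs_ge0 ?hM ?kN.
Qed.

Lemma bmeasZ c h : bmeas h -> bmeas (fun x => c * h x).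
Proof. by move=> bh; apply: bmeasM => //; exact: bmeas_cst. Qed.

Lemma bmeasN h : bmeas h -> bmeas (fun x => - h x).
Proof. by move/(bmeasZ (-1)); under eq_fun do rewrite mulN1r. Qed.

Lemma bmeasB h k : bmeas h -> bmeas k -> bmeas (fun x => h x - k x).
Proof. by move=> bh bk; apply: bmeasD => //; exact: bmeasN. Qed.

Lemma bmeasJ h : bmeas h -> bmeas (fun x => Num.conj (h x)).
Proof.
move=> [h1 h2 [M hM]]; split.
- by under eq_fun do rewrite cReJ.
- by under eq_fun do rewrite cImJ; exact: measurableT_comp.
- by exists M => x Dx; rewrite cabsJ hM.
Qed.

Lemma bmeasX h n : bmeas h -> bmeas (fun x => h x ^+ n).
Proof.
move=> bh; elim: n => [|n IH]; first exact: bmeas_cst.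
by under eq_fun do rewrite exprS; exact: bmeasM.
Qed.

Lemma bmeas_sum (I : Type) (s : seq I) (P : pred I) (F : I -> T -> R[i]) :
  (forall i, bmeas (F i)) -> bmeas (fun x => \sum_(i <- s | P i) F i x).
Proof.
move=> bF; elim: s => [|i s IH].
  by under eq_fun do rewrite big_nil; exact: bmeas_cst.
by under eq_fun do rewrite big_cons; case: (P i) => //; exact: bmeasD.
Qed.

Lemma eq_bmeas h k : (forall x, D x -> h x = k x) -> bmeas h -> bmeas k.
Proof.
move=> hk [h1 h2 [M hM]]; split.
- apply: (eq_measurable_fun _ _ h1) => x; rewrite inE => Dx; by rewrite hk.
- apply: (eq_measurable_fun _ _ h2) => x; rewrite inE => Dx; by rewrite hk.
- by exists M => x Dx; rewrite -hk// hM.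
Qed.

End bounded_measurable.

Section complex_integral.
Context d (T : measurableType d) (R : realType).
Variables (mu : {measure set T -> \bar R}) (D : set T).
Hypotheses (mD : measurable D) (finD : (mu D < +oo)%E).
Implicit Types h k : T -> R[i].

(** [sphere_integral] unfolds to this for the surface measure, so that the rules below apply to it
    directly. *)
Definition cint h : R[i] :=
  (Rintegral mu D (fun x => complex.Re (h x))) +i*
  (Rintegral mu D (fun x => complex.Im (h x))).

Lemma bmeas_integrable h : bmeas D h ->
  mu.-integrable D (EFin \o (fun x => complex.Re (h x))) /\
  mu.-integrable D (EFin \o (fun x => complex.Im (h x))).
Proof.
move=> [h1 h2 [M hM]]; split; apply: measurable_bounded_integrable => //.
- exists M; split; rewrite ?num_real// => y My x Dx /=.
  by rewrite (le_trans (ler_Re _))// (le_trans (hM _ Dx))// ltW.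
- exists M; split; rewrite ?num_real// => y My x Dx /=.
  by rewrite (le_trans (ler_Im _))// (le_trans (hM _ Dx))// ltW.
Qed.

Lemma eq_cint h k : (forall x, D x -> h x = k x) -> cint h = cint k.
Proof.
by move=> hk; rewrite /cint; congr (_ +i* _); apply: eq_Rintegral => x;
  rewrite inE => Dx; rewrite hk.
Qed.

Lemma cint_cst c : cint (fun=> c) = c * (fine (mu D))%:C.
Proof.
rewrite /cint !Rintegral_cst//; apply: complex_eqP => /=.
  by rewrite cReM /= mulr0 subr0.
by rewrite cImM /= mulr0 add0r.
Qed.

Lemma cintD h k : bmeas D h -> bmeas D k ->
  cint (fun x => h x + k x) = cint h + cint k.
Proof.
move=> /bmeas_integrable[h1 h2] /bmeas_integrable[k1 k2].
rewrite /cint; apply: complex_eqP => /=.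
  by under [LHS]eq_Rintegral do rewrite cReD; rewrite RintegralD.
by under [LHS]eq_Rintegral do rewrite cImD; rewrite RintegralD.
Qed.

Lemma cintZ c h : bmeas D h -> cint (fun x => c * h x) = c * cint h.
Proof.
move=> /bmeas_integrable[h1 h2].
have i1 r : mu.-integrable D (EFin \o (fun x => r * complex.Re (h x))).
  by have := integrableZl mD r h1.
have i2 r : mu.-integrable D (EFin \o (fun x => r * complex.Im (h x))).
  by have := integrableZl mD r h2.
rewrite /cint; apply: complex_eqP.
  rewrite cReM /=; under [LHS]eq_Rintegral do rewrite cReM.
  by rewrite RintegralB// !RintegralZl.
rewrite cImM /=; under [LHS]eq_Rintegral do rewrite cImM.
by rewrite RintegralD// !RintegralZl.
Qed.

Lemma cintN h : bmeas D h -> cint (fun x => - h x) = - cint h.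
Proof.
move=> bh; rewrite -mulN1r -cintZ//.
by apply: eq_cint => x _; rewrite mulN1r.
Qed.

Lemma cintB h k : bmeas D h -> bmeas D k ->
  cint (fun x => h x - k x) = cint h - cint k.
Proof. by move=> bh bk; rewrite cintD// ?cintN//; exact: bmeasN. Qed.

Lemma cintJ h : bmeas D h -> cint (fun x => Num.conj (h x)) = Num.conj (cint h).
Proof.
move=> /bmeas_integrable[h1 h2]; rewrite /cint; apply: complex_eqP.
  by rewrite cReJ /=; under [LHS]eq_Rintegral do rewrite cReJ.
rewrite cImJ /=; under [LHS]eq_Rintegral do rewrite cImJ -mulN1r.
by rewrite RintegralZl// mulN1r.
Qed.

Lemma cint_sum (I : Type) (s : seq I) (F : I -> T -> R[i]) :
  (forall i, bmeas D (F i)) ->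
  cint (fun x => \sum_(i <- s) F i x) = \sum_(i <- s) cint (F i).
Proof.
move=> bF; elim: s => [|i s IH].
  under eq_cint do rewrite big_nil.
  by rewrite big_nil cint_cst mul0r.
under eq_cint do rewrite big_cons.
by rewrite big_cons cintD// ?IH//; exact: bmeas_sum.
Qed.

Lemma integrable_cst_fin (M : R) : mu.-integrable D (EFin \o (fun=> M)).
Proof.
apply: measurable_bounded_integrable => //.
by exists `|M|; split; rewrite ?num_real// => y My x Dx /=; exact: ltW.
Qed.

(* The constant 2 is not sharp; bounding the real and imaginary parts
   separately is enough here. *)
Lemma cint_le h (M : R) : bmeas D h -> (forall x, D x -> cabs (h x) <= M) ->
  cabs (cint h) <= 2 * M * fine (mu D).
Proof.
move=> bh hM; have [h1 h2] := bmeas_integrable bh.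
have iM := integrable_cst_fin M.
apply: (le_trans (cabs_le_ReIm _)); rewrite -mulrA mulr2n mulrDl !mul1r.
by apply: lerD; rewrite -Rintegral_cst//;
  apply: (le_trans (le_normr_Rintegral _ _)) => //; apply: le_Rintegral => //;
  rewrite ?integrable_norm// => x Dx; apply: le_trans (hM x Dx);
  rewrite ?ler_Re ?ler_Im.
Qed.

Lemma cint_Re_ge h (M : R) : bmeas D h ->
  (forall x, D x -> M <= complex.Re (h x)) ->
  M * fine (mu D) <= complex.Re (cint h).
Proof.
move=> bh hM; have [h1 h2] := bmeas_integrable bh.
have iM := integrable_cst_fin M.
by rewrite -Rintegral_cst//; apply: le_Rintegral.
Qed.

Lemma cvg_ReIm (u : R[i] ^nat) (l : R[i]) :
  (forall e : R, 0 < e -> \forall n \near \oo, cabs (u n - l) <= e) ->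
  (complex.Re (u n) @[n --> \oo] --> complex.Re l) /\
  (complex.Im (u n) @[n --> \oo] --> complex.Im l).
Proof.
move=> ul; split; apply/cvgrPdist_le => e /ul; apply: filterS => n.
  by apply: le_trans; rewrite distrC -cReN -cReD ler_Re.
by apply: le_trans; rewrite distrC -cImN -cImD ler_Im.
Qed.

(** Dominated convergence for the real and imaginary parts, with the constant M as majorant. Limits
    in [R[i]] are expressed through [cabs], here and below. *)
Lemma cint_dominated (h : nat -> T -> R[i]) (k : T -> R[i]) (M : R) :
  (forall n, bmeas D (h n)) -> (forall n x, D x -> cabs (h n x) <= M) ->
  (forall x, D x -> forall e : R, 0 < e ->
    \forall n \near \oo, cabs (h n x - k x) <= e) ->
  bmeas D k /\
  forall e : R, 0 < e -> \forall n \near \oo, cabs (cint (h n) - cint k) <= e.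
Proof.
move=> bh hM hk.
have kR x : D x -> complex.Re (h n x) @[n --> \oo] --> complex.Re (k x).
  by move=> Dx; have [] := cvg_ReIm (hk x Dx).
have kI x : D x -> complex.Im (h n x) @[n --> \oo] --> complex.Im (k x).
  by move=> Dx; have [] := cvg_ReIm (hk x Dx).
have mR : measurable_fun D (fun x => complex.Re (k x)).
  by apply: measurable_fun_cvg kR => n; have [] := bh n.
have mI : measurable_fun D (fun x => complex.Im (k x)).
  by apply: measurable_fun_cvg kI => n; have [] := bh n.
have kM x : D x -> cabs (k x) <= M.
  move=> Dx; apply/ler_addgt0Pr => e e0.
  have [n _ /(_ _ (leqnn n)) hn] := hk x Dx e e0.
  rewrite -[k x](subKr (h n x)) (le_trans (cabsB _ _))// lerD ?hM//.
split; first by split => //; exists M.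
have iM := integrable_cst_fin M.
have bk : bmeas D k by split => //; exists M.
have [ik1 ik2] := bmeas_integrable bk.
have cv (u : nat -> T -> R) (v : T -> R) :
    (forall n, measurable_fun D (u n)) -> measurable_fun D v ->
    (forall x, D x -> u n x @[n --> \oo] --> v x) ->
    (forall n x, D x -> `|u n x| <= M) -> mu.-integrable D (EFin \o v) ->
    Rintegral mu D (u n) @[n --> \oo] --> Rintegral mu D v.
  move=> mu' mv uv uM iv; apply: fine_cvg.
  rewrite fineK; last exact: integrable_fin_num.
  have [|||||_ _ //] := @dominated_convergence _ _ _ mu _ mD (fun n => EFin \o u n)
    (EFin \o v) (EFin \o (fun=> M)).
  - by move=> n; apply/measurable_EFinP.
  - exact/measurable_EFinP.
  - apply: aeW => x Dx; apply: cvg_EFin; last exact: uv.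
    by near=> n.
  - exact: iM.
  - by apply: aeW => x n Dx /=; rewrite lee_fin uM.
move=> e e0.
have e20 : 0 < e / 2 by rewrite divr_gt0.
have c1 : complex.Re (cint (h n)) @[n --> \oo] --> complex.Re (cint k).
  apply: cv => //; first by move=> n; have [] := bh n.
  by move=> n x Dx; rewrite (le_trans (ler_Re _))// hM.
have c2 : complex.Im (cint (h n)) @[n --> \oo] --> complex.Im (cint k).
  apply: cv => //; first by move=> n; have [] := bh n.
  by move=> n x Dx; rewrite (le_trans (ler_Im _))// hM.
move/cvgrPdist_le : c1 => /(_ _ e20) c1; move/cvgrPdist_le : c2 => /(_ _ e20) c2.
near=> n.
apply: (le_trans (cabs_le_ReIm _)); rewrite [leRHS]splitr cReD cImD cReN cImN.
by apply: lerD; rewrite distrC; near: n.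
Unshelve. all: by end_near. Qed.

End complex_integral.

(** * Goursat's lemma and Cauchy's formula *)

Section goursat.
Variable R : realType.

(* [f] is differentiable at [(x, y)] with partial derivatives [al] and [be] *)
Definition diff2 (f : R -> R -> R) (x y al be : R) : Prop :=
  forall e : R, 0 < e -> exists2 del : R, 0 < del & forall u v : R,
    `|u - x| <= del -> `|v - y| <= del ->
    `|f u v - f x y - (al * (u - x) + be * (v - y))|
      <= e * (`|u - x| + `|v - y|).

(** The mean value theorem for F minus the quadratic primitive of k + al (x - x0). *)
Lemma mvt_quadratic (F f : R -> R) (a b k al x0 M : R) : a < b ->
  (forall x, x \in `]a, b[ -> is_derive x 1 F (f x)) ->
  {within `[a, b], continuous F} ->
  (forall x, x \in `]a, b[ -> `|f x - (k + al * (x - x0))| <= M) ->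
  `|F b - F a - (k * (b - a) + al / 2 * ((b - x0) ^+ 2 - (a - x0) ^+ 2))|
    <= M * (b - a).
Proof.
move=> ab dF cF fM.
pose G x := F x - (k * x + al / 2 * (x - x0) ^+ 2).
have dG x : x \in `]a, b[ -> is_derive x 1 G (f x - (k + al * (x - x0))).
  move=> /dF dFx; apply: is_derive_eq.
  by rewrite /GRing.scale /=; field.
have cG : {within `[a, b], continuous G}.
  have cq : continuous (fun x => k * x + al / 2 * (x - x0) ^+ 2).
    move=> z; apply: cvgD; first by apply: cvgM; [exact: cvg_cst|exact: cvg_id].
    apply: cvgM; first exact: cvg_cst.
    by apply: cvgM; (apply: cvgB; [exact: cvg_id|exact: cvg_cst]).
  move=> x; apply: cvgB; first exact: cF.
  exact: (continuous_subspaceT cq).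
have [x xab] := MVT ab dG cG.
have -> : G b - G a =
    F b - F a - (k * (b - a) + al / 2 * ((b - x0) ^+ 2 - (a - x0) ^+ 2)).
  by rewrite /G; field.
move=> ->; rewrite normrM [X in _ * X <= _]ger0_norm; last by rewrite subr_ge0 ltW.
by rewrite ler_wpM2r ?subr_ge0 ?fM// ltW.
Qed.

Lemma dist_itv (x s u v : R) :
  x <= u -> u <= x + s -> x <= v -> v <= x + s -> `|u - v| <= s.
Proof. by move=> *; rewrite ler_norml; apply/andP; split; lra. Qed.

(** The point is the supremum of the left end points. *)
Lemma nested_point (x c : nat -> R) :
  (forall n, x n <= x n.+1) ->
  (forall n, x n.+1 + c n.+1 <= x n + c n) -> (forall n, 0 <= c n) ->
  exists z : R, forall n, x n <= z <= x n + c n.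
Proof.
move=> xS cS c0.
have xi n m : (n <= m)%N -> x n <= x m.
  by apply: (homo_leq (fun y => lexx y) (fun y u w => @le_trans _ _ y u w)).
have ci n m : (n <= m)%N -> x m + c m <= x n + c n.
  move=> /subnK <-; elim: (m - n)%N => [|k IH]; first by rewrite add0n.
  by rewrite addSn (le_trans (cS _)).
have xc n m : x n <= x m + c m.
  have [/xi h|/ltnW/ci h] := leqP n m; first by rewrite (le_trans h)// lerDl.
  by rewrite (le_trans _ h)// lerDl.
exists (sup (range x)) => n; apply/andP; split.
  apply: ub_le_sup; last by exists n.
  by exists (x 0 + c 0) => _ [m _ <-]; exact: xc.
by apply: ge_sup; [exists (x 0), 0|move=> _ [m _ <-]; exact: xc].
Qed.

(** X is a primitive of p in the first variable and Y of q in the second. Increments of X and Y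
    replace integrals along the sides of a rectangle, so that the mean value theorem suffices for
    the estimates. *)
Variables (p q X Y : R -> R -> R) (a b c d : R).
Hypotheses (ab : a < b) (cd : c < d).
Hypothesis dX : forall x y : R, x \in `]a, b[ -> y \in `[c, d] ->
  is_derive x 1 (X ^~ y) (p x y).
Hypothesis cX : forall y : R, y \in `[c, d] -> {within `[a, b], continuous (X ^~ y)}.
Hypothesis dY : forall x y : R, x \in `[a, b] -> y \in `]c, d[ ->
  is_derive y 1 (Y x) (q x y).
Hypothesis cY : forall x : R, x \in `[a, b] -> {within `[c, d], continuous (Y x)}.
(** The shared [be] is the equality of dp/dy and dq/dx, at each point separately, as in Goursat's
    lemma. *)
Hypothesis closed_form : forall x y : R, x \in `[a, b] -> y \in `[c, d] ->
  exists al be ga : R, diff2 p x y al be /\ diff2 q x y be ga.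

(* the integral of p dx + q dy along the boundary of [a', b'] x [c', d'] *)
Definition circulation a' b' c' d' :=
  (X b' c' - X a' c') - (X b' d' - X a' d') +
  (Y b' d' - Y b' c') - (Y a' d' - Y a' c').

(** Only the remainders of p and q at (x0, y0) contribute: the terms in [al] and [ga] cancel between
    opposite sides, and the two terms be s t cancel because the form is closed. Each remainder is at
    most e (s + t) times the length of its side. *)
Lemma circulation_small (x0 y0 e : R) : x0 \in `[a, b] -> y0 \in `[c, d] -> 0 < e ->
  exists2 del : R, 0 < del & forall x y s t : R, 0 < s <= del -> 0 < t <= del ->
    a <= x -> x + s <= b -> c <= y -> y + t <= d ->
    x <= x0 <= x + s -> y <= y0 <= y + t ->
    `|circulation x (x + s) y (y + t)| <= 2 * e * (s + t) ^+ 2.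
Proof.
move=> x0ab y0cd e0.
have [al [be [ga [dp dq]]]] := closed_form x0ab y0cd.
have [d1 d10 {}dp] := dp e e0; have [d2 d20 {}dq] := dq e e0.
exists (Num.min d1 d2); first by rewrite lt_min d10.
move=> x y s t /andP[s0]; rewrite le_min => /andP[s1 s2] /andP[t0].
rewrite le_min => /andP[t1 t2] ax xb cy yd /andP[xl xr] /andP[yl yr].
have sub_within u v u' v' (f : R -> R) : u' <= u -> v <= v' ->
    {within `[u', v'], continuous f} -> {within `[u, v], continuous f}.
  move=> h1 h2; apply: continuous_subspaceW => z /=; rewrite !in_itv/=.
  by move=> /andP[z1 z2]; rewrite (le_trans h1)// (le_trans z2).
have bndX y' : y <= y' <= y + t ->
  `|X (x + s) y' - X x y' - ((p x0 y0 + be * (y' - y0)) * (x + s - x) +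
     al / 2 * ((x + s - x0) ^+ 2 - (x - x0) ^+ 2))| <= e * (s + t) * (x + s - x).
  move=> /andP[y1 y2].
  have y'cd : y' \in `[c, d] by rewrite in_itv /= (le_trans cy)// (le_trans y2).
  have xxs : x < x + s by rewrite ltrDl.
  have dX' (z : R) : z \in `]x, x + s[ -> is_derive z 1 (X ^~ y') (p z y').
    rewrite in_itv/= => /andP[z1 z2]; apply: dX => //.
    by rewrite in_itv /= (le_lt_trans ax)// (lt_le_trans z2).
  apply: (mvt_quadratic xxs dX').
  - by apply: (sub_within _ _ a b) => //; exact: cX.
  - move=> z; rewrite in_itv/= => /andP[/ltW z1 /ltW z2].
    have zs := dist_itv z1 z2 xl xr; have yt := dist_itv y1 y2 yl yr.
    have := dp z y' (le_trans zs s1) (le_trans yt t1).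
    have -> : p z y' - (p x0 y0 + be * (y' - y0) + al * (z - x0)) =
      p z y' - p x0 y0 - (al * (z - x0) + be * (y' - y0)) by ring.
    by move/le_trans; apply; apply: ler_wpM2l; [exact: ltW|exact: lerD].
have bndY x' : x <= x' <= x + s ->
  `|Y x' (y + t) - Y x' y - ((q x0 y0 + be * (x' - x0)) * (y + t - y) +
     ga / 2 * ((y + t - y0) ^+ 2 - (y - y0) ^+ 2))| <= e * (s + t) * (y + t - y).
  move=> /andP[x1 x2].
  have x'cd : x' \in `[a, b] by rewrite in_itv /= (le_trans ax)// (le_trans x2).
  have yyt : y < y + t by rewrite ltrDl.
  have dY' (z : R) : z \in `]y, y + t[ -> is_derive z 1 (Y x') (q x' z).
    rewrite in_itv/= => /andP[z1 z2]; apply: dY => //.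
    by rewrite in_itv /= (le_lt_trans cy)// (lt_le_trans z2).
  apply: (mvt_quadratic yyt dY').
  - by apply: (sub_within _ _ c d) => //; exact: cY.
  - move=> z; rewrite in_itv/= => /andP[/ltW z1 /ltW z2].
    have xs := dist_itv x1 x2 xl xr; have zt := dist_itv z1 z2 yl yr.
    have := dq x' z (le_trans xs s2) (le_trans zt t2).
    have -> : q x' z - (q x0 y0 + be * (x' - x0) + ga * (z - y0)) =
      q x' z - q x0 y0 - (be * (x' - x0) + ga * (z - y0)) by ring.
    by move/le_trans; apply; apply: ler_wpM2l; [exact: ltW|exact: lerD].
have yl' : y <= y <= y + t by rewrite lexx lerDl ltW.
have yr' : y <= y + t <= y + t by rewrite lexx lerDl ltW.
have xl' : x <= x <= x + s by rewrite lexx lerDl ltW.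
have xr' : x <= x + s <= x + s by rewrite lexx lerDl ltW.
move: (bndX _ yl') (bndX _ yr') (bndY _ xl') (bndY _ xr').
rewrite !ler_norml /circulation => /andP[A1 A2] /andP[B1 B2] /andP[C1 C2] /andP[D1 D2].
have -> : 2 * e * (s + t) ^+ 2 = 2 * (e * (s + t) * (x + s - x)) + 2 * (e * (s + t) * (y + t - y)) by ring.
have E1 : (p x0 y0 + be * (y - y0)) * (x + s - x) - (p x0 y0 + be * (y + t - y0)) * (x + s - x)
  = - (be * s * t) by ring.
have E2 : (q x0 y0 + be * (x + s - x0)) * (y + t - y) - (q x0 y0 + be * (x - x0)) * (y + t - y)
  = be * s * t by ring.
move: A1 A2 B1 B2 C1 C2 D1 D2 E1 E2; clear.
by move=> *; apply/andP; split; lra.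
Qed.

Lemma circulation_split (x y s t : R) :
  circulation x (x + (s + s)) y (y + (t + t)) =
  circulation x (x + s) y (y + t) +
  circulation (x + s) (x + s + s) y (y + t) +
  circulation x (x + s) (y + t) (y + t + t) +
  circulation (x + s) (x + s + s) (y + t) (y + t + t).
Proof. by rewrite (addrA x) (addrA y) /circulation; ring. Qed.

(** Bisection keeps a quarter whose circulation exceeds [eta] times its area; near the common point
    of the nested rectangles this contradicts [circulation_small]. *)
Theorem goursat : circulation a b c d = 0.
Proof.
apply/eqP; apply/negPn/negP => J0.
pose s n : R := (b - a) / 2 ^+ n; pose t n : R := (d - c) / 2 ^+ n.
have sS n : s n.+1 = s n / 2 by rewrite /s exprS invfM; ring.
have tS n : t n.+1 = t n / 2 by rewrite /t exprS invfM; ring.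
have s_gt0 n : 0 < s n by rewrite divr_gt0 ?subr_gt0// exprn_gt0.
have t_gt0 n : 0 < t n by rewrite divr_gt0 ?subr_gt0// exprn_gt0.
(* Half the ratio of circulation to area for the whole rectangle, which makes the inequality in
   [bad] strict at the start. *)
pose eta := `|circulation a b c d| / (2 * (s 0 * t 0)).
have eta0 : 0 < eta by rewrite divr_gt0 ?normr_gt0// mulr_gt0// mulr_gt0.
pose bad n (z : R * R) := [/\ a <= z.1, z.1 + s n <= b, c <= z.2, z.2 + t n <= d &
  eta * (s n * t n) < `|circulation z.1 (z.1 + s n) z.2 (z.2 + t n)|].
have bad0 : bad 0 (a, c).
  split => //=; rewrite ?/s ?/t ?expr0 ?divr1 ?lexx//; try by rewrite addrC subrK.
  rewrite [a + _]addrC [c + _]addrC !subrK /eta /s /t expr0 !divr1.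
  set J := `|_|; have J1 : 0 < J by rewrite normr_gt0.
  have -> : J / (2 * ((b - a) * (d - c))) * ((b - a) * (d - c)) = J / 2.
    by field; rewrite !subr_eq0 !gt_eqF.
  by rewrite ltr_pdivrMr// mulr_natr mulr2n ltrDl.
have step n z : bad n z -> exists z', [/\ bad n.+1 z', z.1 <= z'.1,
    z'.1 + s n.+1 <= z.1 + s n, z.2 <= z'.2 & z'.2 + t n.+1 <= z.2 + t n].
  clear J0 eta0 bad0; case: z => x y; rewrite /bad /= => -[h1 h2 h3 h4].
  move=> h5; have sn := s_gt0 n.+1; have tn := t_gt0 n.+1.
  have sE : s n = s n.+1 + s n.+1 by rewrite sS; field.
  have tE : t n = t n.+1 + t n.+1 by rewrite tS; field.
  move: h2 h4 h5; rewrite sE tE circulation_split => h2 h4.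
  set J1 := (X in X + _ + _ + _); set J2 := (X in _ + X + _ + _).
  set J3 := (X in _ + _ + X + _); set J4 := (X in _ + _ + _ + X) => h5.
  have [j1|j1] := ltP (eta * (s n.+1 * t n.+1)) `|J1|.
    by exists (x, y); split => //=; first split => //=; lra.
  have [j2|j2] := ltP (eta * (s n.+1 * t n.+1)) `|J2|.
    by exists (x + s n.+1, y); split => //=; first split => //=; lra.
  have [j3|j3] := ltP (eta * (s n.+1 * t n.+1)) `|J3|.
    by exists (x, y + t n.+1); split => //=; first split => //=; lra.
  have [j4|j4] := ltP (eta * (s n.+1 * t n.+1)) `|J4|.
    by exists (x + s n.+1, y + t n.+1); split => //=; first split => //=; lra.
  have := ler_normD (J1 + J2 + J3) J4; have := ler_normD (J1 + J2) J3.
  by have := ler_normD J1 J2; nra.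
pose nx n z := if pselect (bad n z) is left h then projT1 (cid (step n z h)) else z.
pose f := fix f n := if n is m.+1 then nx m (f m) else (a, c).
have badf n : bad n (f n).
  elim: n => [//|n IH] /=; rewrite /nx; case: pselect => // h.
  by have [] := projT2 (cid (step n (f n) h)).
have fS n : [/\ (f n).1 <= (f n.+1).1, (f n.+1).1 + s n.+1 <= (f n).1 + s n,
    (f n).2 <= (f n.+1).2 & (f n.+1).2 + t n.+1 <= (f n).2 + t n].
  rewrite /= /nx; case: pselect => // h.
  by have [] := projT2 (cid (step n (f n) h)).
have [x0 x0P] : exists z : R, forall n, (f n).1 <= z <= (f n).1 + s n.
  by apply: nested_point => n; [have [] := fS n|have [] := fS n|exact: ltW].
have [y0 y0P] : exists z : R, forall n, (f n).2 <= z <= (f n).2 + t n.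
  by apply: nested_point => n; [have [] := fS n|have [] := fS n|exact: ltW].
have x0ab : x0 \in `[a, b].
  by have [? ? ? ? _] := badf 0; have /andP[? ?] := x0P 0; rewrite in_itv/=; apply/andP; split; lra.
have y0cd : y0 \in `[c, d].
  by have [? ? ? ? _] := badf 0; have /andP[? ?] := y0P 0; rewrite in_itv/=; apply/andP; split; lra.
have st0 : 0 < s 0 + t 0 by rewrite addr_gt0.
(* All rectangles have the same shape, so this value makes the bound 2 e (s n + t n) ^ 2 equal to
   eta (s n) (t n) for every n. *)
pose e := eta * (s 0 * t 0) / (2 * (s 0 + t 0) ^+ 2).
have e0 : 0 < e.
  apply: divr_gt0; first by rewrite mulr_gt0// mulr_gt0.
  by rewrite mulr_gt0// exprn_gt0.
have [del del0 hdel] := circulation_small x0ab y0cd e0.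
have [n [sn tn]] : exists n, s n <= del /\ t n <= del.
  have hc : 2^-1 ^+ n @[n --> \oo] --> (0 : R).
    by apply: cvg_expr; rewrite ger0_norm// invf_lt1// ltr1n.
  have hs (L : R) : 0 < L -> \forall n \near \oo, L / 2 ^+ n <= del.
    move=> L0; have dL : 0 < del / L by rewrite divr_gt0.
    move/cvgrPdist_le : hc => /(_ _ dL); apply: filterS => n.
    rewrite sub0r normrN ger0_norm ?exprn_ge0// exprVn => h.
    by rewrite mulrC -ler_pdivlMr.
  have ba : 0 < b - a by rewrite subr_gt0. have dc : 0 < d - c by rewrite subr_gt0.
  by have [n _ /(_ _ (leqnn n)) hn] := filterI (hs _ ba) (hs _ dc); exists n.
have [h1 h2 h3 h4] := badf n; apply/negP; rewrite -leNgt.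
apply: (le_trans (hdel _ _ _ _ _ _ h1 h2 h3 h4 (x0P n) (y0P n))).
- by rewrite s_gt0.
- by rewrite t_gt0.
have sE : s n = s 0 / 2 ^+ n by rewrite /s expr0 divr1.
have tE : t n = t 0 / 2 ^+ n by rewrite /t expr0 divr1.
have key (S T E k : R) : 0 < S + T -> k != 0 ->
    2 * (E * (S * T) / (2 * (S + T) ^+ 2)) * (S / k + T / k) ^+ 2 = E * (S / k * (T / k)).
  by move=> ST0 k0; field; rewrite k0 gt_eqF.
by rewrite sE tE key ?lexx// expf_neq0// pnatr_eq0.
Qed.
End goursat.

(** * Complex derivatives, and differentials in two real variables *)

Section complex_differentiability.
Variable R : realType.
Implicit Types (F : R[i] -> R[i]) (G H : R -> R -> R[i]).

Definition cdiff F (z d : R[i]) : Prop :=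
  forall e : R, 0 < e -> exists2 del : R, 0 < del & forall w,
    cabs (w - z) <= del -> cabs (F w - F z - d * (w - z)) <= e * cabs (w - z).

(** With complex partial derivatives the chain rule with [cdiff] is a multiplication; [cdiff2_ReIm]
    then returns to [diff2]. *)
Definition cdiff2 G (x y : R) (al be : R[i]) : Prop :=
  forall e : R, 0 < e -> exists2 del : R, 0 < del & forall u v : R,
    `|u - x| <= del -> `|v - y| <= del ->
    cabs (G u v - G x y - (al * (u - x)%:C + be * (v - y)%:C))
      <= e * (`|u - x| + `|v - y|).

Lemma cdiff2_ReIm G x y al be : cdiff2 G x y al be ->
  diff2 (fun u v => complex.Re (G u v)) x y (complex.Re al) (complex.Re be) /\
  diff2 (fun u v => complex.Im (G u v)) x y (complex.Im al) (complex.Im be).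
Proof.
move=> dG; split => e e0; have [del del0 h] := dG e e0; exists del => // u v ux vy.
  apply: le_trans (h u v ux vy); apply: le_trans (ler_Re _).
  by rewrite !(cReD, cReN, cReM) /= !mulr0 !subr0.
apply: le_trans (h u v ux vy); apply: le_trans (ler_Im _).
by rewrite !(cImD, cImN, cImM) /= !mulr0 !add0r.
Qed.

Lemma cdiff2_lip G x y al be : cdiff2 G x y al be ->
  exists2 L : R, 0 < L & exists2 del : R, 0 < del & forall u v : R,
    `|u - x| <= del -> `|v - y| <= del ->
    cabs (G u v - G x y) <= L * (`|u - x| + `|v - y|).
Proof.
move=> dG; have [del del0 h] := dG 1 ltr01.
exists (1 + (cabs al + cabs be)).
  by rewrite ltr_pwDl// addr_ge0 ?cabs_ge0.
exists del => // u v ux vy.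
rewrite -[X in cabs X](subrK (al * (u - x)%:C + be * (v - y)%:C)).
apply: (le_trans (cabsD _ _)); rewrite mulrDl lerD ?h//.
apply: (le_trans (cabsD _ _)); rewrite !cabsM !cabsR.
have := cabs_ge0 al; have := cabs_ge0 be.
have := normr_ge0 (u - x); have := normr_ge0 (v - y).
by move: `|u - x| `|v - y| (cabs al) (cabs be) => a b c d; clear; move=> *; nra.
Qed.

Lemma cdiff2_cst (c : R[i]) x y : cdiff2 (fun _ _ => c) x y 0 0.
Proof.
move=> e e0; exists 1 => // u v _ _.
by rewrite subrr !mul0r addr0 subrr cabs0 mulr_ge0 ?addr_ge0// ltW.
Qed.

Lemma cdiff2D G H x y al be al' be' : cdiff2 G x y al be -> cdiff2 H x y al' be' ->
  cdiff2 (fun u v => G u v + H u v) x y (al + al') (be + be').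
Proof.
move=> dG dH e e0; have e20 : 0 < e / 2 by rewrite divr_gt0.
have [d1 d10 h1] := dG _ e20; have [d2 d20 h2] := dH _ e20.
exists (Num.min d1 d2) => [|u v]; first by rewrite lt_min d10.
rewrite !le_min => /andP[u1 u2] /andP[v1 v2].
have -> : G u v + H u v - (G x y + H x y) -
    ((al + al') * (u - x)%:C + (be + be') * (v - y)%:C) =
  (G u v - G x y - (al * (u - x)%:C + be * (v - y)%:C)) +
  (H u v - H x y - (al' * (u - x)%:C + be' * (v - y)%:C)) by ring.
apply: (le_trans (cabsD _ _)); rewrite [e in leRHS]splitr mulrDl lerD ?h1 ?h2//.
Qed.

Lemma cdiff2M G H x y al be al' be' : cdiff2 G x y al be -> cdiff2 H x y al' be' ->
  cdiff2 (fun u v => G u v * H u v) x y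
    (al * H x y + G x y * al') (be * H x y + G x y * be').
Proof.
move=> dG dH e e0.
have [L L0 [dl dl0 hL]] := cdiff2_lip dG.
have [L' L'0 [dl' dl'0 hL']] := cdiff2_lip dH.
(* The added 1 keeps the divisors below positive when a value vanishes. *)
pose g := cabs (G x y) + 1; pose h := cabs (H x y) + 1.
have g0 : 0 < g by rewrite ltr_wpDl ?cabs_ge0.
have h0 : 0 < h by rewrite ltr_wpDl ?cabs_ge0.
have eh : 0 < e / (3 * h) by rewrite divr_gt0// mulr_gt0.
have eg : 0 < e / (3 * g) by rewrite divr_gt0// mulr_gt0.
have [d1 d10 h1] := dG _ eh; have [d2 d20 h2] := dH _ eg.
(* The product of the two increments is at most L L' S ^ 2, which S <= 2 d3 bounds by e / 3 times
   S. *)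
pose d3 := e / (6 * (L * L')).
have d30 : 0 < d3 by rewrite divr_gt0// mulr_gt0// mulr_gt0.
exists (Num.min (Num.min d1 d2) (Num.min d3 (Num.min dl dl'))) => [|u v].
  by rewrite !lt_min d10 d20 d30 dl0.
rewrite !le_min => /andP[/andP[u1 u2] /and3P[u3 u4 u5]].
move=> /andP[/andP[v1 v2] /and3P[v3 v4 v5]].
have -> : G u v * H u v - G x y * H x y - ((al * H x y + G x y * al') * (u - x)%:C +
    (be * H x y + G x y * be') * (v - y)%:C) =
  (G u v - G x y - (al * (u - x)%:C + be * (v - y)%:C)) * H x y +
  G x y * (H u v - H x y - (al' * (u - x)%:C + be' * (v - y)%:C)) +
  (G u v - G x y) * (H u v - H x y) by ring.
apply: (le_trans (cabsD _ _)).
apply: (le_trans (lerD (cabsD _ _) (lexx _))); rewrite !cabsM.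
move: (h1 u v u1 v1) (h2 u v u2 v2) (hL u v u4 v4) (hL' u v u5 v5).
set A := cabs (G u v - _ - _); set B := cabs (H u v - _ - _).
set S := `|u - x| + `|v - y| => hA hB hG hH.
have S0 : 0 <= S by rewrite addr_ge0.
have SE : S <= 2 * d3 by rewrite mulr2n mulrDl mul1r lerD.
have T1 : A * cabs (H x y) <= e / 3 * S.
  apply: (@le_trans _ _ (e / (3 * h) * S * h)).
    by apply: ler_pM; rewrite ?cabs_ge0// /h lerDl.
  by rewrite le_eqVlt; apply/orP; left; apply/eqP; field; rewrite gt_eqF.
have T2 : cabs (G x y) * B <= e / 3 * S.
  apply: (@le_trans _ _ (g * (e / (3 * g) * S))).
    by apply: ler_pM; rewrite ?cabs_ge0// /g lerDl.
  by rewrite le_eqVlt; apply/orP; left; apply/eqP; field; rewrite gt_eqF.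
have T3 : cabs (G u v - G x y) * cabs (H u v - H x y) <= e / 3 * S.
  apply: (@le_trans _ _ ((L * S) * (L' * (2 * d3)))).
    apply: ler_pM; rewrite ?cabs_ge0// (le_trans hH)// ler_wpM2l// ltW//.
  by rewrite /d3 le_eqVlt; apply/orP; left; apply/eqP; field; rewrite !gt_eqF.
by move: T1 T2 T3; clear; move=> *; lra.
Qed.

Lemma cdiff2_comp F G x y al be d : cdiff2 G x y al be -> cdiff F (G x y) d ->
  cdiff2 (fun u v => F (G u v)) x y (d * al) (d * be).
Proof.
move=> dG dF e e0.
have [L L0 [dl dl0 hL]] := cdiff2_lip dG.
have d0 : 0 < cabs d + 1 by rewrite ltr_wpDl ?cabs_ge0.
have e1 : 0 < e / (2 * (cabs d + 1)) by rewrite divr_gt0// mulr_gt0.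
have e2 : 0 < e / (2 * L) by rewrite divr_gt0// mulr_gt0.
have [d1 d10 h1] := dG _ e1; have [d2 d20 h2] := dF _ e2.
pose d3 := d2 / (2 * L).
have d30 : 0 < d3 by rewrite divr_gt0// mulr_gt0.
exists (Num.min d1 (Num.min d3 dl)) => [|u v]; first by rewrite !lt_min d10 d30.
rewrite !le_min => /and3P[u1 u2 u3] /and3P[v1 v2 v3].
have -> : F (G u v) - F (G x y) - (d * al * (u - x)%:C + d * be * (v - y)%:C) =
  (F (G u v) - F (G x y) - d * (G u v - G x y)) +
  d * (G u v - G x y - (al * (u - x)%:C + be * (v - y)%:C)) by ring.
apply: (le_trans (cabsD _ _)); rewrite cabsM.
move: (h1 u v u1 v1) (hL u v u3 v3).
set A := cabs (G u v - _ - _); set S := `|u - x| + `|v - y| => hA hG.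
have S0 : 0 <= S by rewrite addr_ge0.
have SE : S <= 2 * d3 by rewrite mulr2n mulrDl mul1r lerD.
have GE : cabs (G u v - G x y) <= d2.
  apply: (le_trans hG); apply: (@le_trans _ _ (L * (2 * d3))).
    by rewrite ler_wpM2l// ltW.
  by rewrite /d3 le_eqVlt; apply/orP; left; apply/eqP; field; rewrite gt_eqF.
have T1 : cabs d * A <= e / 2 * S.
  apply: (@le_trans _ _ ((cabs d + 1) * (e / (2 * (cabs d + 1)) * S))).
    by apply: ler_pM; rewrite ?cabs_ge0// lerDl.
  by rewrite le_eqVlt; apply/orP; left; apply/eqP; field; rewrite gt_eqF.
have T2 : cabs (F (G u v) - F (G x y) - d * (G u v - G x y)) <= e / 2 * S.
  apply: (le_trans (h2 _ GE)); apply: (@le_trans _ _ (e / (2 * L) * (L * S))).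
    by rewrite ler_wpM2l// ltW.
  by rewrite le_eqVlt; apply/orP; left; apply/eqP; field; rewrite gt_eqF.
by move: T1 T2; clear; move=> *; lra.
Qed.

Lemma cdiffV (z : R[i]) : z != 0 -> cdiff (fun w => w^-1) z (- (z ^+ 2)^-1).
Proof.
move=> z0 e e0; pose r := cabs z; have r0 : 0 < r by rewrite cabs_gt0.
(* The first bound gives |w| >= r / 2, and with it the second gives |w - z| <= e |w| r ^ 2. *)
pose dl := Num.min (r / 2) (e * r ^+ 3 / 2).
exists dl => [|w]; first by rewrite lt_min !divr_gt0 ?mulr_gt0 ?exprn_gt0.
rewrite le_min => /andP[w1 w2].
have wr : r / 2 <= cabs w.
  have := cabsB w (w - z); rewrite subKr -/r => h; move: h w1; clear.
  by move=> *; lra.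
have w0 : w != 0 by rewrite -cabs_gt0 (lt_le_trans _ wr)// divr_gt0.
have -> : w^-1 - z^-1 - - (z ^+ 2)^-1 * (w - z) = (w - z) * ((w - z) / (w * z ^+ 2)).
  by field; rewrite w0 z0.
rewrite cabsM mulrC ler_wpM2r ?cabs_ge0// !(cabsM, cabsV, cabsX) -/r.
rewrite ler_pdivrMr ?mulr_gt0 ?exprn_gt0// ?cabs_gt0//.
apply: (le_trans w2); apply: (@le_trans _ _ (e * (r / 2 * r ^+ 2))).
  by rewrite le_eqVlt; apply/orP; left; apply/eqP; field.
by rewrite ler_wpM2l ?(ltW e0)// ler_wpM2r// exprn_ge0// ltW.
Qed.

End complex_differentiability.

(** * Goursat's lemma for complex integrals over the sides of a rectangle *)

Section circle_integrals.
Variable R : realType.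
Local Notation leb := (@lebesgue_measure R).
Implicit Types (F : R[i] -> R[i]) (h : R -> R[i]).

Definition ccont h (x : R) : Prop := forall e : R, 0 < e ->
  exists2 del : R, 0 < del & forall u, `|u - x| <= del -> cabs (h u - h x) <= e.

Lemma near_dist_le (x del : R) : 0 < del -> \forall u \near x, `|u - x| <= del.
Proof.
move=> del0; have /cvgrPdist_le/(_ _ del0) := @cvg_id _ (nbhs x).
by apply: filterS => u; rewrite distrC.
Qed.

Lemma ccont_ReIm h x : ccont h x ->
  {for x, continuous (fun u => complex.Re (h u))} /\
  {for x, continuous (fun u => complex.Im (h u))}.
Proof.
move=> hx; split; apply/cvgrPdist_le => e e0; have [del del0 hd] := hx e e0;
  apply: filterS (near_dist_le x del0) => u /hd; apply: le_trans; rewrite distrC.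
  by rewrite -cReN -cReD ler_Re.
by rewrite -cImN -cImD ler_Im.
Qed.

Lemma bmeas_ccont h (a b : R) :
  (forall x : R, x \in `[a, b] -> ccont h x) -> bmeas `[a, b] h.
Proof.
move=> hc.
have cR : {within `[a, b], continuous (fun u => complex.Re (h u))}.
  apply: continuous_in_subspaceT => x; rewrite inE => /hc/ccont_ReIm[]//.
have cI : {within `[a, b], continuous (fun u => complex.Im (h u))}.
  apply: continuous_in_subspaceT => x; rewrite inE => /hc/ccont_ReIm[]//.
have bnd (f : R -> R) : {within `[a, b], continuous f} ->
    exists M : R, forall x, x \in `[a, b] -> `|f x| <= M.
  move=> cf; have [ab|ba] := leP a b; last first.
    exists 0 => x; rewrite in_itv/= => /andP[ax xb].
    by have := le_trans ax xb; rewrite leNgt ba.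
  have [c _ hc'] := EVT_max ab cf; have [c' _ hc''] := EVT_min ab cf.
  exists (Num.max `|f c| `|f c'|) => x xab.
  rewrite ler_norml le_max; apply/andP; split.
    rewrite lerNl; apply: (@le_trans _ _ (- f c')); first by rewrite lerN2 hc''.
    by rewrite le_max; apply/orP; right; rewrite -normrN ler_norm.
  by apply/orP; left; rewrite (le_trans (hc' x xab))// ler_norm.
have [M hM] := bnd _ cR; have [M' hM'] := bnd _ cI.
split.
- by apply: subspace_continuous_measurable_fun.
- by apply: subspace_continuous_measurable_fun.
- by exists (M + M') => x xab; rewrite (le_trans (cabs_le_ReIm _))// lerD ?hM ?hM'.
Qed.

Lemma primitive (f : R -> R) (a b : R) : a < b ->
  (forall x : R, x \in `[a, b] -> {for x, continuous f}) ->
  let F (x : R) := Rintegral leb `[a, x] f in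
  (forall x : R, x \in `]a, b[ -> is_derive x 1 F (f x)) /\
  {within `[a, b], continuous F}.
Proof.
move=> ab cf F.
have cw : {within `[a, b], continuous f}.
  by apply: continuous_in_subspaceT => x; rewrite inE => /cf.
have fi : leb.-integrable `[a, b] (EFin \o f).
  by apply: continuous_compact_integrable => //; exact: segment_compact.
split; last by apply: parameterized_integral_continuous => //; exact: ltW.
move=> x; rewrite in_itv/= => /andP[ax xb].
have [|d1 d2] := continuous_FTC1_closed xb fi ax.
  by apply: cf; rewrite in_itv/= !ltW.
by move: d2; rewrite derive1E => d2; exact: (DeriveDef d1 d2).
Qed.

Let circulationE (p q : R -> R -> R) (a b c d : R) : a < b -> c < d ->
  (forall x y : R, x \in `[a, b] -> y \in `[c, d] -> {for x, continuous (p ^~ y)}) ->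
  (forall x y : R, x \in `[a, b] -> y \in `[c, d] -> {for y, continuous (q x)}) ->
  (forall x y : R, x \in `[a, b] -> y \in `[c, d] ->
    exists al be ga : R, diff2 p x y al be /\ diff2 q x y be ga) ->
  Rintegral leb `[a, b] (p ^~ c) - Rintegral leb `[a, b] (p ^~ d) +
  Rintegral leb `[c, d] (q b) - Rintegral leb `[c, d] (q a) = 0.
Proof.
move=> ab cd cp cq dpq.
pose X (x y : R) := Rintegral leb `[a, x] (p ^~ y).
pose Y (x y : R) := Rintegral leb `[c, y] (q x).
have X1 (x y : R) : x \in `]a, b[ -> y \in `[c, d] -> is_derive x 1 (X ^~ y) (p x y).
  move=> xab ycd; have [h _] := primitive ab (fun x xab => cp x y xab ycd).
  exact: h.
have X2 (y : R) : y \in `[c, d] -> {within `[a, b], continuous (X ^~ y)}.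
  by move=> ycd; have [_ h] := primitive ab (fun x xab => cp x y xab ycd).
have Y1 (x y : R) : x \in `[a, b] -> y \in `]c, d[ -> is_derive y 1 (Y x) (q x y).
  move=> xab ycd; have [h _] := primitive cd (fun y ycd => cq x y xab ycd).
  exact: h.
have Y2 (x : R) : x \in `[a, b] -> {within `[c, d], continuous (Y x)}.
  by move=> xab; have [_ h] := primitive cd (fun y ycd => cq x y xab ycd).
have := goursat ab cd X1 X2 Y1 Y2 dpq.
have z1 (u : R) (f : R -> R) : Rintegral leb `[u, u] f = 0.
  by rewrite set_itv1 Rintegral_set1.
by rewrite /circulation /X /Y !z1 !subr0.
Qed.

Lemma cdiff2_ccont (G : R -> R -> R[i]) x y al be : cdiff2 G x y al be ->
  ccont (G ^~ y) x /\ ccont (G x) y.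
Proof.
move=> /cdiff2_lip[L L0 [del del0 hL]]; split => e e0.
  exists (Num.min del (e / L)) => [|u]; first by rewrite lt_min del0 divr_gt0.
  rewrite le_min => /andP[u1 u2].
  have yy : `|y - y| <= del by rewrite subrr normr0 ltW.
  apply: (le_trans (hL u y u1 yy)).
  by rewrite subrr normr0 addr0 mulrC -ler_pdivlMr.
exists (Num.min del (e / L)) => [|u]; first by rewrite lt_min del0 divr_gt0.
rewrite le_min => /andP[u1 u2].
have xx : `|x - x| <= del by rewrite subrr normr0 ltW.
apply: (le_trans (hL x u xx u1)).
by rewrite subrr normr0 add0r mulrC -ler_pdivlMr.
Qed.

(** Closedness passes to the real and imaginary parts; the primitives required by [goursat] are the
    integrals from the lower end point. *)
Lemma goursat_complex (P Q : R -> R -> R[i]) (a b c d : R) : a < b -> c < d ->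
  (forall x y : R, x \in `[a, b] -> y \in `[c, d] ->
    exists al be ga : R[i], cdiff2 P x y al be /\ cdiff2 Q x y be ga) ->
  cint leb `[a, b] (P ^~ c) - cint leb `[a, b] (P ^~ d) +
  cint leb `[c, d] (Q b) - cint leb `[c, d] (Q a) = 0.
Proof.
move=> ab cd dPQ.
have c1 (x y : R) : x \in `[a, b] -> y \in `[c, d] -> ccont (P ^~ y) x.
  by move=> xab ycd; have [? [? [? [/cdiff2_ccont[]]]]] := dPQ x y xab ycd.
have c2 (x y : R) : x \in `[a, b] -> y \in `[c, d] -> ccont (Q x) y.
  by move=> xab ycd; have [? [? [? [_ /cdiff2_ccont[]]]]] := dPQ x y xab ycd.
apply: complex_eqP; rewrite !(cReD, cReN, cImD, cImN) /cint /=.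
  apply: (circulationE (p := fun x y => complex.Re (P x y))
    (q := fun x y => complex.Re (Q x y))) => //.
  - by move=> x y xab /(c1 x _ xab)/ccont_ReIm[].
  - by move=> x y xab /(c2 x _ xab)/ccont_ReIm[].
  move=> x y xab /(dPQ x _ xab)[al [be [ga [/cdiff2_ReIm[p _] /cdiff2_ReIm[q _]]]]].
  by exists (complex.Re al), (complex.Re be), (complex.Re ga).
apply: (circulationE (p := fun x y => complex.Im (P x y))
  (q := fun x y => complex.Im (Q x y))) => //.
- by move=> x y xab /(c1 x _ xab)/ccont_ReIm[].
- by move=> x y xab /(c2 x _ xab)/ccont_ReIm[].
move=> x y xab /(dPQ x _ xab)[al [be [ga [/cdiff2_ReIm[_ p] /cdiff2_ReIm[_ q]]]]].
by exists (complex.Im al), (complex.Im be), (complex.Im ga).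
Qed.

Definition cis (x : R) : R[i] := cos x +i* sin x.

Lemma cabs_cis x : cabs (cis x) = 1.
Proof. by rewrite cabsE /= cos2Dsin2 sqrtr1. Qed.

Lemma cis_neq0 x : cis x != 0.
Proof. by rewrite -cabs_eq0 cabs_cis oner_eq0. Qed.

Lemma cis_2pi : cis (pi *+ 2) = cis 0.
Proof. by rewrite /cis cos2pi sin2pi cos0 sin0. Qed.

Lemma is_derive_eps (f : R -> R) (x l : R) : is_derive x 1 f l ->
  forall e : R, 0 < e -> exists2 del : R, 0 < del & forall v : R,
    `|v - x| <= del -> `|f v - f x - l * (v - x)| <= e * `|v - x|.
Proof.
move=> [df fl] e e0.
have : h^-1 *: (f (h *: 1 + x) - f x) @[h --> 0^'] --> l.
  by move: df; rewrite /derivable -fl.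
move=> /cvgrPdist_le/(_ _ e0) /nbhs_ballP[del /= del0 hd].
exists (del / 2); first by rewrite divr_gt0.
move=> v vx; have [->|nvx] := eqVneq v x.
  by rewrite !subrr mulr0 subr0 normr0 mulr0.
have vx0 : v - x != 0 by rewrite subr_eq0.
have : ball 0 del (v - x).
  by rewrite /ball /= sub0r normrN (le_lt_trans vx)// gtr_pMr// invf_lt1// ltr1n.
move=> /hd /(_ vx0); rewrite /GRing.scale /= mulr1 subrK => h.
have -> : f v - f x - l * (v - x) = - ((l - (v - x)^-1 * (f v - f x)) * (v - x)).
  by field.
by rewrite normrN normrM ler_wpM2r.
Qed.

Lemma cdiff2_cis (x y : R) : cdiff2 (fun _ v => cis v) x y 0 ('i%C * cis y).
Proof.
move=> e e0; have e20 : 0 < e / 2 by rewrite divr_gt0.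
have [d1 d10 h1] := is_derive_eps (is_derive_cos y) e20.
have [d2 d20 h2] := is_derive_eps (is_derive_sin y) e20.
exists (Num.min d1 d2) => [|u v _]; first by rewrite lt_min d10.
rewrite le_min => /andP[v1 v2].
apply: (le_trans (cabs_le_ReIm _)).
rewrite !(cReD, cImD, cReN, cImN, cReM, cImM) /=.
have -> : cos v - cos y - (0 * (u - x) - 0 * 0 +
  ((0 * cos y - 1 * sin y) * (v - y) - (0 * sin y + 1 * cos y) * 0)) =
  cos v - cos y - - sin y * (v - y) by ring.
have -> : sin v - sin y - (0 * 0 + 0 * (u - x) +
  ((0 * cos y - 1 * sin y) * 0 + (0 * sin y + 1 * cos y) * (v - y))) =
  sin v - sin y - cos y * (v - y) by ring.
have := h1 v v1; have := h2 v v2; have := normr_ge0 (u - x).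
by move: `|u - x| `|v - y|; clear - e0; move=> *; nra.
Qed.

Lemma cdiff2_fst (x y : R) : cdiff2 (fun u _ => u%:C) x y 1 0.
Proof.
move=> e e0; exists 1 => // u v _ _.
have -> : u%:C - x%:C - (1 * (u - x)%:C + 0 * (v - y)%:C) = 0 :> R[i].
  by rewrite rmorphB; ring.
by rewrite cabs0 mulr_ge0 ?addr_ge0// ltW.
Qed.

End circle_integrals.

Section cauchy_formula.
Variable R : realType.
Local Notation leb := (@lebesgue_measure R).
Local Notation circ := (cint leb `[0, pi *+ 2]).
Implicit Types (F : R[i] -> R[i]) (h : R -> R[i]).

Definition holo F := forall z, cabs z < 1 -> exists d, cdiff F z d.

Let twopi_gt0 : 0 < (pi : R) *+ 2.
Proof. by rewrite mulrn_wgt0// pi_gt0. Qed.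

Let mcirc : measurable (`[0, pi *+ 2]%classic : set (measurableTypeR R)).
Proof. exact: measurable_itv. Qed.

Let leb_circ : leb `[0, pi *+ 2] = (pi *+ 2)%:E.
Proof. by rewrite lebesgue_measure_itv /= lte_fin twopi_gt0 -EFinD subr0. Qed.

Let fin_circ : (leb `[0%R, (pi *+ 2)%R] < +oo)%E.
Proof. by rewrite leb_circ ltry. Qed.

Lemma cdiff2_eq (G : R -> R -> R[i]) x y al be al' be' :
  cdiff2 G x y al be -> al = al' -> be = be' -> cdiff2 G x y al' be'.
Proof. by move=> h <- <-. Qed.

Let circ_le h (M : R) : bmeas `[0, pi *+ 2] h -> (forall y, cabs (h y) <= M) ->
  cabs (circ h) <= 2 * M * (pi *+ 2).
Proof.
move=> bh hM; have := @cint_le _ _ _ leb _ mcirc fin_circ h M bh (fun y _ => hM y).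
by rewrite [fine _](congr1 fine leb_circ).
Qed.

Section kernel.
Variables (F : R[i] -> R[i]) (rho : R) (w : R[i]).
Hypotheses (hF : holo F) (rho0 : 0 < rho) (rho1 : rho < 1) (wrho : cabs w < rho).

(** With zeta = rho e^(iy), this is d zeta / (i (zeta - w)) written in the angle y. *)
Definition cauchy_kernel (y : R) : R[i] := rho%:C * cis y / (rho%:C * cis y - w).

Let den_neq0 y : rho%:C * cis y - w != 0.
Proof.
rewrite subr_eq0; apply/eqP => h; move: wrho.
by rewrite -h cabsM cabsR cabs_cis mulr1 gtr0_norm// ltxx.
Qed.

(** The segment homotopy from the point w at t = 0 to the circle at t = 1. *)
Let z (t y : R) : R[i] := w + t%:C * (rho%:C * cis y - w).

Let zlt (t y : R) : 0 <= t <= 1 -> cabs (z t y) < 1.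
Proof.
move=> /andP[t0 t1]; apply: le_lt_trans rho1.
have -> : z t y = (1 - t)%:C * w + t%:C * (rho%:C * cis y).
  by rewrite /z rmorphB rmorph1; ring.
apply: (le_trans (cabsD _ _)); rewrite !cabsM !cabsR cabs_cis mulr1.
rewrite (ger0_norm t0) (gtr0_norm rho0) ger0_norm ?subr_ge0//.
apply: (@le_trans _ _ ((1 - t) * rho + t * rho)); last by rewrite -mulrDl subrK mul1r.
by rewrite lerD2r ler_wpM2l ?subr_ge0// ltW.
Qed.

Let dz (t y : R) : cdiff2 z t y (rho%:C * cis y - w) (t%:C * (rho%:C * ('i%C * cis y))).
Proof.
have d1 := cdiff2M (cdiff2_cst rho%:C t y) (cdiff2_cis t y).
have d2 := cdiff2D d1 (cdiff2_cst (- w) t y).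
have d3 := cdiff2M (cdiff2_fst t y) d2.
apply: (cdiff2_eq (cdiff2D (cdiff2_cst w t y) d3)); ring.
Qed.

Let dk (t y : R) : exists be, cdiff2 (fun _ v => cauchy_kernel v) t y 0 be.
Proof.
have d1 := cdiff2M (cdiff2_cst rho%:C t y) (cdiff2_cis t y).
have d2 := cdiff2D d1 (cdiff2_cst (- w) t y).
have d3 := cdiff2M d1 (cdiff2_comp d2 (cdiffV (den_neq0 y))).
by eexists; apply: (cdiff2_eq d3) => //; ring.
Qed.

Let dF (t y : R) : 0 <= t <= 1 -> exists d,
  cdiff2 (fun t y => F (z t y)) t y (d * (rho%:C * cis y - w))
    (d * (t%:C * (rho%:C * ('i%C * cis y)))).
Proof.
by move=> /(@zlt _ y)/hF[d dF]; exists d; apply: cdiff2_comp (dz t y) dF.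
Qed.

Lemma bmeas_kernel : bmeas `[0, pi *+ 2] cauchy_kernel.
Proof.
apply: bmeas_ccont => y _; have [be h] := dk 0 y.
by have [] := cdiff2_ccont h.
Qed.

Lemma bmeas_Fz (t : R) : 0 <= t <= 1 -> bmeas `[0, pi *+ 2] (fun y => F (z t y)).
Proof.
move=> t01; apply: bmeas_ccont => y _; have [d h] := dF y t01.
by have [] := cdiff2_ccont h.
Qed.

(** Goursat's lemma for F(zeta) d zeta / (zeta - w) pulled back along [z]. Its components are P = F
    / u and Q = i F times the kernel, which does not depend on u; the sides y = 0 and y = 2 pi
    cancel by periodicity, and t > 0 stays away from the pole. *)
Lemma cauchy_homotopy (t : R) : 0 < t < 1 ->
  circ (fun y => F (rho%:C * cis y) * cauchy_kernel y) =
  circ (fun y => F (z t y) * cauchy_kernel y).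
Proof.
move=> /andP[t0 t1].
have t01 : 0 <= t <= 1 by rewrite !ltW.
have o01 : (0 : R) <= (1 : R) <= (1 : R) by rewrite ler01 /=.
pose P u y := F (z u y) * (u%:C)^-1.
pose Q u y := 'i%C * (F (z u y) * cauchy_kernel y).
have := @goursat_complex _ P Q t 1 0 (pi *+ 2) t1 twopi_gt0.
have PE : cint leb `[t, 1] (P ^~ 0) = cint leb `[t, 1] (P ^~ (pi *+ 2)).
  by apply: eq_cint => u _; rewrite /P /z cis_2pi.
rewrite PE subrr add0r => h; apply: (@mulfI _ 'i%C).
  by rewrite eq_complex /= eqxx oner_eq0.
have bz u : 0 <= u <= 1 -> bmeas `[0, pi *+ 2] (fun y => F (z u y) * cauchy_kernel y).
  by move=> u01; apply: bmeasM; [exact: bmeas_Fz|exact: bmeas_kernel].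
have z1 y : z 1 y = rho%:C * cis y by rewrite /z rmorph1; ring.
under eq_cint do rewrite -z1.
have b1 := bz 1 o01; have bt := bz t t01; rewrite -!cintZ//.
apply/eqP; rewrite -subr_eq0; apply/eqP; apply: h => u y.
rewrite in_itv/= => /andP[tu u1] _.
have u0 : 0 < u by exact: lt_le_trans tu.
have u01 : 0 <= u <= 1 by rewrite u1 ltW.
have [d dG] := dF y u01; have [b dK] := dk u y.
have uC0 : u%:C != 0 :> R[i] by rewrite -cabs_eq0 cabsR normr_eq0 gt_eqF.
have dP := cdiff2M dG (cdiff2_comp (cdiff2_fst u y) (cdiffV uC0)).
have dQ := cdiff2M (cdiff2_cst 'i%C u y) (cdiff2M dG dK).
eexists; eexists; eexists; split; first exact: dP.
apply: (cdiff2_eq dQ) => //.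
by rewrite /cauchy_kernel; field; rewrite uC0 den_neq0.
Qed.

Lemma cauchy_kernel_le y : cabs (cauchy_kernel y) <= (1 - cabs w / rho)^-1.
Proof.
have d0 : 0 < rho - cabs w by rewrite subr_gt0.
rewrite cabsM cabsV !cabsM cabsR cabs_cis mulr1 gtr0_norm//.
have -> : (1 - cabs w / rho)^-1 = rho / (rho - cabs w).
  by field; rewrite !gt_eqF.
rewrite ler_wpM2l ?(ltW rho0)// lef_pV2 ?posrE// ?cabs_gt0 ?den_neq0//.
rewrite lerBlDr; apply: le_trans (cabsD _ _); rewrite subrK cabsM cabsR cabs_cis.
by rewrite mulr1 gtr0_norm.
Qed.

(** The limit t -> 0 of the homotopy. The mean of the kernel is left unevaluated: its value follows
    in [power_series] from the geometric series and [circ_cis], which itself uses this formula. *)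
Lemma cauchy_formula0 :
  circ (fun y => F (rho%:C * cis y) * cauchy_kernel y) = F w * circ cauchy_kernel.
Proof.
apply/eqP; rewrite -subr_eq0 -cabs_eq0; apply/eqP/le_anti; rewrite cabs_ge0 andbT.
pose K := (1 - cabs w / rho)^-1.
have K0 : 0 < K by rewrite invr_gt0 subr_gt0 ltr_pdivrMr// mul1r.
apply/ler_addgt0Pr => e e0; rewrite add0r.
have w1 : cabs w < 1 by exact: lt_trans rho1.
have [d dFw] := hF w1.
pose e' := e / (2 * (K * (pi *+ 2))).
have e'0 : 0 < e' by rewrite divr_gt0// ?mulr_gt0.
(* The error 1 suffices: differentiability serves only as a Lipschitz bound at w, with constant 1 +
   |d|. *)
have [dl dl0 hdl] := dFw 1 ltr01.
pose L := 1 + cabs d; have L0 : 0 < L by rewrite ltr_pwDl// cabs_ge0.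
(* As |z t y - w| <= 2 t, the second bound makes the Lipschitz estimate applicable and the third
   makes it at most e'. *)
pose t := Num.min 2^-1 (Num.min (dl / 2) (e' / (2 * L))).
have t0 : 0 < t by rewrite !lt_min invr_gt0 ltr0n !divr_gt0 ?mulr_gt0.
have t1 : t < 1 by rewrite gt_min invf_lt1// ltr1n.
have t01 : 0 <= t <= 1 by rewrite !ltW.
have tdl : t * 2 <= dl by rewrite -ler_pdivlMr// !ge_min lexx orbT.
have tL : t * (2 * L) <= e' by rewrite -ler_pdivlMr ?mulr_gt0// !ge_min lexx !orbT.
rewrite (@cauchy_homotopy t) ?t0// -cintZ//; last exact: bmeas_kernel.
have bz := bmeas_Fz t01; have bk := bmeas_kernel.
rewrite -cintB//; [|exact: bmeasM|exact: bmeasZ].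
apply: (@le_trans _ _ (2 * (e' * K) * (pi *+ 2))); last first.
  have -> : 2 * (e' * K) * (pi *+ 2) = e' * (2 * (K * (pi *+ 2))) by ring.
  by rewrite /e' divfK// gt_eqF// ?mulr_gt0.
apply: circ_le => [|y]; first by apply: bmeasB; [exact: bmeasM|exact: bmeasZ].
rewrite -mulrBl cabsM ler_pM ?cabs_ge0//; last exact: cauchy_kernel_le.
have zw : cabs (z t y - w) <= t * 2.
  rewrite /z addrC addKr cabsM cabsR (gtr0_norm t0) ler_wpM2l ?(ltW t0)//.
  rewrite (le_trans (cabsB _ _))// cabsM cabsR cabs_cis mulr1 (gtr0_norm rho0).
  by rewrite -[2]/(1 + 1) lerD// ltW.
have h := hdl _ (le_trans zw tdl).
rewrite -[X in cabs X](subrK (d * (z t y - w))) (le_trans (cabsD _ _))// cabsM.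
apply: (le_trans _ tL); apply: (@le_trans _ _ (L * cabs (z t y - w))).
  by rewrite mulrDl lerD.
have -> : t * (2 * L) = L * (t * 2) by ring.
by rewrite ler_wpM2l ?(ltW L0).
Qed.

End kernel.

Lemma bmeas_cis : bmeas `[0, pi *+ 2] (@cis R).
Proof.
by apply: bmeas_ccont => y _; have [] := cdiff2_ccont (cdiff2_cis 0 y).
Qed.

Lemma circ1 : circ (fun=> 1) = (pi *+ 2)%:C.
Proof. by rewrite cint_cst// mul1r [fine _](congr1 fine leb_circ). Qed.

Lemma holo_exp n : holo (fun z => z ^+ n).
Proof.
move=> z _; have d1 x y : cdiff2 (fun _ _ => z) x y 0 0 by exact: cdiff2_cst.
elim: n => [|n [d hd]].
  exists 0 => e e0; exists 1 => // w _.
  by rewrite !expr0 subrr mul0r subr0 cabs0 mulr_ge0 ?cabs_ge0// ltW.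
exists (z ^+ n + z * d) => e e0.
pose M := cabs d + 1; have M0 : 0 < M by rewrite ltr_wpDl ?cabs_ge0.
pose Z := cabs z + 1; have Z0 : 0 < Z by rewrite ltr_wpDl ?cabs_ge0.
have e1 : 0 < Num.min 1 (e / (2 * Z)) by rewrite lt_min ltr01 divr_gt0// mulr_gt0.
have [dl dl0 h] := hd _ e1.
exists (Num.min dl (e / (2 * M))) => [|w]; first by rewrite lt_min dl0 divr_gt0// mulr_gt0.
rewrite le_min => /andP[w1 w2]; have := h w w1.
set A := cabs (_ - _ - _) => hA.
have hA1 : A <= cabs (w - z).
  by rewrite (le_trans hA)// ler_piMl ?cabs_ge0// ge_min lexx.
have hA2 : A <= e / (2 * Z) * cabs (w - z).
  by rewrite (le_trans hA)// ler_wpM2r ?cabs_ge0// ge_min lexx orbT.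
have -> : w ^+ n.+1 - z ^+ n.+1 - (z ^+ n + z * d) * (w - z) =
  z * (w ^+ n - z ^+ n - d * (w - z)) + (w - z) * (w ^+ n - z ^+ n).
  by rewrite !exprS; ring.
have B1 : cabs (w ^+ n - z ^+ n) <= M * cabs (w - z).
  rewrite -[X in cabs X](subrK (d * (w - z))) (le_trans (cabsD _ _))// cabsM.
  by rewrite /M addrC mulrDl mul1r lerD2l.
rewrite (le_trans (cabsD _ _))// !cabsM -/A [e]splitr mulrDl lerD//.
  apply: (@le_trans _ _ (Z * (e / (2 * Z) * cabs (w - z)))).
    by apply: ler_pM; rewrite ?cabs_ge0// lerDl.
  by rewrite le_eqVlt; apply/orP; left; apply/eqP; field; rewrite gt_eqF.
apply: (@le_trans _ _ (e / (2 * M) * (M * cabs (w - z)))).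
  by apply: ler_pM; rewrite ?cabs_ge0.
by rewrite le_eqVlt; apply/orP; left; apply/eqP; field; rewrite gt_eqF.
Qed.

(** For positive exponents this is Cauchy's formula for the power at w = 0, where the kernel is 1
    and the power vanishes. *)
Lemma circ_cis n : circ (fun y : R => cis y ^+ n) = (n == 0%N)%:R * (pi *+ 2)%:C.
Proof.
case: n => [|n]; first by under eq_cint do rewrite expr0; rewrite circ1 mul1r.
rewrite mul0r; have h0 : 0 < (2^-1 : R) by rewrite invr_gt0.
have h1 : (2^-1 : R) < 1 by rewrite invf_lt1// ltr1n.
have hw : cabs (0 : R[i]) < 2^-1 by rewrite cabs0.
have := cauchy_formula0 (holo_exp n.+1) h0 h1 hw.
rewrite expr0n /= mul0r.
have -> : circ (fun y => ((2^-1)%:C * cis y) ^+ n.+1 * cauchy_kernel 2^-1 0 y) =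
    circ (fun y => (2^-1)%:C ^+ n.+1 * cis y ^+ n.+1).
  apply: eq_cint => y _; rewrite /cauchy_kernel subr0 exprMn divff ?mulr1//.
  by rewrite mulf_neq0 ?cis_neq0// -cabs_eq0 cabsR normr_eq0 gt_eqF.
rewrite cintZ//; last exact/bmeasX/bmeas_cis.
move/eqP; rewrite mulf_eq0 => /orP[|/eqP//].
by rewrite expf_eq0 /= -cabs_eq0 cabsR normr_eq0 gt_eqF.
Qed.

(* [F] is the sum of the power series [c] on the disc of radius [rho], with an
   explicit bound on the remainders *)
Definition hasps F (c : nat -> R[i]) (rho K : R) := forall w m, cabs w < rho ->
  cabs (F w - \sum_(n < m) c n * w ^+ n) <= K * (cabs w / rho) ^+ m / (1 - cabs w / rho).

(** The kernel equals 1 / (1 - q) with q = w / zeta, and the right-hand side is its finite geometric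
    expansion. *)
Lemma cauchy_kernelE (rho : R) w m (y : R) : cis y != 0 -> 0 < rho -> cabs w < rho ->
  cauchy_kernel rho w y = \sum_(n < m) (w / (rho%:C * cis y)) ^+ n
    + (w / (rho%:C * cis y)) ^+ m * cauchy_kernel rho w y.
Proof.
move=> y0 rho0 wrho; set q := w / _.
have z0 : rho%:C * cis y != 0.
  by rewrite mulf_neq0// -cabs_eq0 cabsR normr_eq0 gt_eqF.
have q1 : 1 - q != 0.
  rewrite subr_eq0; apply/eqP => /(congr1 (@cabs R)); rewrite cabs1 /q cabsM cabsV.
  rewrite cabsM cabsR cabs_cis mulr1 gtr0_norm// => h.
  have : cabs w / rho < 1 by rewrite ltr_pdivrMr// mul1r.
  by rewrite -h ltxx.
have -> : cauchy_kernel rho w y = (1 - q)^-1.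
  by rewrite /cauchy_kernel /q -[in RHS](divff z0) -mulrBl invf_div.
have := subrX1 q m; rewrite -opprB -[q - 1]opprB mulNr => /oppr_inj h.
apply: (mulfI q1); rewrite mulrDr -h [in RHS]mulrCA divff// mulr1.
by rewrite subrK.
Qed.

(** The geometric expansion of the kernel is integrated against F term by term. The factor 2 is that
    of [cint_le]; the remainder depends on F only through M, which gives estimates uniform over the
    slices of a function on the ball. *)
Theorem power_series F (rho M : R) : holo F -> 0 < rho -> rho < 1 ->
  (forall z, cabs z <= rho -> cabs (F z) <= M) ->
  exists c, hasps F c rho (2 * M).
Proof.
move=> hF rho0 rho1 FM.
have p0 : (pi *+ 2)%:C != 0 :> R[i].
  by rewrite -cabs_eq0 cabsR normr_eq0 gt_eqF.
have r0 : rho%:C != 0 :> R[i] by rewrite -cabs_eq0 cabsR normr_eq0 gt_eqF.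
have bF : bmeas `[0, pi *+ 2] (fun y => F (rho%:C * cis y)).
  have h0 : cabs (0 : R[i]) < rho by rewrite cabs0.
  have o01 : (0 : R) <= (1 : R) <= (1 : R) by rewrite ler01 /=.
  apply: (eq_bmeas _ (bmeas_Fz hF rho0 rho1 h0 o01)) => y _.
  by rewrite rmorph1 mul1r subr0 add0r.
have cisV (y : R) : (cis y)^-1 = Num.conj (cis y).
  apply: (mulfI (cis_neq0 y)); rewrite divff ?cis_neq0// cabs_sqr cabs_cis.
  by rewrite expr1n.
have bcV n : bmeas `[0, pi *+ 2] (fun y : R => (cis y)^-1 ^+ n).
  by apply: bmeasX => //; apply: (eq_bmeas _ (bmeasJ bmeas_cis)) => y _; rewrite cisV.
have circV n : circ (fun y : R => (cis y)^-1 ^+ n) = (n == 0%N)%:R * (pi *+ 2)%:C.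
  under eq_cint do rewrite cisV -rmorphXn.
  rewrite cintJ//; last exact/bmeasX/bmeas_cis.
  rewrite circ_cis; apply: complex_eqP; rewrite ?(cReJ, cImJ)//.
  by case: (n == _); rewrite ?mul1r ?mul0r //= oppr0.
(* Cauchy's coefficients: the mean of F(zeta) zeta ^ -n over the circle of radius rho. *)
pose c n := ((pi *+ 2)%:C)^-1 * (rho%:C^-1 ^+ n * circ (fun y => F (rho%:C * cis y) * (cis y)^-1 ^+ n)).
exists c => w m wrho.
have bk : bmeas `[0, pi *+ 2] (cauchy_kernel rho w) by exact: bmeas_kernel.
have q1 : cabs w / rho < 1 by rewrite ltr_pdivrMr// mul1r.
have q0 : 0 <= cabs w / rho by rewrite divr_ge0 ?cabs_ge0// ltW.
have M0 : 0 <= M by rewrite (le_trans (cabs_ge0 _) (FM 0 _))// cabs0 ltW.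
have qE (y : R) n : (w / (rho%:C * cis y)) ^+ n = w ^+ n * rho%:C^-1 ^+ n * (cis y)^-1 ^+ n.
  by rewrite -!exprMn invfM mulrA.
have qle (y : R) n : cabs ((w / (rho%:C * cis y)) ^+ n) = (cabs w / rho) ^+ n.
  by rewrite cabsX cabsM cabsV cabsM cabsR cabs_cis mulr1 gtr0_norm.
have bq n : bmeas `[0, pi *+ 2] (fun y => (w / (rho%:C * cis y)) ^+ n).
  by apply: (eq_bmeas _ (bmeasZ (w ^+ n * rho%:C^-1 ^+ n) (bcV n))) => y _; rewrite qE.
pose K := (1 - cabs w / rho)^-1.
have K0 : 0 < K by rewrite invr_gt0 subr_gt0.
(* the kernel has mean 1, by the geometric series *)
have kE m' : circ (cauchy_kernel rho w) = \sum_(n < m') (w ^+ n * rho%:C^-1 ^+ n) *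
    ((n == 0%N :> nat)%:R * (pi *+ 2)%:C) +
    circ (fun y => (w / (rho%:C * cis y)) ^+ m' * cauchy_kernel rho w y).
  under [LHS]eq_cint => y _ do rewrite (cauchy_kernelE m' (cis_neq0 y) rho0 wrho).
  rewrite cintD//; [|by apply: bmeas_sum => i; exact: bq|exact: (bmeasM (bq _) bk)].
  congr (_ + _); rewrite cint_sum => [|//|//|i]; last exact: bq.
  apply: eq_bigr => n _.
  under eq_cint do rewrite qE.
  rewrite cintZ//; last exact: bcV.
  by rewrite circV.
have k1 : circ (cauchy_kernel rho w) = (pi *+ 2)%:C.
  apply/eqP; rewrite -subr_eq0 -cabs_eq0; apply/eqP/le_anti; rewrite cabs_ge0 andbT.
  apply/ler_addgt0Pr => e e0; rewrite add0r.
  have [m' hm'] : exists m' : nat, 2 * ((cabs w / rho) ^+ m'.+1 * K) * (pi *+ 2) <= e.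
    have hc : (cabs w / rho) ^+ n @[n --> \oo] --> (0 : R).
      by apply: cvg_expr; rewrite ger0_norm.
    pose e' := e / (2 * (K * (pi *+ 2))).
    have e'0 : 0 < e' by rewrite divr_gt0// ?mulr_gt0.
    move/cvgrPdist_le : hc => /(_ _ e'0)[m' _ hm']; exists m'.
    have := hm' m'.+1 (leqnSn _); rewrite /= sub0r normrN ger0_norm ?exprn_ge0// => h.
    apply: (@le_trans _ _ (e' * (2 * (K * (pi *+ 2))))).
      rewrite (_ : 2 * _ * _ = (cabs w / rho) ^+ m'.+1 * (2 * (K * (pi *+ 2)))).
        by rewrite ler_wpM2r// ltW// ?mulr_gt0.
      by ring.
    by rewrite /e' divfK// gt_eqF// ?mulr_gt0.
  rewrite (kE m'.+1) big_ord_recl /= big1 => [|i _]; last by rewrite mul0r mulr0.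
  rewrite !expr0 !mul1r addr0 addrC addKr.
  apply: le_trans hm'; apply: circ_le => [|y]; first exact: (bmeasM (bq _) bk).
  by rewrite cabsM qle ler_wpM2l ?exprn_ge0// cauchy_kernel_le.
have := cauchy_formula0 hF rho0 rho1 wrho; rewrite k1 => FE.
have {FE} -> : F w = ((pi *+ 2)%:C)^-1 * circ (fun y => F (rho%:C * cis y) * cauchy_kernel rho w y).
  by rewrite FE mulrCA mulVf// mulr1.
have -> : \sum_(n < m) c n * w ^+ n = ((pi *+ 2)%:C)^-1 *
    circ (fun y => F (rho%:C * cis y) * \sum_(n < m) (w / (rho%:C * cis y)) ^+ n).
  under eq_cint do rewrite big_distrr /=.
  rewrite cint_sum => [|//|//|i]; last exact: (bmeasM bF (bq _)).
  rewrite big_distrr /=; apply: eq_bigr => n _; rewrite /c -!mulrA; congr (_ * _).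
  transitivity (w ^+ n * rho%:C^-1 ^+ n * circ (fun y => F (rho%:C * cis y) * (cis y)^-1 ^+ n)).
    by ring.
  rewrite -cintZ//; last exact: (bmeasM bF (bcV _)).
  by apply: eq_cint => y _; rewrite qE; ring.
have bs : bmeas `[0, pi *+ 2] (fun y => F (rho%:C * cis y) * \sum_(n < m) (w / (rho%:C * cis y)) ^+ n).
  by apply: bmeasM => //; apply: bmeas_sum => i; exact: bq.
rewrite -mulrBr cabsM cabsV cabsR gtr0_norm// -cintB//; last exact: (bmeasM bF bk).
have -> : circ (fun y => F (rho%:C * cis y) * cauchy_kernel rho w y -
    F (rho%:C * cis y) * \sum_(n < m) (w / (rho%:C * cis y)) ^+ n) =
  circ (fun y => F (rho%:C * cis y) * ((w / (rho%:C * cis y)) ^+ m * cauchy_kernel rho w y)).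
  apply: eq_cint => y _; rewrite -mulrBr; congr (_ * _).
  by rewrite {1}(cauchy_kernelE m (cis_neq0 y) rho0 wrho) addrC addKr.
rewrite mulrC ler_pdivrMr//.
rewrite -[_ / _]/(_ * K) -!mulrA mulrA.
apply: (@le_trans _ _ (2 * (M * ((cabs w / rho) ^+ m * K)) * (pi *+ 2))).
  apply: circ_le => [|y]; first exact: (bmeasM bF (bmeasM (bq _) bk)).
  rewrite cabsM ler_pM ?cabs_ge0//.
    by apply: FM; rewrite cabsM cabsR cabs_cis mulr1 gtr0_norm.
  by rewrite cabsM qle ler_wpM2l ?exprn_ge0// cauchy_kernel_le.
by rewrite !mulrA.
Qed.

End cauchy_formula.

(** * Unitary invariance of the surface measure *)

Section lebesgue_tuple.
Variable R : realType.
Local Notation leb := (@lebesgue_measure R).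
Local Notation RT n := (n.-tuple (measurableTypeR R)).

Lemma lebesgue_measure_translate (b : R) (A : set R) : measurable A ->
  leb ((fun x : R => x + b) @^-1` A) = leb A.
Proof.
move=> mA; have mf : measurable_fun setT (fun x : measurableTypeR R => x + b : measurableTypeR R).
  by apply: measurable_funD.
transitivity (mpushforward leb mf A) => //.
apply/esym/lebesgue_measure_unique => // _ [[u v]] _ <-; rewrite /mpushforward /= /pushforward.
have -> : (fun x : R => x + b) @^-1` [set` `]u, v]] = [set` `](u - b), (v - b)]].
  by apply/seteqP; split => x /=; rewrite !in_itv/= ltrBlDr lerBrDr.
rewrite !lebesgue_measure_itv /= !lte_fin ltrD2r -!EFinB.
by case: ifP => // _; congr (_%:E); ring.
Qed.

Definition tadd n (x y : RT n) : RT n := [tuple tnth x i + tnth y i | i < n].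

Arguments tadd {n}.

Lemma measurable_tadd n (y : RT n) : measurable_fun setT (tadd ^~ y).
Proof.
apply/measurable_fun_tnthP => i.
rewrite (_ : _ \o _ = (fun x : RT n => tnth x i + tnth y i)); last first.
  by apply/funext => x; rewrite /= tnth_mktuple.
by apply: measurable_funD => //; exact: measurable_tnth.
Qed.

Lemma tuple_rconsP n (E : RT n.+1) : exists p, E = tuple_rcons p.
Proof.
exists ([tuple tnth E (widen_ord (leqnSn n) i) | i < n], tnth E ord_max).
apply: eq_from_tnth => i; rewrite /tuple_rcons [RHS](tnth_nth 0) /= nth_rcons size_map size_enum_ord.
case: ltnP => [ilt|ige].
  rewrite (nth_map (Ordinal ilt)) ?size_enum_ord//.
  rewrite (_ : nth _ _ _ = Ordinal ilt); last exact: (nth_ord_enum _ (Ordinal ilt)).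
  by rewrite !(tnth_nth 0).
have -> : i = ord_max by apply/val_inj/eqP; rewrite eqn_leq ige -ltnS ltn_ord.
by rewrite eqxx.
Qed.

Lemma tadd_rcons n (x y : RT n) (u v : R) :
  tadd (tuple_rcons (x, u)) (tuple_rcons (y, v)) = tuple_rcons (tadd x y, u + v).
Proof.
apply: eq_from_tnth => i; rewrite tnth_mktuple !(tnth_nth 0) /= !nth_rcons.
rewrite size_map size_enum_ord !size_tuple.
case: ltnP => [ilt|ige].
  rewrite (nth_map (Ordinal ilt)) ?size_enum_ord//.
  rewrite (_ : nth _ _ _ = Ordinal ilt); last exact: (nth_ord_enum _ (Ordinal ilt)).
  by rewrite !(tnth_nth 0).
by rewrite (_ : _ == _) //= eqn_leq ige -ltnS ltn_ord.
Qed.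

Lemma lebesgue_tupleS n (E : set (RT n.+1)) : lebesgue_tuple R n.+1 E =
  (\int[lebesgue_tuple R n]_x leb (xsection (@tuple_rcons R n @^-1` E) x))%E.
Proof. by []. Qed.

Lemma measurable_rcons_preimage n (E : set (RT n.+1)) : measurable E ->
  measurable (@tuple_rcons R n @^-1` E).
Proof.
by move=> mE; rewrite -[X in measurable X]setTI; exact: measurable_tuple_rcons.
Qed.

Lemma lebesgue_tuple_translate n (a : RT n) (E : set (RT n)) : measurable E ->
  lebesgue_tuple R n (tadd ^~ a @^-1` E) = lebesgue_tuple R n E.
Proof.
elim: n a E => [|n IH] a E mE.
  rewrite (_ : _ @^-1` _ = E)//; apply/seteqP.
  by split => x /=; rewrite (tuple0 x) (tuple0 (tadd _ _)).
have [[a' b] ->] := tuple_rconsP a.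
set F := @tuple_rcons R n @^-1` E.
have mF : measurable F by exact: measurable_rcons_preimage.
rewrite !lebesgue_tupleS -/F.
transitivity (\int[lebesgue_tuple R n]_x leb (xsection F (tadd x a')))%E.
  apply: eq_integral => x _.
  have mX := measurable_xsection (tadd x a') mF.
  rewrite -(lebesgue_measure_translate b mX).
  congr (leb _); apply/seteqP; split => y /=; rewrite /xsection /= !inE /F /= tadd_rcons//.
have mg : measurable_fun setT (fun x => leb (xsection F x)) by exact: measurable_fun_xsection.
rewrite -(@ge0_integral_pushforward _ _ _ _ _ _ (measurable_tadd a')
  (lebesgue_tuple R n) setT (fun x => leb (xsection F x)))//.
apply: eq_measure_integral => [|mt A mA _]; first exact: measurable_tadd.
exact: (IH a' A mA).
Qed.

Definition box n (a b : R) : set (RT n) := [set x | forall i, a < tnth x i < b].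

Arguments box {n}.

Lemma measurable_box n a b : measurable (box a b : set (RT n)).
Proof.
rewrite (_ : box a b = \bigcap_(i in [set: 'I_n]) ((fun x : RT n => tnth x i) @^-1` `]a, b[)).
  apply: fin_bigcap_measurable => [|i _]; first exact: finite_finset.
  by rewrite -[X in measurable X]setTI; exact: measurable_tnth.
apply/seteqP; split => x /= h i; first by move=> _; rewrite /= in_itv/= h.
by have := h i I; rewrite /= in_itv.
Qed.

Lemma lebesgue_tuple_box n a b : a < b ->
  lebesgue_tuple R n (box a b) = ((b - a) ^+ n)%:E.
Proof.
move=> ab; elim: n => [|n IH].
  by rewrite /= diracE mem_set ?expr0// => k; case: (k) => m; have := ltn0 m.
rewrite lebesgue_tupleS.
transitivity (((lebesgue_tuple R n) \x leb)%E (box a b `*` `]a, b[)).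
  congr ((_ \x _)%E _); apply/seteqP; split => -[x u] /=.
    move=> h; split => [i|]; have := h.
      move=> /(_ (widen_ord (leqnSn n) i)).
      by rewrite !(tnth_nth 0) /= nth_rcons size_tuple ltn_ord.
    move=> /(_ ord_max); rewrite (tnth_nth 0) /= nth_rcons size_tuple ltnn eqxx.
    by rewrite in_itv.
  move=> [h]; rewrite in_itv /= => uab i; rewrite (tnth_nth 0) /= nth_rcons size_tuple.
  case: ltnP => [ilt|ige]; first by have := h (Ordinal ilt); rewrite (tnth_nth 0).
  by rewrite (_ : _ == _) //= eqn_leq ige -ltnS ltn_ord.
rewrite product_measure1E//; last exact: measurable_box.
have E : leb `]a, b[ = (b - a)%:E by rewrite lebesgue_measure_itv /= lte_fin ab -EFinB.
by rewrite [X in (X * _)%E]IH [X in (_ * X)%E]E -EFinM exprSr.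
Qed.

Lemma sigma_finite_lebesgue_tuple n : sigma_finite setT (lebesgue_tuple R n).
Proof.
exists (fun k => box (- k.+1%:R) k.+1%:R).
  apply/seteqP; split => // x _.
  pose M := \sum_(i < n) `|tnth x i|.
  exists (Num.truncn M) => // i.
  have : `|tnth x i| < (Num.truncn M).+1%:R.
    apply: le_lt_trans (Num.Theory.truncnS_gt M).
    by rewrite /M (bigD1 i)//= lerDl sumr_ge0.
  by rewrite ltr_norml.
move=> k; split; first exact: measurable_box.
by rewrite lebesgue_tuple_box ?ltry// gtrN// ltr0n.
Qed.

(** A named copy of the set function, to which the sigma-finite structure required by Tonelli's
    theorem is attached. *)
Definition ltuple n : set (RT n) -> \bar R := lebesgue_tuple R n.
HB.instance Definition _ n := Measure.copy (@ltuple n) (lebesgue_tuple R n).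
HB.instance Definition _ n :=
  Measure_isSigmaFinite.Build _ _ _ (@ltuple n) (@sigma_finite_lebesgue_tuple n).

Lemma ltuple_translate n (a : RT n) (E : set (RT n)) : measurable E ->
  ltuple (tadd ^~ a @^-1` E) = ltuple E.
Proof. exact: lebesgue_tuple_translate. Qed.

Definition tscale n (c : R) (x : RT n) : RT n := [tuple c * tnth x i | i < n].

Lemma taddA_tscaleN n (x y : RT n) : tadd x (tadd y (tscale (-1) x)) = y.
Proof. by apply: eq_from_tnth => i; rewrite !tnth_mktuple; ring. Qed.

Section orthogonal.
Variables (n : nat) (T V : RT n -> RT n).
Hypotheses (mT : measurable_fun setT T) (mV : measurable_fun setT V).
Hypothesis Tadd : forall x y, T (tadd x y) = tadd (T x) (T y).
Hypothesis Tscale : forall (c : R) x, T (tscale c x) = tscale c (T x).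
Hypothesis TV : forall x, T (V x) = x.
Hypothesis Tnorm : forall x, tuple_norm (T x) = tuple_norm x.

Local Notation B := (@tuple_ball R n).
Local Notation mu := (@ltuple n).

(** In positive dimension this avoids the origin, the only point whose [tuple_dir] is not a unit
    vector; [surface_measure_gt0] relies on it. *)
Definition coords_neq0 : set (RT n) := [set x | forall i, tnth x i != 0].

Let mpre (f : RT n -> RT n) (E : set (RT n)) : measurable_fun setT f ->
  measurable E -> measurable (f @^-1` E).
Proof. by move=> mf mE; rewrite -[X in measurable X]setTI; exact: mf. Qed.

Let TB : T @^-1` B = B.
Proof. by apply/seteqP; split => x; rewrite /tuple_ball /= Tnorm. Qed.

Lemma ltuple_ball_lty : (mu B < +oo)%E.
Proof.
apply: (@le_lt_trans _ _ (mu (box (-1) 1))).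
  apply: le_measure; rewrite ?inE; [exact: measurable_tuple_ball|exact: measurable_box|].
  move=> x; rewrite /tuple_ball /= => x1 i; rewrite -ltr_norml.
  apply: le_lt_trans x1; rewrite -sqrtr_sqr ler_wsqrtr// (bigD1 i)//= lerDl.
  by rewrite sumr_ge0// => j _; rewrite sqr_ge0.
by rewrite /ltuple lebesgue_tuple_box ?ltry// gtrN.
Qed.

Lemma measurable_ball_neq0 : measurable (B `&` coords_neq0).
Proof.
apply: measurableI; first exact: measurable_tuple_ball.
rewrite (_ : coords_neq0 = \bigcap_(i in [set: 'I_n])
  ((fun x : RT n => tnth x i) @^-1` ~` [set 0])).
  apply: fin_bigcap_measurable => [|i _]; first exact: finite_finset.
  rewrite -[X in measurable X]setTI; apply: measurable_tnth => //.
  by apply: measurableC; exact: measurable_set1.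
apply/seteqP; split => x /= h i; first by move=> _; exact/eqP.
by apply/eqP; exact: (h i I).
Qed.

Lemma ltuple_ball_gt0 : (0 < mu (B `&` coords_neq0))%E.
Proof.
(* A cube of side 1 / (n + 1) fits in the ball, since the squares of its coordinates sum to at most
   n / (n + 1). *)
have h0 : (0 : R) < n.+1%:R^-1 by rewrite invr_gt0 ltr0n.
apply: (@lt_le_trans _ _ (mu (box 0 n.+1%:R^-1))).
  by rewrite /ltuple lebesgue_tuple_box// lte_fin subr0 exprn_gt0.
apply: le_measure; rewrite ?inE; first exact: measurable_box.
  exact: measurable_ball_neq0.
move=> x hx; split=> [|i]; last by have /andP[/lt0r_neq0] := hx i.
rewrite /tuple_ball /= -sqrtr1 ltr_sqrt//.
apply: (@le_lt_trans _ _ (\sum_(i < n) n.+1%:R^-1)).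
  apply: ler_sum => i _; have /andP[x0 x1] := hx i.
  apply: (@le_trans _ _ (n.+1%:R^-1 * n.+1%:R^-1)).
    by rewrite expr2 ler_pM// ltW.
  by rewrite ler_piMl ?(ltW h0)// invf_le1 ?ltr0n// ler1n.
rewrite sumr_const card_ord -[_ *+ n]mulr_natr mulrC ltr_pdivrMr ?ltr0n// mul1r.
by rewrite ltr_nat.
Qed.

Let int_indic (c : \bar R) (E : set (RT n)) : measurable E -> (0 <= c)%E ->
  (\int[mu]_y (c * (\1_E y)%:E) = c * mu E)%E.
Proof.
move=> mE c0; rewrite ge0_integralZl//; last by exact/measurable_EFinP/measurable_indic.
by rewrite integral_indic// setIT.
Qed.

Let mule_cancel (a a' b : \bar R) : (0 < b)%E -> (b < +oo)%E -> (a * b = a' * b)%E -> a = a'.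
Proof.
case: b => [b| |]//= b0 _; move: b0.
rewrite lte_fin => b0 /(congr1 (fun z => z * (b^-1)%:E)%E).
by rewrite -!muleA -EFinM divff ?gt_eqF// !mule1.
Qed.

(* Both sides times [mu B] are the volume of a set of [RT n * RT n], computed
   along the two directions; this is the proof of the uniqueness of Haar measure. *)
Lemma ltuple_orthogonal (A : set (RT n)) : measurable A -> mu (T @^-1` A) = mu A.
Proof.
move=> mA.
have mB : measurable B by exact: measurable_tuple_ball.
have mTA := mpre mT mA.
(* Over a fixed x the sections of S1 and S2 are translates of each other by [V x]. Over a fixed y,
   the section of S1 has measure [mu A] if T y lies in B, that of S2 has measure [mu B] if T y lies
   in A, and they are empty otherwise. *)
pose S1 : set (RT n * RT n) := [set p | A (tadd p.1 (T p.2)) /\ B (T p.2)].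
pose S2 : set (RT n * RT n) := [set p | A (T p.2) /\ B (tadd (T p.2) (tscale (-1) p.1))].
have mtn i : measurable_fun setT (fun x : RT n => tnth x i) by exact: measurable_tnth.
have mTn i : measurable_fun setT (fun x : RT n => tnth (T x) i)
  by exact: (measurableT_comp (mtn i) mT).
have mS1 : measurable S1.
  have -> : S1 = ((fun p => tadd p.1 (T p.2)) @^-1` A) `&` ((fun p => T p.2) @^-1` B) by [].
  have m1 : measurable_fun setT (fun p : RT n * RT n => tadd p.1 (T p.2)).
    apply/measurable_fun_tnthP => i.
    rewrite (_ : _ \o _ = (fun p : RT n * RT n => tnth p.1 i + tnth (T p.2) i)); last first.
      by apply/funext => p; rewrite /= tnth_mktuple.
    apply: measurable_funD; first exact: (measurableT_comp (mtn i) measurable_fst).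
    exact: (measurableT_comp (mTn i) measurable_snd).
  have m2 : measurable_fun setT (fun p : RT n * RT n => T p.2)
    by exact: (measurableT_comp mT measurable_snd).
  by apply: measurableI; rewrite -[X in measurable X]setTI; [exact: m1|exact: m2].
have mS2 : measurable S2.
  have -> : S2 = ((fun p => T p.2) @^-1` A) `&`
     ((fun p => tadd (T p.2) (tscale (-1) p.1)) @^-1` B) by [].
  have m1 : measurable_fun setT (fun p : RT n * RT n => tadd (T p.2) (tscale (-1) p.1)).
    apply/measurable_fun_tnthP => i.
    rewrite (_ : _ \o _ = (fun p : RT n * RT n => tnth (T p.2) i + -1 * tnth p.1 i)); last first.
      by apply/funext => p; rewrite /= !tnth_mktuple.
    apply: measurable_funD; first exact: (measurableT_comp (mTn i) measurable_snd).
    by apply: measurable_funM => //; exact: (measurableT_comp (mtn i) measurable_fst).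
  have m2 : measurable_fun setT (fun p : RT n * RT n => T p.2)
    by exact: (measurableT_comp mT measurable_snd).
  by apply: measurableI; rewrite -[X in measurable X]setTI; [exact: m2|exact: m1].
have swap (S : set (RT n * RT n)) : measurable S ->
    (\int[mu]_x mu (xsection S x) = \int[mu]_y mu (ysection S y))%E.
  move=> mS; have := @indic_fubini_tonelli _ _ _ _ R mu mu S mS.
  by rewrite indic_fubini_tonelli_FE// indic_fubini_tonelli_GE.
have e12 : (\int[mu]_x mu (xsection S1 x) = \int[mu]_x mu (xsection S2 x))%E.
  apply: eq_integral => x _.
  rewrite -(ltuple_translate (tscale (-1) (V x)) (measurable_xsection x mS1)).
  congr (mu _); apply/seteqP; split => y /=; rewrite /xsection /= !inE /S1 /S2 /= Tadd Tscale TV.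
    by rewrite taddA_tscaleN.
  by rewrite taddA_tscaleN.
have m1E : (\int[mu]_y mu (ysection S1 y) = mu A * mu B)%E.
  have -> : mu B = mu (T @^-1` B) by rewrite TB.
  rewrite -(@int_indic (mu A) _ (mpre mT mB) (measure_ge0 _ _)).
  apply: eq_integral => y _; rewrite indicE.
  have [yB|yB] := boolP (y \in T @^-1` B).
    rewrite mule1 -(ltuple_translate (T y) mA); congr (mu _).
    apply/seteqP; split => x /=; rewrite /ysection /= inE /S1 /=; first by case.
    by move=> Ax; split; [exact: Ax|rewrite inE in yB].
  rewrite mule0; have -> : ysection S1 y = set0; last exact: measure0.
  rewrite -subset0 => x; rewrite /ysection /= inE /S1 /= => -[_ yB'].
  by move: yB; rewrite notin_setE; apply.
have m2E : (\int[mu]_y mu (ysection S2 y) = mu (T @^-1` A) * mu B)%E.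
  rewrite muleC -(@int_indic (mu B) _ mTA (measure_ge0 _ _)); apply: eq_integral => y _; rewrite indicE.
  have [yA|yA] := boolP (y \in T @^-1` A).
    rewrite mule1 -(ltuple_translate (tscale (-1) (T y)) mB); congr (mu _).
    have symB x : B (tadd (T y) (tscale (-1) x)) = B (tadd x (tscale (-1) (T y))).
      rewrite /tuple_ball /=; congr (is_true (Num.sqrt _ < 1)).
      by apply: eq_bigr => i _; rewrite !tnth_mktuple; ring.
    apply/seteqP; split => x /=; rewrite /ysection /= inE /S2 /= -symB; first by case.
    by move=> Bx; split; [rewrite inE in yA|exact: Bx].
  rewrite mule0; have -> : ysection S2 y = set0; last exact: measure0.
  rewrite -subset0 => x; rewrite /ysection /= inE /S2 /= => -[yA' _].
  by move: yA; rewrite notin_setE; apply.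
have muB0 : (0 < mu B)%E.
  apply: lt_le_trans ltuple_ball_gt0 _; apply: le_measure => [||x []//].
    by rewrite inE; exact: measurable_ball_neq0.
  by rewrite inE.
apply/esym; apply: (mule_cancel muB0 ltuple_ball_lty).
by rewrite -m1E -m2E -!swap.
Qed.

End orthogonal.
End lebesgue_tuple.

Section surface.
Variables (R : realType) (n : nat).
Local Notation RT := (n.-tuple (measurableTypeR R)).
Local Notation sigma := (@surface_measure R n).
Local Notation S := (@tuple_sphere R n).
Local Notation B := (@tuple_ball R n).
Local Notation mu := (@ltuple R n).

Lemma measurable_tuple_sphere : measurable S.
Proof.
rewrite (_ : S = (@tuple_norm R n) @^-1` [set 1]) //.
rewrite -[X in measurable X]setTI; exact: measurable_tuple_norm.
Qed.

Lemma surface_measureE (E : set RT) :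
  sigma E = (`|(fine (mu B))^-1|%:E * mu ((@tuple_dir R n) @^-1` E `&` B))%E.
Proof. by []. Qed.

Let vol_gt0 : 0 < fine (mu B).
Proof.
apply: fine_gt0; rewrite ltuple_ball_lty andbT.
apply: lt_le_trans (ltuple_ball_gt0 R n) _; apply: le_measure => [||x []//].
  by rewrite inE; exact: measurable_ball_neq0.
by rewrite inE; exact: measurable_tuple_ball.
Qed.

Let measurable_dir_ball (E : set RT) : measurable E ->
  measurable ((@tuple_dir R n) @^-1` E `&` B).
Proof.
move=> mE; apply: measurableI; last exact: measurable_tuple_ball.
by rewrite -[X in measurable X]setTI; exact: measurable_tuple_dir.
Qed.

Lemma surface_measure_lty : (sigma S < +oo)%E.
Proof.
rewrite surface_measureE lte_mul_pinfty//.
apply: le_lt_trans (ltuple_ball_lty R n); apply: le_measure => [||x []//].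
  by rewrite inE; apply: measurable_dir_ball; exact: measurable_tuple_sphere.
by rewrite inE; exact: measurable_tuple_ball.
Qed.

Lemma tuple_norm_dir (x : RT) : tuple_norm x != 0 -> tuple_norm (tuple_dir x) = 1.
Proof.
move=> x0; rewrite {1}/tuple_norm.
under eq_bigr do rewrite tnth_mktuple expr_div_n.
rewrite -mulr_suml -[X in Num.sqrt (X / _)]sqr_sqrtr; last first.
  by apply: sumr_ge0 => i _; exact: sqr_ge0.
by rewrite -/(tuple_norm x) divff ?sqrtr1// expf_neq0.
Qed.

Lemma surface_measure_gt0 : (0 < n)%N -> 0 < fine (sigma S).
Proof.
move=> n0; apply: fine_gt0; rewrite surface_measure_lty andbT surface_measureE.
apply: mule_gt0.
  by rewrite lte_fin normr_gt0 invr_eq0 gt_eqF.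
apply: lt_le_trans (ltuple_ball_gt0 R n) _; apply: le_measure.
- by rewrite inE; exact: measurable_ball_neq0.
- by rewrite inE; apply: measurable_dir_ball; exact: measurable_tuple_sphere.
move=> x [xB x0]; split => //; rewrite /= /tuple_sphere /= tuple_norm_dir//.
rewrite gt_eqF// sqrtr_gt0 (bigD1 (Ordinal n0))//= ltr_pwDl//.
  by rewrite exprn_even_gt0//= x0.
by apply: sumr_ge0 => i _; exact: sqr_ge0.
Qed.

Section orthogonal.
Variables T V : RT -> RT.
Hypotheses (mT : measurable_fun setT T).
Hypothesis Tadd : forall x y, T (tadd x y) = tadd (T x) (T y).
Hypothesis Tscale : forall (c : R) x, T (tscale c x) = tscale c (T x).
Hypothesis TV : forall x, T (V x) = x.
Hypothesis Tnorm : forall x, tuple_norm (T x) = tuple_norm x.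

Let TS : T @^-1` S = S.
Proof. by apply/seteqP; split => x; rewrite /tuple_sphere /= Tnorm. Qed.

(** T preserves the ball and commutes with [tuple_dir], so the cone over the preimage of E is the
    preimage of the cone over E. *)
Lemma surface_measure_orthogonal (E : set RT) : measurable E ->
  sigma (T @^-1` E) = sigma E.
Proof.
move=> mE; rewrite !surface_measureE; congr (_ * _)%E.
have mF := measurable_dir_ball mE.
rewrite -(ltuple_orthogonal mT Tadd Tscale TV Tnorm mF).
congr (mu _); apply/seteqP.
have dirE x : tuple_dir (T x) = T (tuple_dir x).
  have E1 (y : RT) : tuple_dir y = tscale (tuple_norm y)^-1 y.
    by apply: eq_from_tnth => i; rewrite !tnth_mktuple mulrC.
  by rewrite !E1 Tscale Tnorm.
by split => x /=; rewrite /tuple_ball /= Tnorm dirE.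
Qed.

Lemma Rintegral_orthogonal (f : RT -> R) (M : R) : measurable_fun S f ->
  (forall x, S x -> `|f x| <= M) ->
  Rintegral sigma S (fun x => f (T x)) = Rintegral sigma S f.
Proof.
move=> mf fM; have mS := measurable_tuple_sphere.
have ST x : S x -> S (T x) by move=> Sx; rewrite /tuple_sphere /= Tnorm.
(* The extension by zero is measurable on the whole space, as integration against a pushforward
   requires. *)
pose g := f \_ S.
have mg : measurable_fun setT g by apply/measurable_restrict => //; rewrite setTI.
have mgT : measurable_fun setT (g \o T) by exact: measurableT_comp.
have gE x : S x -> g x = f x by move=> Sx; rewrite /g patchE mem_set.
rewrite /Rintegral; congr fine.
transitivity (\int[sigma]_(x in S) (g (T x))%:E)%E.
  by apply: eq_integral => x; rewrite inE => Sx; rewrite gE//; exact: ST.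
transitivity (\int[sigma]_(x in S) (g x)%:E)%E; last first.
  by apply: eq_integral => x; rewrite inE => Sx; rewrite gE.
have := @integral_pushforward _ _ _ _ R T mT sigma S (EFin \o g).
rewrite TS => <-//.
- apply: eq_measure_integral => A mA AS; exact: (surface_measure_orthogonal mA).
- exact/measurable_EFinP.
apply: measurable_bounded_integrable => //; first exact: surface_measure_lty.
  exact: measurable_funS mgT.
exists M; split; rewrite ?num_real// => y My x Sx /=.
by rewrite gE ?(le_trans (fM _ (ST _ Sx)))// ?ltW//; exact: ST.
Qed.

Lemma cint_orthogonal (h : RT -> R[i]) : bmeas S h ->
  cint sigma S (fun x => h (T x)) = cint sigma S h.
Proof.
move=> [h1 h2 [M hM]]; apply: complex_eqP => /=.
  apply: (Rintegral_orthogonal h1 (M := M)) => x /hM; apply: le_trans; exact: ler_Re.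
apply: (Rintegral_orthogonal h2 (M := M)) => x /hM; apply: le_trans; exact: ler_Im.
Qed.

End orthogonal.
End surface.

Section unitary.
Variables (R : realType) (N : nat).
Local Notation C := R[i].
Local Notation CN := 'cV[C]_N.
Local Notation RT := ((N + N).-tuple (measurableTypeR R)).
Local Notation sigma := (@surface_measure R (N + N)).
Local Notation S := (@tuple_sphere R (N + N)).
Local Notation cv := (@complex_vector R N).

Lemma dotcDl (x y z : CN) : dotc (x + y) z = dotc x z + dotc y z.
Proof. by rewrite /dotc -big_split; apply: eq_bigr => j _; rewrite mxE mulrDl. Qed.

Lemma dotcZl a (x z : CN) : dotc (a *: x) z = a * dotc x z.
Proof. by rewrite /dotc big_distrr /=; apply: eq_bigr => j _; rewrite mxE mulrA. Qed.

Lemma dotcC (x y : CN) : dotc x y = Num.conj (dotc y x).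
Proof.
rewrite /dotc rmorph_sum; apply: eq_bigr => j _.
by rewrite rmorphM /= conjCK mulrC.
Qed.

Lemma dotcDr (x y z : CN) : dotc z (x + y) = dotc z x + dotc z y.
Proof. by rewrite dotcC dotcDl rmorphD /= -!dotcC. Qed.

Lemma dotcZr a (x z : CN) : dotc z (a *: x) = Num.conj a * dotc z x.
Proof. by rewrite dotcC dotcZl rmorphM /= -dotcC. Qed.

Lemma dotcNl (x z : CN) : dotc (- x) z = - dotc x z.
Proof. by rewrite -scaleN1r dotcZl mulN1r. Qed.

Lemma dotcNr (x z : CN) : dotc z (- x) = - dotc z x.
Proof. by rewrite dotcC dotcNl rmorphN /= -dotcC. Qed.

Lemma dotcBl (x y z : CN) : dotc (x - y) z = dotc x z - dotc y z.
Proof. by rewrite dotcDl dotcNl. Qed.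

Lemma dotcBr (x y z : CN) : dotc z (x - y) = dotc z x - dotc z y.
Proof. by rewrite dotcDr dotcNr. Qed.

Lemma dotc0l (z : CN) : dotc 0 z = 0.
Proof. by rewrite -(scale0r 0) dotcZl mul0r. Qed.

Lemma dotc0r (z : CN) : dotc z 0 = 0.
Proof. by rewrite dotcC dotc0l rmorph0. Qed.

Lemma dotc_sum (z : CN) : dotc z z = (\sum_j cabs (z j 0) ^+ 2)%:C.
Proof. by rewrite /dotc rmorph_sum; apply: eq_bigr => j _; rewrite cabs_sqr. Qed.

Lemma enorm_ge0 (z : CN) : 0 <= enorm z.
Proof. exact: sqrtr_ge0. Qed.

Lemma enorm_sqr (z : CN) : enorm z ^+ 2 = \sum_j cabs (z j 0) ^+ 2.
Proof.
rewrite /enorm sqr_sqrtr dotc_sum //=.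
by apply: sumr_ge0 => j _; exact: sqr_ge0.
Qed.

Lemma dotcE (z : CN) : dotc z z = (enorm z ^+ 2)%:C.
Proof. by rewrite enorm_sqr dotc_sum. Qed.

Lemma enormZ a (z : CN) : enorm (a *: z) = cabs a * enorm z.
Proof.
apply/eqP; rewrite -(@eqrXn2 _ 2)// ?mulr_ge0 ?enorm_ge0 ?cabs_ge0//.
rewrite exprMn !enorm_sqr big_distrr /=; apply/eqP/eq_bigr => j _.
by rewrite mxE cabsM exprMn.
Qed.

Lemma tuple_norm_cv (x : RT) : tuple_norm x = enorm (cv x).
Proof.
rewrite /tuple_norm /enorm dotc_sum /=; congr Num.sqrt.
transitivity (\sum_(j < N) (tnth x (lshift N j) ^+ 2 + tnth x (rshift N j) ^+ 2)).
  by rewrite big_split /= big_split_ord.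
by apply: eq_bigr => j _; rewrite mxE cabsE sqr_sqrtr ?addr_ge0 ?sqr_ge0.
Qed.

Definition real_tuple (z : CN) : RT :=
  [tuple match fintype.split i with
         | inl j => complex.Re (z j 0) | inr j => complex.Im (z j 0) end | i < N + N].

Lemma real_tupleK z : cv (real_tuple z) = z.
Proof.
apply/matrixP => j k; rewrite (ord1 k) mxE !tnth_mktuple.
by rewrite (unsplitK (inl _ j)) (unsplitK (inr _ j)); case: (z j 0).
Qed.

Lemma complex_vectorK x : real_tuple (cv x) = x.
Proof.
apply: eq_from_tnth => i; rewrite tnth_mktuple -{2}(splitK i).
by case: (fintype.split i) => j /=; rewrite mxE.
Qed.

Lemma cv_tadd x y : cv (tadd x y) = cv x + cv y.
Proof. by apply/matrixP => j k; rewrite !mxE !tnth_mktuple. Qed.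

Lemma cv_tscale (c : R) x : cv (tscale c x) = c%:C *: cv x.
Proof.
apply/matrixP => j k; rewrite !mxE !tnth_mktuple.
by apply: complex_eqP; rewrite ?(cReM, cImM) /= ?mul0r ?subr0 ?addr0.
Qed.

Section action.
Variables (U W : 'M[C]_N).
Hypotheses (UW : U *m W = 1%:M) (Unorm : forall z, enorm (U *m z) = enorm z).

Let T x := real_tuple (U *m cv x).

Let mT : measurable_fun setT T.
Proof.
apply/measurable_fun_tnthP => i.
pose f (x : RT) := \sum_k U (match fintype.split i with inl j => j | inr j => j end) k * cv x k 0.
have mf : measurable_fun setT (fun x => complex.Re (f x)) /\
    measurable_fun setT (fun x => complex.Im (f x)).
  have mR k : measurable_fun setT (fun x => complex.Re (cv x k 0)).
    by under eq_fun do rewrite mxE /=; exact: measurable_tnth.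
  have mI k : measurable_fun setT (fun x => complex.Im (cv x k 0)).
    by under eq_fun do rewrite mxE /=; exact: measurable_tnth.
  split.
    have -> : (fun x => complex.Re (f x)) = (fun x => \sum_k
      complex.Re (U (match fintype.split i with inl j => j | inr j => j end) k * cv x k 0)).
      apply/funext => x; rewrite /f; elim/big_ind2: _ => //= _ u _ v <- <-.
      by rewrite cReD.
    apply: measurable_sum => k; under eq_fun do rewrite cReM.
    by apply: measurable_funB; apply: measurable_funM.
  have -> : (fun x => complex.Im (f x)) = (fun x => \sum_k
      complex.Im (U (match fintype.split i with inl j => j | inr j => j end) k * cv x k 0)).
      apply/funext => x; rewrite /f; elim/big_ind2: _ => //= _ u _ v <- <-.
      by rewrite cImD.
    apply: measurable_sum => k; under eq_fun do rewrite cImM.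
    by apply: measurable_funD; apply: measurable_funM.
case: mf => mf1 mf2.
rewrite (_ : _ \o _ = fun x => if fintype.split i is inl j then complex.Re (f x) else complex.Im (f x)).
  by case: (fintype.split i).
apply/funext => x; rewrite /= /T tnth_mktuple /f.
by case: (fintype.split i) => j; rewrite mxE.
Qed.

Lemma sphere_integral_unitary (F : CN -> C) : bmeas S (fun x => F (cv x)) ->
  sphere_integral (fun z => F (U *m z)) = sphere_integral F.
Proof.
move=> bF.
have cvT x : cv (T x) = U *m cv x by exact: real_tupleK.
transitivity (cint sigma S (fun x => F (cv (T x)))).
  by rewrite /sphere_integral /cint; congr (_ +i* _); apply: eq_Rintegral => x _;
    rewrite cvT.
apply: (@cint_orthogonal R (N + N) T (fun x => real_tuple (W *m cv x)) mT _ _ _ _ _ bF).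
- move=> x y; rewrite -[RHS]complex_vectorK cv_tadd !cvT.
  by rewrite /T cv_tadd mulmxDr.
- move=> c x; rewrite -[RHS]complex_vectorK cv_tscale !cvT.
  by rewrite /T cv_tscale -scalemxAr.
- by move=> x; rewrite /T real_tupleK mulmxA UW mul1mx complex_vectorK.
- by move=> x; rewrite !tuple_norm_cv cvT Unorm.
Qed.

End action.
End unitary.

(** * Continuity and holomorphy on the ball *)

Section euclidean.
Variables (R : realType) (N : nat).
Local Notation C := R[i].
Local Notation CN := 'cV[C]_N.

Lemma dotc_cauchy_schwarz (z w : CN) : cabs (dotc z w) <= enorm z * enorm w.
Proof.
have [w0|w0] := eqVneq (enorm w) 0.
  have wE : w = 0.
    apply/matrixP => j k; rewrite (ord1 k) mxE; apply/eqP; rewrite -cabs_eq0.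
    have := enorm_sqr w; rewrite w0 expr0n /= => /esym/eqP; rewrite psumr_eq0 => [|i _].
      by move=> /allP/(_ j); rewrite mem_index_enum expf_eq0 /= => /(_ isT).
    exact: sqr_ge0.
  by rewrite wE dotc0r cabs0 mulr_ge0 ?enorm_ge0.
have W0 : 0 < enorm w by rewrite lt_def w0 enorm_ge0.
(* The coefficient of the orthogonal projection of z on w; the inequality is the positivity of |z -
   a w| ^ 2. *)
pose a := dotc z w / (enorm w ^+ 2)%:C.
have w2 : (enorm w ^+ 2)%:C != 0 :> C by rewrite -cabs_eq0 cabsR normr_eq0 expf_neq0.
have := dotcE (z - a *: w).
rewrite dotcBl !dotcBr dotcZl !dotcZr dotcZl !dotcE => h.
have {h} h : (enorm z ^+ 2)%:C - (cabs (dotc z w) ^+ 2 / enorm w ^+ 2)%:C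
    = (enorm (z - a *: w) ^+ 2)%:C :> C.
  have -> : (cabs (dotc z w) ^+ 2 / enorm w ^+ 2)%:C =
      dotc z w * Num.conj (dotc z w) / (enorm w ^+ 2)%:C :> C.
    by rewrite cabs_sqr -fmorphV -rmorphM.
  have aJ : Num.conj a = Num.conj (dotc z w) / (enorm w ^+ 2)%:C.
    rewrite /a rmorphM /=; congr (_ * _); rewrite -fmorphV.
    by apply: complex_eqP; rewrite ?(cReJ, cImJ)//= oppr0.
  rewrite -h aJ /a [dotc w z]dotcC; field.
  by rewrite -cabs_eq0 cabsR normr_eq0.
have {h} : enorm z ^+ 2 - cabs (dotc z w) ^+ 2 / enorm w ^+ 2 = enorm (z - a *: w) ^+ 2.
  by apply: (@complexI R); rewrite rmorphB.
move=> h; have : 0 <= enorm z ^+ 2 - cabs (dotc z w) ^+ 2 / enorm w ^+ 2.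
  by rewrite h sqr_ge0.
rewrite subr_ge0 ler_pdivrMr ?exprn_gt0// -exprMn => h2.
by rewrite -(@ler_pXn2r _ 2)// ?nnegrE ?mulr_ge0 ?enorm_ge0 ?cabs_ge0.
Qed.

Lemma enormD (z w : CN) : enorm (z + w) <= enorm z + enorm w.
Proof.
rewrite -(@ler_pXn2r _ 2)// ?nnegrE ?addr_ge0 ?enorm_ge0//.
have h : (enorm (z + w) ^+ 2)%:C = (enorm z ^+ 2 + enorm w ^+ 2)%:C + (dotc z w + Num.conj (dotc z w)) :> C.
  by rewrite -dotcE dotcDl !dotcDr !dotcE -dotcC rmorphD /=; ring.
have {h} -> : enorm (z + w) ^+ 2 = enorm z ^+ 2 + enorm w ^+ 2 + complex.Re (dotc z w) *+ 2.
  by move/(congr1 (@complex.Re R)): h; rewrite !cReD cReJ /= mulr2n.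
have := le_trans (ler_norm _) (le_trans (ler_Re (dotc z w)) (dotc_cauchy_schwarz z w)).
by rewrite sqrrD mulr2n => h; lra.
Qed.

Lemma enormN (z : CN) : enorm (- z) = enorm z.
Proof. by rewrite -scaleN1r enormZ cabsN cabs1 mul1r. Qed.

Lemma enorm_dist (z w : CN) : `|enorm z - enorm w| <= enorm (z - w).
Proof.
rewrite ler_norml; apply/andP; split.
  rewrite lerBrDl lerBlDr -(enormN (z - w)) opprB.
  by apply: le_trans (enormD _ _); rewrite addrC subrK.
by rewrite lerBlDr; apply: le_trans (enormD _ _); rewrite subrK.
Qed.

Lemma enorm0 : enorm (0 : CN) = 0.
Proof. by rewrite -(scale0r 0) enormZ cabs0 mul0r. Qed.

Lemma cabs_coord_le (z : CN) j : cabs (z j 0) <= enorm z.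
Proof.
rewrite -(@ler_pXn2r _ 2)// ?nnegrE ?enorm_ge0 ?cabs_ge0//.
by rewrite enorm_sqr (bigD1 j)//= lerDl sumr_ge0// => i _; rewrite sqr_ge0.
Qed.

Lemma enorm_le_sum (z : CN) : enorm z <= \sum_j cabs (z j 0).
Proof.
rewrite -(@ler_pXn2r _ 2)// ?nnegrE ?enorm_ge0 ?sumr_ge0// => [|i _]; last exact: cabs_ge0.
rewrite enorm_sqr expr2 big_distrl /=; apply: ler_sum => j _.
rewrite expr2 ler_wpM2l ?cabs_ge0// (bigD1 j)//= lerDl sumr_ge0// => i _.
exact: cabs_ge0.
Qed.

(** Continuity for the Euclidean norm in explicit form, to which [hol_at_ctsat] reduces the abstract
    notion. *)
Definition ctsat (F : CN -> C) (z : CN) : Prop := forall e : R, 0 < e ->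
  exists2 del : R, 0 < del & forall w, enorm (w - z) <= del -> cabs (F w - F z) <= e.

Section measurability.
Local Notation RT := ((N + N).-tuple (measurableTypeR R)).
Local Notation S := (@tuple_sphere R (N + N)).
Local Notation cv := (@complex_vector R N).

Definition rounding k (x : RT) : RT :=
  [tuple (Num.floor (tnth x i * k.+1%:R))%:~R / k.+1%:R | i < N + N].

(** Rounding to the grid of mesh 1 / (k + 1) takes countably many values on measurable cells, so
    composing it with an arbitrary function gives a measurable one. *)
Lemma measurable_rounding k (g : RT -> R) : measurable_fun setT (g \o rounding k).
Proof.
move=> _ Y mY; rewrite setTI.
pose fib (c : (N + N).-tuple int) : set RT :=
  [set x | forall i, Num.floor (tnth x i * k.+1%:R) = tnth c i].
pose pt (c : (N + N).-tuple int) : RT := [tuple (tnth c i)%:~R / k.+1%:R | i < N + N].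
rewrite (_ : _ @^-1` _ = \bigcup_(c in [set c | Y (g (pt c))]) fib c).
  rewrite bigcup_mkcond; apply: countable_bigcupT_measurable => // c.
  case: ifP => // _.
  rewrite (_ : fib c = \bigcap_(i in [set: 'I_(N + N)])
    ((fun x : RT => tnth x i) @^-1` `[(tnth c i)%:~R / k.+1%:R, (tnth c i + 1)%:~R / k.+1%:R[)).
    apply: fin_bigcap_measurable => [|i _]; first exact: finite_finset.
    by rewrite -[X in measurable X]setTI; exact: measurable_tnth.
  have k0 : (0 : R) < k.+1%:R by rewrite ltr0n.
  apply/seteqP; split => x /= h i.
    move=> _; rewrite /= in_itv /= ler_pdivrMr// ltr_pdivlMr// -(h i).
    by rewrite Num.Theory.floor_itv.
  have /= := h i I; rewrite in_itv /= ler_pdivrMr// ltr_pdivlMr//.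
  by move=> /Num.Theory.floor_def.
apply/seteqP; split => x /=.
  move=> Yx; exists [tuple Num.floor (tnth x i * k.+1%:R) | i < N + N].
    rewrite /= (_ : pt _ = rounding k x)//.
    by apply: eq_from_tnth => i; rewrite !tnth_mktuple.
  by move=> i; rewrite tnth_mktuple.
move=> [c Yc fc]; rewrite (_ : rounding k x = pt c)//.
by apply: eq_from_tnth => i; rewrite !tnth_mktuple fc.
Qed.

End measurability.
End euclidean.

Section continuous_on_sphere.
Variables (R : realType) (N : nat).
Local Notation C := R[i].
Local Notation CN := 'cV[C]_N.
Local Notation RT := ((N + N).-tuple (measurableTypeR R)).
Local Notation S := (@tuple_sphere R (N + N)).
Local Notation cv := (@complex_vector R N).

Lemma enorm_tuple_le (x : RT) (e : R) : (forall i, `|tnth x i| <= e) ->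
  enorm (cv x) <= (N + N)%:R * e.
Proof.
move=> xe; apply: (le_trans (enorm_le_sum _)).
apply: (@le_trans _ _ (\sum_(j < N) (e + e))).
  apply: ler_sum => j _; apply: (le_trans (cabs_le_ReIm _)).
  by rewrite mxE /= lerD.
by rewrite sumr_const card_ord -[(e + e) *+ N]mulr_natl natrD; lra.
Qed.

Lemma rounding_dist k (x : RT) :
  enorm (cv (rounding k x) - cv x) <= (N + N)%:R / k.+1%:R.
Proof.
have -> : cv (rounding k x) - cv x = cv (tadd (rounding k x) (tscale (-1) x)).
  by rewrite cv_tadd cv_tscale rmorphN rmorph1 scaleN1r.
apply: enorm_tuple_le => i; rewrite !tnth_mktuple mulN1r.
have k0 : (0 : R) < k.+1%:R by rewrite ltr0n.
have -> : (Num.floor (tnth x i * k.+1%:R))%:~R / k.+1%:R - tnth x i =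
  ((Num.floor (tnth x i * k.+1%:R))%:~R - tnth x i * k.+1%:R) / k.+1%:R :> R.
  by field; rewrite gt_eqF.
rewrite normrM [X in _ * X]ger0_norm ?invr_ge0 ?(ltW k0)//.
rewrite -[leRHS]mul1r ler_wpM2r ?invr_ge0 ?(ltW k0)//.
have /andP[h1 h2] := Num.Theory.floor_itv (tnth x i * k.+1%:R).
move: h2; rewrite rmorphD /= => h2.
by rewrite ler_norml; apply/andP; split; lra.
Qed.

(** On the sphere F is the pointwise limit of its roundings. Rounded points leave the sphere, so
    continuity is required with respect to all nearby points of the space. *)
Lemma bmeas_ctsat (F : CN -> C) (M : R) :
  (forall z, enorm z = 1 -> ctsat F z) -> (forall z, enorm z = 1 -> cabs (F z) <= M) ->
  bmeas S (fun x => F (cv x)).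
Proof.
move=> Fc FM.
have Sn x : S x -> enorm (cv x) = 1 by rewrite -tuple_norm_cv.
have cv_rounding x : S x -> forall e : R, 0 < e ->
    \forall k \near \oo, cabs (F (cv (rounding k x)) - F (cv x)) <= e.
  move=> /Sn/Fc h e e0; have [del del0 hdel] := h e e0.
  have N0 : (0 : R) < (N + N).+1%:R by rewrite ltr0n.
  exists (Num.bound ((N + N)%:R / del)) => // k /= Mk; apply: hdel.
  apply: (le_trans (rounding_dist _ _)).
  have k0 : (0 : R) < k.+1%:R by rewrite ltr0n.
  rewrite ler_pdivrMr// mulrC -ler_pdivrMr//.
  apply: (le_trans (ltW (Num.Theory.archi_boundP _))).
    by rewrite divr_ge0// ltW.
  by rewrite ler_nat (leq_trans Mk).
split.
- apply: (@measurable_fun_cvg _ _ _ _ (fun k x => complex.Re (F (cv (rounding k x))))).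
    move=> k; apply: measurable_funTS.
    exact: (measurable_rounding k (fun x => complex.Re (F (cv x)))).
  by move=> x /cv_rounding h; have [] := cvg_ReIm h.
- apply: (@measurable_fun_cvg _ _ _ _ (fun k x => complex.Im (F (cv (rounding k x))))).
    move=> k; apply: measurable_funTS.
    exact: (measurable_rounding k (fun x => complex.Im (F (cv x)))).
  by move=> x /cv_rounding h; have [] := cvg_ReIm h.
- by exists M => x /Sn /FM.
Qed.

Let vecof (v : 'rV[R]_(N + N)) : CN := cv [tuple v ord0 i | i < N + N].

Let vecof_dist (u v : 'rV[R]_(N + N)) (e : R) : (forall i, `|u ord0 i - v ord0 i| <= e) ->
  enorm (vecof u - vecof v) <= (N + N)%:R * e.
Proof.
move=> uv.
have -> : vecof u - vecof v = cv [tuple u ord0 i - v ord0 i | i < N + N].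
  apply/matrixP => j k; rewrite !mxE !tnth_mktuple.
  exact: complex_eqP.
by apply: enorm_tuple_le => i; rewrite tnth_mktuple.
Qed.

Let near_vecof (v : 'rV[R]_(N + N)) (del : R) : 0 < del ->
  \forall u \near v, enorm (vecof u - vecof v) <= del.
Proof.
move=> del0; have N0 : (0 : R) < (N + N).+1%:R by rewrite ltr0n.
have e0 : 0 < del / (N + N).+1%:R by rewrite divr_gt0.
apply/nbhs_ballP; exists (del / (N + N).+1%:R) => // u [_ vu].
apply: (le_trans (vecof_dist (e := del / (N + N).+1%:R) _)) => [i|].
  by have := vu ord0 i; rewrite /ball /= distrC => /ltW.
rewrite mulrCA ler_piMr ?(ltW del0)// ler_pdivrMr// mul1r ler_nat.
exact: leqnSn.
Qed.

(** Compactness of the closed ball, obtained from that of closed bounded sets of real row vectors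
    through [vecof]. *)
Lemma bounded_ctsat (F : CN -> C) (rho : R) :
  (forall z, enorm z <= rho -> ctsat F z) ->
  exists M : R, forall z, enorm z <= rho -> cabs (F z) <= M.
Proof.
move=> Fc.
pose K : set 'rV[R]_(N + N) := [set v | enorm (vecof v) <= rho].
have cK : compact K.
  apply: bounded_closed_compact.
    exists rho; split; rewrite ?num_real// => y rhoy v /= Kv.
    rewrite [leLHS]/Num.norm /= mx_normrE; apply: bigmax_le => [|[i j] _ /=].
      by rewrite (le_trans (enorm_ge0 (vecof v)))// (le_trans Kv)// ltW.
    rewrite (ord1 i) (le_trans _ (ltW rhoy))// (le_trans _ Kv)//.
    rewrite -tuple_norm_cv -sqrtr_sqr ler_wsqrtr// (bigD1 j)//= tnth_mktuple lerDl.
    by rewrite sumr_ge0// => k _; rewrite sqr_ge0.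
  have cn : continuous (fun v => enorm (vecof v)).
    move=> v; apply/(@cvgrPdist_le _ R^o _ (nbhs (v : 'rV[R]_(N + N)))) => e e0; near=> u; rewrite distrC.
    by rewrite (le_trans (enorm_dist _ _))//; near: u; exact: near_vecof.
  have -> : K = (fun v => enorm (vecof v)) @^-1` [set y | y <= rho] by [].
  by apply: closed_comp => [v _|]; [exact: cn|exact: closed_le].
have cF : {within K, continuous (fun v => cabs (F (vecof v)) : R^o)}.
  apply: continuous_in_subspaceT => v; rewrite inE => Kv.
  apply/(@cvgrPdist_le _ R^o _ (nbhs (v : 'rV[R]_(N + N)))) => e e0; have [del del0 hdel] := Fc _ Kv e e0.
  near=> u; rewrite distrC (le_trans (cabs_dist _ _))// hdel//.
  by near: u; exact: near_vecof.
have [M [_ hM]] := compact_bounded (continuous_compact cF cK).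
exists (M + 1) => z zrho.
have zE : vecof (\row_i tnth (real_tuple z) i) = z.
  rewrite /vecof -[RHS]real_tupleK; congr (cv _).
  by apply: eq_from_tnth => i; rewrite tnth_mktuple mxE.
rewrite -[leLHS]ger0_norm ?cabs_ge0//.
apply: (hM (M + 1) _ (cabs (F z))); first by rewrite ltrDl.
by exists (\row_i tnth (real_tuple z) i); rewrite /K /= zE.
Unshelve. all: by end_near. Qed.

Lemma ctsat_dotc (w z : CN) : ctsat (fun u => dotc u w) z.
Proof.
move=> e e0; have w1 : 0 < enorm w + 1 by rewrite ltr_wpDl ?enorm_ge0.
exists (e / (enorm w + 1)); first by rewrite divr_gt0.
move=> u; rewrite ler_pdivlMr// => uz; rewrite -dotcBl.
apply: (le_trans (dotc_cauchy_schwarz _ _)); apply: le_trans uz.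
by rewrite ler_wpM2l ?enorm_ge0// lerDl.
Qed.

Lemma bmeas_dotc (w : CN) : bmeas S (fun x => dotc (cv x) w).
Proof.
apply: (@bmeas_ctsat (fun z => dotc z w) (enorm w)) => z z1; first exact: ctsat_dotc.
by rewrite (le_trans (dotc_cauchy_schwarz _ _))// z1 mul1r.
Qed.

End continuous_on_sphere.

(* The topology on ['cV[K]_n] is only inferred for an abstract [K], hence this
   section; it is later used with [K := R[i]]. *)
Section frechet.
Variables (K : numFieldType) (n : nat).
Implicit Types (f g : 'cV[K]_n -> K) (z w : 'cV[K]_n).

Definition hol_at f z : Prop := differentiable (f : _ -> K^o) z.

Lemma mx_norm_le z (b : K) : 0 <= b -> (forall j, `|z j 0| <= b) -> `|z| <= b.
Proof.
move=> b0 zb; rewrite [leLHS]/Num.norm /= mx_normE.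
have -> : b = (NngNum b0)%:num by [].
rewrite num_le; elim/big_ind: _ => [|x y hx hy|[j k] _].
- by rewrite -num_le.
- by rewrite ge_max hx.
- by rewrite -num_le /= (ord1 k) zb.
Qed.

(** The size of w - z is measured by a bound b on its coordinates rather than by a matrix norm,
    which keeps the conclusion usable at K = [R[i]]. *)
Lemma hol_at_expand f z : hol_at f z ->
  exists2 L : 'cV[K]_n -> K, forall a u, L (a *: u) = a * L u &
  forall e : K, 0 < e -> exists2 del : K, 0 < del & forall w (b : K),
    0 <= b -> b < del -> (forall j, `|(w - z) j 0| <= b) ->
    `|f w - f z - L (w - z)| <= e * b.
Proof.
move=> df; exists ('d (f : _ -> K^o) z) => [a u|e e0]; first by rewrite linearZ.
have /eqaddoP := diff_locally df.
move=> /(_ _ e0)/nbhs_ballP[del /= del0 h]; exists del => // w b b0 bdel wb.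
have : ball 0 del (w - z).
  rewrite mx_norm_ball /ball_ /= sub0r normrN.
  by rewrite (le_lt_trans (mx_norm_le b0 wb)).
move=> /h /=; rewrite !fctE /= subrK opprD addrA => h'.
by apply: (le_trans h'); rewrite ler_wpM2l ?mx_norm_le// ltW.
Qed.

Lemma hol_at_continuous f z : hol_at f z -> forall e : K, 0 < e ->
  exists2 del : K, 0 < del & forall w (b : K),
    0 <= b -> b < del -> (forall j, `|(w - z) j 0| <= b) -> `|f w - f z| <= e.
Proof.
move=> /differentiable_continuous cf e e0.
have /cvgrPdist_le/(_ _ e0)/nbhs_ballP[del /= del0 h] := cf.
exists del => // w b b0 bdel wb; rewrite distrC; apply: h.
rewrite mx_norm_ball /ball_ /= -normrN opprB.
by rewrite (le_lt_trans (mx_norm_le b0 wb)).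
Qed.

Lemma hol_at_cst (c : K) z : hol_at (fun=> c) z.
Proof. exact: differentiable_cst. Qed.

Lemma hol_at_coord j z : hol_at (fun w => w j 0) z.
Proof. exact: differentiable_coord. Qed.

Lemma hol_atD f g z : hol_at f z -> hol_at g z -> hol_at (fun w => f w + g w) z.
Proof. by move=> df dg; exact: (differentiableD df dg). Qed.

Lemma hol_atM f g z : hol_at f z -> hol_at g z -> hol_at (fun w => f w * g w) z.
Proof. by move=> df dg; exact: (differentiableM df dg). Qed.

Lemma hol_atX f k z : hol_at f z -> hol_at (fun w => f w ^+ k) z.
Proof.
move=> df; elim: k => [|k IH]; first exact: hol_at_cst.
rewrite /hol_at; under eq_fun do rewrite exprS; exact: hol_atM.
Qed.

Lemma hol_atV f z : f z != 0 -> hol_at f z -> hol_at (fun w => (f w)^-1) z.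
Proof. by move=> fz df; exact: (differentiableV df fz). Qed.

Lemma hol_at_sum (m : nat) (F : 'I_m -> 'cV[K]_n -> K) z :
  (forall j, hol_at (F j) z) -> hol_at (fun w => \sum_(j < m) F j w) z.
Proof.
move=> dF; rewrite /hol_at.
rewrite (_ : (fun w => _) = \sum_(j < m) (F j : _ -> K^o)).
  exact: differentiable_sum.
by apply/funext => w; rewrite fct_sumE.
Qed.

Lemma hol_at_comp f (phi : 'cV[K]_n -> 'cV[K]_n) z :
  (forall j, hol_at (fun w => phi w j 0) z) -> hol_at f (phi z) ->
  hol_at (fun w => f (phi w)) z.
Proof.
move=> dphi df; apply: differentiable_comp => //.
have -> : phi = \sum_(j < n) (fun w => phi w j 0 *: (delta_mx j 0 : 'cV[K]_n)).
  apply/funext => w; rewrite fct_sumE; apply/matrixP => j k.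
  rewrite (ord1 k) summxE (bigD1 j)//= !mxE !eqxx mulr1 big1 ?addr0// => i ij.
  by rewrite !mxE eq_sym (negbTE ij) mulr0.
apply: differentiable_sum => j.
exact: (@differentiableZl K _ _ (fun w => phi w j 0) (delta_mx j 0 : 'cV[K]_n) z (dphi j)).
Qed.

End frechet.

Section holomorphic.
Variables (R : realType) (N : nat).
Local Notation C := R[i].
Local Notation CN := 'cV[C]_N.
Implicit Types (f : CN -> C) (z w : CN).

Lemma posC (e : C) : 0 < e -> exists2 x : R, 0 < x & e = x%:C.
Proof.
rewrite ltcE /= => /andP[/eqP h1 h2]; exists (complex.Re e) => //.
exact: complex_eqP.
Qed.

Lemma hol_at_ctsat f z : hol_at f z -> ctsat f z.
Proof.
move=> cf e e0; have e0' : (0 : C) < e%:C by rewrite ltcR.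
have [del' del'0 h] := hol_at_continuous cf e0'.
have [del del0 delE] := posC del'0.
exists (del / 2) => [|w wz]; first by rewrite divr_gt0.
rewrite -lecR -normr_cabs; apply: (h w (del / 2)%:C).
- by rewrite ler0c divr_ge0// ltW.
- by rewrite delE ltcR gtr_pMr// invf_lt1// ltr1n.
- by move=> j; rewrite normr_cabs lecR (le_trans (cabs_coord_le _ _)).
Qed.

(** The derivative along the complex line is the differential applied to its direction q. *)
Lemma hol_at_slice f (p q : CN) (l : C) : hol_at f (p + l *: q) ->
  exists d, cdiff (fun m => f (p + m *: q)) l d.
Proof.
move=> /hol_at_expand[L LZ h]; exists (L q) => e e0.
have q0 : 0 < enorm q + 1 by rewrite ltr_wpDl ?enorm_ge0.
have e1 : 0 < e / (enorm q + 1) by rewrite divr_gt0.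
have e1' : (0 : C) < (e / (enorm q + 1))%:C by rewrite ltcR.
have [del' del'0 {}h] := h _ e1'; have [del del0 delE] := posC del'0.
exists (del / 2 / (enorm q + 1)) => [|m]; first by rewrite !divr_gt0.
rewrite ler_pdivlMr// => ml.
have E : p + m *: q - (p + l *: q) = (m - l) *: q.
  by rewrite opprD addrACA subrr add0r -scalerBl.
have b0 : 0 <= cabs (m - l) * (enorm q + 1) by rewrite mulr_ge0 ?cabs_ge0// ltW.
have := h (p + m *: q) (cabs (m - l) * (enorm q + 1))%:C.
rewrite E LZ ler0c b0 delE ltcR (le_lt_trans ml); last first.
  by rewrite gtr_pMr// invf_lt1// ltr1n.
move=> /(_ isT isT) h'; rewrite [L q * _]mulrC -lecR -normr_cabs.
apply: (le_trans (h' _)) => [j|].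
  rewrite !mxE normr_cabs lecR cabsM ler_wpM2l ?cabs_ge0//.
  by rewrite (le_trans (cabs_coord_le _ _))// lerDl.
rewrite -rmorphM lecR le_eqVlt; apply/orP; left; apply/eqP.
by field; rewrite gt_eqF.
Qed.

Lemma hol_at_dotc (c z : CN) : hol_at (fun w => dotc w c) z.
Proof.
apply: hol_at_sum => j; apply: hol_atM; first exact: hol_at_coord.
exact: hol_at_cst.
Qed.

End holomorphic.

(** * Averages over circle actions *)

Section roots_of_unity.
Variable R : realType.
Local Notation C := R[i].

Lemma prim_root_exists M : (0 < M)%N -> exists w : C, M.-primitive_root w.
Proof.
move=> M0; have monicM : ('X^M - 1 : {poly C}) \is monic := monicXnsubC 1 M0.
have [r] := closed_field_poly_normal ('X^M - 1 : {poly C}).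
rewrite (monicP monicM) scale1r => E.
have ur : uniq r.
  by rewrite -separable_prod_XsubC -E separable_Xn_sub_1// pnatr_eq0 -lt0n.
have sr : size r = M by apply: succn_inj; rewrite -(size_prod_XsubC r id) -E size_XnsubC.
have rr : all M.-unity_root r.
  by apply/allP => z zr; rewrite /root_of_unity E root_prod_XsubC.
by have /hasP[w _ pw] := has_prim_root M0 rr ur (eq_leq (esym sr)); exists w.
Qed.

Section average.
Variables (M : nat) (w : C).
Hypotheses (M0 : (0 < M)%N) (pw : M.-primitive_root w).

Lemma cabs_prim_root k : cabs (w ^+ k) = 1.
Proof.
rewrite cabsX; have /eqP := congr1 (@cabs R) (prim_expr_order pw).
rewrite cabsX cabs1 pexpr_eq1 ?cabs_ge0// => /eqP ->.
exact: expr1n.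
Qed.

Lemma prim_root_orthogonal i j : (i < M)%N -> (j < M)%N ->
  \sum_(k < M) (w ^+ k) ^+ i * Num.conj ((w ^+ k) ^+ j) = (i == j)%:R * M%:R.
Proof.
move=> iM jM; have w0 k : w ^+ k != 0 by rewrite -cabs_eq0 cabs_prim_root oner_eq0.
have wJ k : Num.conj (w ^+ k) = (w ^+ k)^-1.
  apply: (mulfI (w0 k)); rewrite divff// cabs_sqr cabs_prim_root.
  by rewrite expr1n.
pose q := w ^+ i / w ^+ j.
have -> : \sum_(k < M) (w ^+ k) ^+ i * Num.conj ((w ^+ k) ^+ j) = \sum_(k < M) q ^+ k.
  apply: eq_bigr => k _; rewrite -!exprM wJ ![(k * _)%N]mulnC !exprM -exprVn.
  by rewrite -exprMn.
have [ijE|ij] := eqVneq i j.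
  rewrite mul1r /q ijE divff//; under eq_bigr do rewrite expr1n.
  by rewrite sumr_const card_ord.
rewrite mul0r; have q1 : q - 1 != 0.
  rewrite subr_eq0 /q; apply: contra ij => /eqP qE.
  have /eqP : w ^+ i = w ^+ j by rewrite -[RHS]mul1r -qE divfK.
  by rewrite (eq_prim_root_expr pw) !modn_small.
apply: (mulfI q1); rewrite -subrX1 mulr0 /q expr_div_n -!exprM mulnC (mulnC j).
by rewrite !exprM (prim_expr_order pw) !expr1n divr1 subrr.
Qed.

(** A finite substitute for the mean over the unit circle: orthogonality of powers is exact for
    exponents below M. *)
Definition avg (h : C -> C) : C := M%:R^-1 * \sum_(k < M) h (w ^+ k).

Let cabs_M : cabs (M%:R : C) = M%:R := cabs_nat R M.

Lemma avg_le (h : C -> C) (b : R) : (forall z, cabs z = 1 -> cabs (h z) <= b) ->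
  cabs (avg h) <= b.
Proof.
move=> hb; have M0' : (0 : R) < M%:R by rewrite ltr0n.
rewrite /avg cabsM cabsV cabs_M mulrC ler_pdivrMr//.
apply: (le_trans (cabs_sum _ _ _)).
apply: (@le_trans _ _ (\sum_(k < M) b)).
  by apply: ler_sum => k _; apply: hb; exact: cabs_prim_root.
by rewrite sumr_const card_ord mulr_natr.
Qed.

Lemma avgB (h g : C -> C) : avg (fun z => h z - g z) = avg h - avg g.
Proof. by rewrite /avg sumrB mulrBr. Qed.

(** A discrete Parseval identity. The Taylor polynomials of degree below M satisfy it exactly;
    replacing F and G by them costs k x ^ M k + 2 k k x ^ M with k = K / (1 - x), hence the constant
    3. *)
Lemma avg_ps (F G : C -> C) (c d : nat -> C) (rho K x r s : R) :
  hasps F c rho K -> hasps G d rho K -> 0 <= K -> 0 < rho -> 0 <= x -> x < 1 ->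
  0 <= r <= x * rho -> 0 <= s <= x * rho ->
  cabs (avg (fun z => F (r%:C * z) * Num.conj (G (s%:C * z))) -
    \sum_(n < M) c n * Num.conj (d n) * (r * s)%:C ^+ n)
  <= 3 * (K / (1 - x)) ^+ 2 * x ^+ M.
Proof.
move=> hF hG K0 rho0 x0 x1 rx sx.
have x1' : 0 < 1 - x by rewrite subr_gt0.
pose P z := \sum_(n < M) c n * (r%:C * z) ^+ n.
pose Q z := \sum_(n < M) d n * (s%:C * z) ^+ n.
have PQ : avg (fun z => P z * Num.conj (Q z)) = \sum_(n < M) c n * Num.conj (d n) * (r * s)%:C ^+ n.
  rewrite /avg.
  have -> : \sum_(k < M) P (w ^+ k) * Num.conj (Q (w ^+ k)) =
     \sum_(i < M) \sum_(j < M) c i * Num.conj (d j) * (r%:C ^+ i * s%:C ^+ j) *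
       \sum_(k < M) (w ^+ k) ^+ i * Num.conj ((w ^+ k) ^+ j).
    have term i j (z : C) : c i * (r%:C * z) ^+ i * Num.conj (d j * (s%:C * z) ^+ j) =
        c i * Num.conj (d j) * (r%:C ^+ i * s%:C ^+ j) * (z ^+ i * Num.conj (z ^+ j)).
      rewrite !exprMn rmorphM /= rmorphM /=.
      have -> : Num.conj (s%:C ^+ j) = s%:C ^+ j :> C.
        rewrite rmorphXn /=; congr (_ ^+ _).
        by apply: complex_eqP; rewrite ?(cReJ, cImJ)//= oppr0.
      by ring.
    transitivity (\sum_(k < M) \sum_(i < M) \sum_(j < M) c i * Num.conj (d j) *
        (r%:C ^+ i * s%:C ^+ j) * ((w ^+ k) ^+ i * Num.conj ((w ^+ k) ^+ j))).
      apply: eq_bigr => k _; rewrite /P /Q rmorph_sum big_distrlr /=.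
      by apply: eq_bigr => i _; apply: eq_bigr => j _; rewrite -term.
    rewrite exchange_big; apply: eq_bigr => i _ /=.
    rewrite exchange_big; apply: eq_bigr => j _ /=.
    by rewrite big_distrr.
  rewrite big_distrr; apply: eq_bigr => i _ /=.
  under eq_bigr => j _ do rewrite (prim_root_orthogonal (ltn_ord i) (ltn_ord j)).
  rewrite (bigD1 i)//= big1 => [|j ji].
    rewrite eqxx mul1r addr0 rmorphM exprMn.
    by field; rewrite pnatr_eq0 -lt0n.
  by move: ji; rewrite -val_eqE eq_sym => /negbTE ->; rewrite mul0r mulr0.
have bnd (H : C -> C) (e : nat -> C) (t : R) m z : hasps H e rho K -> 0 <= t <= x * rho ->
    cabs z = 1 -> cabs (H (t%:C * z) - \sum_(n < m) e n * (t%:C * z) ^+ n) <= K / (1 - x) * x ^+ m.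
  move=> hH /andP[t0 tx] z1.
  have tz : cabs (t%:C * z) = t by rewrite cabsM cabsR z1 mulr1 ger0_norm.
  have trho : t < rho by rewrite (le_lt_trans tx)// gtr_pMl.
  have := hH (t%:C * z) m; rewrite tz => /(_ trho) /le_trans; apply.
  have tr0 : 0 <= t / rho by rewrite divr_ge0// ltW.
  have tr : t / rho <= x by rewrite ler_pdivrMr.
  rewrite -!mulrA ler_wpM2l// mulrC; apply: ler_pM; rewrite ?invr_ge0 ?subr_ge0 ?exprn_ge0//.
    by rewrite (le_trans tr) ?ltW.
    by rewrite lef_pV2 ?posrE ?subr_gt0 ?lerD2l ?lerN2// (le_lt_trans tr).
  by rewrite lerXn2r ?nnegrE.
rewrite -PQ -avgB; apply: avg_le => z z1.
set k := K / (1 - x); have k0 : 0 <= k by rewrite divr_ge0 ?(ltW x1').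
have F1 := bnd F c r M z hF rx z1; have G1 := bnd G d s M z hG sx z1.
(* The remainder of order 0 is the function itself, so this bounds F and G by k. *)
have F0 := bnd F c r 0%N z hF rx z1; have G0 := bnd G d s 0%N z hG sx z1.
move: F0 G0; rewrite !big_ord0 !subr0 expr0 mulr1 => F0 G0.
have xM1 : x ^+ M <= 1 by rewrite exprn_ile1// ltW.
have xM0 : 0 <= x ^+ M by rewrite exprn_ge0.
have P0 : cabs (P z) <= 2 * k.
  rewrite -[P z](subKr (F (r%:C * z))) (le_trans (cabsB _ _))// mulr2n mulrDl mul1r lerD//.
  by rewrite (le_trans F1)// ler_piMr.
have -> : F (r%:C * z) * Num.conj (G (s%:C * z)) - P z * Num.conj (Q z) =
  (F (r%:C * z) - P z) * Num.conj (G (s%:C * z)) +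
  P z * Num.conj (G (s%:C * z) - Q z) by rewrite rmorphB /=; ring.
apply: (le_trans (cabsD _ _)); rewrite !cabsM !cabsJ.
have -> : 3 * k ^+ 2 * x ^+ M = k * x ^+ M * k + 2 * k * (k * x ^+ M) by ring.
by rewrite lerD// ler_pM ?cabs_ge0.
Qed.

End average.
End roots_of_unity.

Lemma cabsB_le2 (R : realType) (a b : R[i]) (e : R) :
  cabs a <= e -> cabs b <= e -> cabs (a - b) <= 2 * e.
Proof. by move=> ae be; rewrite (le_trans (cabsB _ _))// mulr2n mulrDl mul1r lerD. Qed.

Lemma subr_common (V : zmodType) (a b c : V) : a - b = (a - c) - (b - c).
Proof. by rewrite opprB addrA subrK. Qed.

(** * Integrals over the sphere of dilated holomorphic functions *)

Section sphere_integrals.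
Variables (R : realType) (N : nat).
Hypothesis N0 : (0 < N)%N.
Local Notation C := R[i].
Local Notation CN := 'cV[C]_N.
Local Notation S := (@tuple_sphere R (N + N)).
Local Notation sigma := (@surface_measure R (N + N)).
Local Notation cv := (@complex_vector R N).

Definition sbm (F : CN -> C) := bmeas S (fun x => F (cv x)).
Definition hol_ball (f : CN -> C) := forall z, enorm z < 1 -> hol_at f z.
(** The mass of the sphere is carried as a positive constant, which cancels from the final
    identities. *)
Definition kappa : R := fine (sigma S).

Let mS : measurable S := @measurable_tuple_sphere R (N + N).
Let fS : (sigma S < +oo)%E := surface_measure_lty R (N + N).

Lemma kappa_gt0 : 0 < kappa.
Proof. by apply: surface_measure_gt0; rewrite addn_gt0 N0. Qed.

Let kappa_ge0 : 0 <= kappa := ltW kappa_gt0.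

Lemma enorm_cv x : S x -> enorm (cv x) = 1.
Proof. by rewrite -tuple_norm_cv. Qed.

Lemma eq_sint (F G : CN -> C) : (forall z, enorm z = 1 -> F z = G z) ->
  sphere_integral F = sphere_integral G.
Proof. by move=> FG; apply: eq_cint => x /enorm_cv/FG. Qed.

Lemma sintB F G : sbm F -> sbm G ->
  sphere_integral (fun z => F z - G z) = sphere_integral F - sphere_integral G.
Proof. exact: cintB. Qed.

Lemma sintD F G : sbm F -> sbm G ->
  sphere_integral (fun z => F z + G z) = sphere_integral F + sphere_integral G.
Proof. exact: cintD. Qed.

Lemma sintZ c F : sbm F ->
  sphere_integral (fun z => c * F z) = c * sphere_integral F.
Proof. exact: cintZ. Qed.

Lemma sintJ F : sbm F ->
  sphere_integral (fun z => Num.conj (F z)) = Num.conj (sphere_integral F).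
Proof. exact: cintJ. Qed.

Lemma sint_sum (I : Type) (s : seq I) (F : I -> CN -> C) : (forall i, sbm (F i)) ->
  sphere_integral (fun z => \sum_(i <- s) F i z) = \sum_(i <- s) sphere_integral (F i).
Proof. by move=> bF; apply: (cint_sum mS fS). Qed.

Lemma sint_cst c : sphere_integral (fun _ : CN => c) = c * kappa%:C.
Proof. exact: cint_cst. Qed.

Lemma sint_le F (M : R) : sbm F -> (forall z, enorm z = 1 -> cabs (F z) <= M) ->
  cabs (sphere_integral F) <= 2 * M * kappa.
Proof. by move=> bF FM; apply: (cint_le mS fS bF) => x /enorm_cv/FM. Qed.

Lemma sint_Re_ge F (M : R) : sbm F -> (forall z, enorm z = 1 -> M <= complex.Re (F z)) ->
  M * kappa <= complex.Re (sphere_integral F).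
Proof. by move=> bF FM; apply: (cint_Re_ge mS fS bF) => x /enorm_cv/FM. Qed.

Lemma sint_dominated (F : nat -> CN -> C) (G : CN -> C) (M : R) :
  (forall n, sbm (F n)) -> (forall n z, enorm z = 1 -> cabs (F n z) <= M) ->
  (forall z, enorm z = 1 -> forall e : R, 0 < e ->
    \forall n \near \oo, cabs (F n z - G z) <= e) ->
  sbm G /\ forall e : R, 0 < e ->
    \forall n \near \oo, cabs (sphere_integral (F n) - sphere_integral G) <= e.
Proof.
move=> bF FM FG; apply: (cint_dominated mS fS bF (M := M)).
  by move=> n x /enorm_cv/FM.
by move=> x /enorm_cv/FG.
Qed.

Lemma eq_sbm F G : (forall z, enorm z = 1 -> F z = G z) -> sbm F -> sbm G.
Proof. by move=> FG; apply: eq_bmeas => x /enorm_cv/FG. Qed.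

Lemma sbmD F G : sbm F -> sbm G -> sbm (fun z => F z + G z).
Proof. exact: bmeasD. Qed.
Lemma sbmB F G : sbm F -> sbm G -> sbm (fun z => F z - G z).
Proof. exact: bmeasB. Qed.
Lemma sbmM F G : sbm F -> sbm G -> sbm (fun z => F z * G z).
Proof. exact: bmeasM. Qed.
Lemma sbmZ c F : sbm F -> sbm (fun z => c * F z).
Proof. exact: bmeasZ. Qed.
Lemma sbmJ F : sbm F -> sbm (fun z => Num.conj (F z)).
Proof. exact: bmeasJ. Qed.
Lemma sbmX F n : sbm F -> sbm (fun z => F z ^+ n).
Proof. exact: bmeasX. Qed.
Lemma sbm_cst c : sbm (fun=> c).
Proof. exact: bmeas_cst. Qed.
Lemma sbm_sum (I : Type) (s : seq I) (F : I -> CN -> C) :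
  (forall i, sbm (F i)) -> sbm (fun z => \sum_(i <- s) F i z).
Proof. by move=> bF; exact: (bmeas_sum s predT bF). Qed.
Lemma sbm_dotc w : sbm (fun z => dotc z w).
Proof. exact: bmeas_dotc. Qed.

Lemma hol_ball_ctsat f z : hol_ball f -> enorm z < 1 -> ctsat f z.
Proof. by move=> hf /hf/hol_at_ctsat. Qed.

Lemma hol_ball_bound f (r : R) : hol_ball f -> r < 1 ->
  exists2 M : R, 0 <= M & forall z, enorm z <= r -> cabs (f z) <= M.
Proof.
move=> hf r1; have [z zr|M hM] := @bounded_ctsat R N f r.
  by apply: hol_ball_ctsat => //; exact: le_lt_trans r1.
by exists `|M| => // z /hM/le_trans; apply; exact: ler_norm.
Qed.

Lemma sbm_hol_comp f (phi : CN -> CN) (L r : R) : hol_ball f -> r < 1 -> 0 <= L ->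
  (forall z, enorm z = 1 -> enorm (phi z) <= r) ->
  (forall u z, enorm (phi u - phi z) <= L * enorm (u - z)) ->
  sbm (fun z => f (phi z)).
Proof.
move=> hf r1 L0 phir phiL; have [M _ hM] := hol_ball_bound hf r1.
apply: (@bmeas_ctsat R N (fun z => f (phi z)) M) => z z1; last exact/hM/phir.
have := hol_ball_ctsat hf (le_lt_trans (phir _ z1) r1) => h e e0.
have [del del0 {}h] := h e e0.
have L1 : 0 < L + 1 by rewrite ltr_wpDl.
exists (del / (L + 1)) => [|u]; first by rewrite divr_gt0.
rewrite ler_pdivlMr// => uz; apply: h; apply: (le_trans (phiL _ _)).
by apply: le_trans uz; rewrite mulrC ler_wpM2l ?enorm_ge0// lerDl.
Qed.

Lemma sbm_hol f (c : C) : hol_ball f -> cabs c < 1 -> sbm (fun z => f (c *: z)).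
Proof.
move=> hf c1; apply: (@sbm_hol_comp f (fun z => c *: z) (cabs c) (cabs c)) => //.
- exact: cabs_ge0.
- by move=> z z1; rewrite enormZ z1 mulr1.
- by move=> u z; rewrite -scalerBr enormZ.
Qed.

Lemma sbm_holR f (r : R) : hol_ball f -> 0 <= r -> r < 1 -> sbm (fun z => f (r%:C *: z)).
Proof. by move=> hf r0 r1; apply: sbm_hol => //; rewrite cabsR ger0_norm. Qed.

Lemma geometric_small (x B e : R) : 0 <= x -> x < 1 -> 0 < e ->
  exists2 M : nat, (0 < M)%N & forall n, (M <= n)%N -> B * x ^+ n <= e.
Proof.
move=> x0 x1 e0; have hc : x ^+ n @[n --> \oo] --> (0 : R).
  by apply: cvg_expr; rewrite ger0_norm.
have B1 : 0 < `|B| + 1 by rewrite ltr_wpDl.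
have e'0 : 0 < e / (`|B| + 1) by rewrite divr_gt0.
move/cvgrPdist_le : hc => /(_ _ e'0)[m _ hm]; exists m.+1 => // n mn.
have := hm n (ltnW mn); rewrite /= sub0r normrN ger0_norm ?exprn_ge0//.
rewrite ler_pdivlMr// => h; apply: le_trans h.
rewrite mulrC ler_wpM2l ?exprn_ge0// (le_trans (ler_norm _))// lerDl.
exact: ler01.
Qed.

(** Each of the M unitary maps leaves the integral unchanged, and a finite average commutes with the
    integral by linearity alone. *)
Lemma sint_avg (U : C -> 'M[C]_N) M (om : C) (F : CN -> C) :
  (0 < M)%N -> M.-primitive_root om ->
  (forall l, cabs l = 1 -> exists W, U l *m W = 1%:M) ->
  (forall l z, cabs l = 1 -> enorm (U l *m z) = enorm z) ->
  sbm F -> (forall l, cabs l = 1 -> sbm (fun z => F (U l *m z))) ->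
  sbm (fun z => avg M om (fun l => F (U l *m z))) /\
  sphere_integral F = sphere_integral (fun z => avg M om (fun l => F (U l *m z))).
Proof.
move=> M0 pom UW Un bF bFU; have om1 k : cabs (om ^+ k) = 1 by exact: (cabs_prim_root M0 pom).
have bs k : sbm (fun z => F (U (om ^+ k) *m z)) by exact: bFU.
have bsum : sbm (fun z => \sum_(k < M) F (U (om ^+ k) *m z)).
  by apply: (@sbm_sum _ _ (fun (k : 'I_M) z => F (U (om ^+ k) *m z))) => k.
split; first exact: sbmZ.
rewrite /avg sintZ// (sint_sum _ (F := fun (k : 'I_M) z => F (U (om ^+ k) *m z)))//.
rewrite (eq_bigr (fun=> sphere_integral F)) => [|k _].
  by rewrite sumr_const card_ord -[sphere_integral F *+ M]mulr_natl mulKf// pnatr_eq0 -lt0n.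
have [W UWE] := UW _ (om1 k).
by apply: (sphere_integral_unitary UWE) => // z; exact: Un.
Qed.

Lemma scalar_action (l : C) : cabs l = 1 -> exists W, (l%:M : 'M[C]_N) *m W = 1%:M.
Proof.
move=> l1; exists (l^-1)%:M; rewrite -scalar_mxM divff//.
by rewrite -cabs_eq0 l1 oner_eq0.
Qed.

Lemma sint_rotation M (om : C) (F : CN -> C) : (0 < M)%N -> M.-primitive_root om ->
  sbm F -> (forall l, cabs l = 1 -> sbm (fun z => F (l *: z))) ->
  sbm (fun z => avg M om (fun l => F (l *: z))) /\
  sphere_integral F = sphere_integral (fun z => avg M om (fun l => F (l *: z))).
Proof.
move=> M0 pom bF bFl.
have E : (fun z => avg M om (fun l => F (l *: z))) =
    (fun z => avg M om (fun l => F (l%:M *m z))).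
  by apply/funext => z; congr (_ * _); apply: eq_bigr => k _; rewrite mul_scalar_mx.
rewrite E; apply: (sint_avg (U := fun l => l%:M)) => //.
- exact: scalar_action.
- by move=> l z l1; rewrite mul_scalar_mx enormZ l1 mul1r.
- by move=> l l1; under eq_fun do rewrite mul_scalar_mx; exact: bFl.
Qed.

(** The constant of the remainder is the same for all slices, so that the errors can be integrated
    over the sphere. *)
Lemma slice_ps f (rho : R) z : hol_ball f -> 0 < rho -> rho < 1 -> enorm z <= 1 ->
  forall M : R, (forall u, enorm u <= rho -> cabs (f u) <= M) ->
  exists c, hasps (fun l => f (l *: z)) c rho (2 * M).
Proof.
move=> hf rho0 rho1 z1 M fM; apply: power_series => // [l l1|l lrho]; last first.
  by apply: fM; rewrite enormZ (le_trans _ lrho)// ler_piMr ?cabs_ge0.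
have [|d hd] := @hol_at_slice R N f 0 z l.
  apply: hf; rewrite add0r enormZ (le_lt_trans _ l1)// ler_piMr// cabs_ge0//.
by exists d; under eq_fun do rewrite -[_ *: z]add0r.
Qed.

Section two_radii.
Variables (f g : CN -> C).
Hypotheses (hf : hol_ball f) (hg : hol_ball g).

Let h (r s : R) (z : CN) := f (r%:C *: z) * Num.conj (g (s%:C *: z)).

Lemma sbm_pair (r s : R) : 0 <= r < 1 -> 0 <= s < 1 -> sbm (h r s).
Proof.
by move=> /andP[r0 r1] /andP[s0 s1]; apply: sbmM; [|apply: sbmJ]; exact: sbm_holR.
Qed.

(* Up to an error vanishing with [M], the average only depends on [r * s]. *)
Lemma avg_pair (t : R) : 0 <= t < 1 -> exists B x : R, [/\ 0 <= B, 0 <= x < 1 &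
  forall z, enorm z = 1 -> exists c d : nat -> C, (f = g -> c = d) /\ forall M om, (0 < M)%N -> M.-primitive_root om ->
  forall r s : R, 0 <= r <= t -> 0 <= s <= t ->
  cabs (avg M om (fun l => h r s (l *: z)) -
    \sum_(n < M) c n * Num.conj (d n) * (r * s)%:C ^+ n) <= B * x ^+ M].
Proof.
(* The midpoint satisfies t <= x ^ 2: slices are expanded on the disc of radius x, and radii up to t
   have ratio at most x to it. *)
move=> /andP[t0 t1]; pose x := (1 + t) / 2.
have x0 : 0 < x by rewrite divr_gt0// ltr_pwDl.
have x1 : x < 1 by rewrite ltr_pdivrMr// mul1r -[2]/(1 + 1) ltrD2l.
have tx : t <= x * x by rewrite /x; nra.
have [K1 K10 fK] := hol_ball_bound hf x1; have [K2 K20 gK] := hol_ball_bound hg x1.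
pose K := Num.max K1 K2; have K0 : 0 <= K by rewrite le_max K10.
exists (3 * (2 * K / (1 - x)) ^+ 2), x; split.
- by rewrite mulr_ge0// exprn_ge0// divr_ge0 ?mulr_ge0// subr_ge0 ltW.
- by rewrite x1 ltW.
move=> z z1; have z1' : enorm z <= 1 by rewrite z1.
have fK' u : enorm u <= x -> cabs (f u) <= K.
  by move=> /fK/le_trans; apply; rewrite /K le_max lexx.
have gK' u : enorm u <= x -> cabs (g u) <= K.
  by move=> /gK/le_trans; apply; rewrite /K le_max lexx orbT.
have [c hc] := slice_ps hf x0 x1 z1' fK'.
have [d hd] := slice_ps hg x0 x1 z1' gK'.
(* The coefficients come from an existential statement, so their equality when f = g, which
   [sint_mono] relies on, has to be imposed here. *)
have {d hd} [d hd cd] : exists2 d, hasps (fun l => g (l *: z)) d x (2 * K) & f = g -> c = d.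
  by have [fg|fg] := pselect (f = g); [exists c; rewrite -?fg|exists d].
exists c, d; split=> // M om M0 pom r s /andP[r0 rt] /andP[s0 st].
have := avg_ps M0 pom hc hd (x := x) (r := r) (s := s).
rewrite mulr_ge0// x0 (ltW x0) x1 r0 s0 !(le_trans _ tx)// => /(_ isT isT isT isT isT isT).
rewrite (_ : avg M om (fun l => h r s (l *: z)) = avg M om (fun l => f ((r%:C * l) *: z) * Num.conj (g ((s%:C * l) *: z))))//.
by congr (_ * _); apply: eq_bigr => k _; rewrite /h !scalerA.
Qed.

Lemma sbm_pair_rot (r s : R) l : 0 <= r < 1 -> 0 <= s < 1 -> cabs l = 1 ->
  sbm (fun z => h r s (l *: z)).
Proof.
move=> /andP[r0 r1] /andP[s0 s1] l1; rewrite /h.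
under eq_fun do rewrite !scalerA.
by apply: sbmM; [|apply: sbmJ]; apply: sbm_hol => //; rewrite cabsM cabsR l1 mulr1 ger0_norm.
Qed.

(** After averaging over rotations both integrands are within B x ^ M of the same power series in r
    s. This allows dilations to be moved between the two factors. *)
Lemma sint_two_radii (r s r' s' : R) : 0 <= r < 1 -> 0 <= s < 1 -> 0 <= r' < 1 ->
  0 <= s' < 1 -> r * s = r' * s' ->
  sphere_integral (h r s) = sphere_integral (h r' s').
Proof.
move=> r01 s01 r'01 s'01 rs.
pose t := Num.max (Num.max r s) (Num.max r' s').
have [r0 r1] := andP r01; have [s0 s1] := andP s01.
have [r'0 r'1] := andP r'01; have [s'0 s'1] := andP s'01.
have t01 : 0 <= t < 1 by rewrite !le_max r0 !gt_max r1 s1 r'1 s'1.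
have [B [x [B0 /andP[x0 x1] hB]]] := avg_pair t01.
apply/eqP; rewrite -subr_eq0 -cabs_eq0; apply/eqP/le_anti; rewrite cabs_ge0 andbT.
apply/ler_addgt0Pr => e e0; rewrite add0r.
have [M M0 hM] := geometric_small (2 * (2 * B) * kappa) x0 x1 e0.
have [om pom] := prim_root_exists R M0.
have [b1 ->] := sint_rotation M0 pom (sbm_pair r01 s01) (fun l => @sbm_pair_rot r s l r01 s01).
have [b2 ->] := sint_rotation M0 pom (sbm_pair r'01 s'01) (fun l => @sbm_pair_rot r' s' l r'01 s'01).
apply: le_trans (hM M (leqnn M)); rewrite -sintB//.
have -> : 2 * (2 * B) * kappa * x ^+ M = 2 * (2 * (B * x ^+ M)) * kappa by ring.
apply: sint_le => [|z z1]; first exact: sbmB.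
have [c [d [_ hcd]]] := hB z z1.
have h1 : cabs (avg M om (fun l => h r s (l *: z)) -
    \sum_(n < M) c n * Num.conj (d n) * (r * s)%:C ^+ n) <= B * x ^+ M.
  by apply: hcd => //; rewrite /t ?r0 ?s0 !le_max lexx ?orbT.
have h2 : cabs (avg M om (fun l => h r' s' (l *: z)) -
    \sum_(n < M) c n * Num.conj (d n) * (r' * s')%:C ^+ n) <= B * x ^+ M.
  by apply: hcd => //; rewrite /t ?r'0 ?s'0 !le_max lexx ?orbT.
move: h1 h2; rewrite rs; set X := \sum_(n < M) _ => h1 h2.
rewrite (subr_common _ _ X); exact: (cabsB_le2 h1 h2).
Qed.

End two_radii.

(** Up to an error vanishing with M, the averaged integrand is a power series in r ^ 2 with the
    nonnegative coefficients |c n| ^ 2. *)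
Lemma sint_mono f (r r' : R) : hol_ball f -> 0 <= r -> r <= r' -> r' < 1 ->
  complex.Re (sphere_integral (fun z => f (r%:C *: z) * Num.conj (f (r%:C *: z)))) <=
  complex.Re (sphere_integral (fun z => f (r'%:C *: z) * Num.conj (f (r'%:C *: z)))).
Proof.
move=> hf r0 rr' r'1.
have r'0 := le_trans r0 rr'; have r1 := le_lt_trans rr' r'1.
have r01 : 0 <= r < 1 by rewrite r0. have r'01 : 0 <= r' < 1 by rewrite r'0.
have [B [x [B0 /andP[x0 x1] hB]]] := avg_pair hf hf r'01.
rewrite -subr_ge0; apply/ler_addgt0Pr => e e0; rewrite -lerBlDr sub0r.
have [M M0 hM] := geometric_small ((2 * B) * kappa) x0 x1 e0.
have [om pom] := prim_root_exists R M0.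
have [b1 ->] := sint_rotation M0 pom (sbm_pair hf hf r01 r01) (fun l => @sbm_pair_rot f f hf hf r r l r01 r01).
have [b2 ->] := sint_rotation M0 pom (sbm_pair hf hf r'01 r'01) (fun l => @sbm_pair_rot f f hf hf r' r' l r'01 r'01).
rewrite -cReN -cReD -sintB//.
have b21 := sbmB b2 b1.
apply: (@le_trans _ _ (- (2 * (B * x ^+ M)) * kappa)).
  by rewrite mulNr lerN2 (le_trans _ (hM M (leqnn M)))// !mulrA mulrAC.
apply: sint_Re_ge => // z z1.
have [c [d [cd hcd]]] := hB z z1; move: hcd; rewrite -(cd erefl) => hcd {d cd}.
have h1 := hcd M om M0 pom r r; have h2 := hcd M om M0 pom r' r'.
move: h1 h2; rewrite r0 rr' r'0 lexx => /(_ isT isT) h1 /(_ isT isT) h2.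
move: h1 h2; set A1 := avg _ _ _; set A2 := avg _ _ _.
set X1 := \sum_(n < M) _; set X2 := \sum_(n < M) _ => h1 h2.
have X12 : 0 <= complex.Re (X2 - X1).
  rewrite /X1 /X2 -sumrB.
  have -> : complex.Re (\sum_(n < M) (c n * Num.conj (c n) * (r' * r')%:C ^+ n -
      c n * Num.conj (c n) * (r * r)%:C ^+ n)) =
    \sum_(n < M) (cabs (c n) ^+ 2 * ((r' * r') ^+ n - (r * r) ^+ n)).
    elim/big_ind2: _ => [//|_ u _ v <- <-|n _]; first by rewrite cReD.
    by rewrite -mulrBr cabs_sqr -!rmorphXn -rmorphB -rmorphM.
  apply: sumr_ge0 => n _; rewrite mulr_ge0 ?sqr_ge0// subr_ge0.
  by rewrite lerXn2r ?nnegrE ?mulr_ge0// ler_pM.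
have -> : A2 - A1 = (X2 - X1) + ((A2 - X2) - (A1 - X1)) by ring.
rewrite cReD -[leLHS]add0r lerD// lerNl -cReN.
apply: (le_trans (le_trans (ler_norm _) (ler_Re _))); rewrite cabsN.
exact: cabsB_le2.
Qed.

End sphere_integrals.

(** * Moments and the reproducing property *)

Section reproducing.
Variables (R : realType) (N : nat).
Hypothesis N0 : (0 < N)%N.
Local Notation C := R[i].
Local Notation CN := 'cV[C]_N.
Local Notation kappa := (@kappa R N).

Lemma hasps_le (F : C -> C) c (rho K K' : R) : 0 < rho -> K <= K' ->
  hasps F c rho K -> hasps F c rho K'.
Proof.
move=> rho0 KK' h z m zrho; apply: (le_trans (h z m zrho)).
have q1 : cabs z / rho < 1 by rewrite ltr_pdivrMr// mul1r.
have q0 : 0 <= cabs z / rho by rewrite divr_ge0 ?cabs_ge0// ltW.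
rewrite -!mulrA; apply: ler_wpM2r => //.
by rewrite mulr_ge0 ?exprn_ge0// invr_ge0 subr_ge0 ltW.
Qed.

Lemma hasps_scale (F : C -> C) c (rho K : R) (p : C) : 0 < rho -> 0 <= K -> cabs p <= 1 ->
  hasps F c rho K -> hasps (fun l => F (l * p)) (fun n => c n * p ^+ n) rho K.
Proof.
move=> rho0 K0 p1 h z m zrho.
have pz : cabs (z * p) <= cabs z by rewrite cabsM ler_piMr ?cabs_ge0.
have -> : \sum_(n < m) c n * p ^+ n * z ^+ n = \sum_(n < m) c n * (z * p) ^+ n.
  by apply: eq_bigr => n _; rewrite -mulrA -exprMn [p * z]mulrC.
apply: (le_trans (h _ _ (le_lt_trans pz zrho))).
have q1 : cabs z / rho < 1 by rewrite ltr_pdivrMr// mul1r.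
have qq : cabs (z * p) / rho <= cabs z / rho by rewrite ler_wpM2r// invr_ge0 ltW.
have q0 : 0 <= cabs (z * p) / rho by rewrite divr_ge0 ?cabs_ge0// ltW.
rewrite -!mulrA ler_wpM2l// ler_pM ?exprn_ge0 ?invr_ge0 ?subr_ge0//.
- by rewrite ltW// (le_lt_trans qq).
- by rewrite lerXn2r ?nnegrE// (le_trans q0).
- by rewrite lef_pV2 ?posrE ?subr_gt0 ?lerD2l ?lerN2// (le_lt_trans qq).
Qed.

Lemma hasps_monomial (a : C) n (rho : R) : 0 < rho -> rho <= 1 ->
  hasps (fun l => a * l ^+ n) (fun j => a * (j == n)%:R) rho (cabs a).
Proof.
move=> rho0 rho1 z m zrho.
have q1 : cabs z / rho < 1 by rewrite ltr_pdivrMr// mul1r.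
have q0 : 0 <= cabs z / rho by rewrite divr_ge0 ?cabs_ge0// ltW.
have qm : 0 <= (cabs z / rho) ^+ m by rewrite exprn_ge0.
have [nm|mn] := ltnP n m.
  rewrite (bigD1 (Ordinal nm))//= eqxx mulr1 big1 => [|j jn]; last first.
    have /negbTE -> : (j != n :> nat) by move: jn; rewrite -val_eqE.
    by rewrite mulr0 mul0r.
  rewrite addr0 subrr cabs0 mulr_ge0 ?invr_ge0 ?subr_ge0 ?(ltW q1)//.
  by rewrite mulr_ge0 ?cabs_ge0.
rewrite big1 => [|j _]; last first.
  by rewrite ltn_eqF ?mulr0 ?mul0r// (leq_trans (ltn_ord j)).
rewrite subr0 cabsM cabsX -mulrA ler_wpM2l ?cabs_ge0//.
apply: (@le_trans _ _ ((cabs z / rho) ^+ m)).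
  apply: (@le_trans _ _ ((cabs z / rho) ^+ n)).
    rewrite lerXn2r ?nnegrE ?cabs_ge0// ler_pdivlMr//.
    by rewrite ler_piMr ?cabs_ge0.
  by rewrite ler_wiXn2l// ltW.
by rewrite ler_peMr// invf_ge1 ?subr_gt0// gerBl.
Qed.

Lemma hasps_coef0 (F : C -> C) c (rho K : R) : 0 < rho -> hasps F c rho K -> c 0%N = F 0.
Proof.
move=> rho0 /(_ 0 1%N); rewrite cabs0 => /(_ rho0).
rewrite mul0r expr1 mulr0 mul0r big_ord1 expr0 mulr1 => h.
by apply/esym/eqP; rewrite -subr_eq0 -cabs_eq0; apply/eqP/le_anti; rewrite h cabs_ge0.
Qed.

Lemma small_eq (X Y : C) (B x : R) : 0 <= x -> x < 1 -> (exists m, forall M, (m <= M)%N ->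
  (0 < M)%N -> cabs (X - Y) <= B * x ^+ M) -> X = Y.
Proof.
move=> x0 x1 [m h]; apply/eqP; rewrite -subr_eq0 -cabs_eq0; apply/eqP/le_anti.
rewrite cabs_ge0 andbT; apply/ler_addgt0Pr => e e0; rewrite add0r.
have [M M0 hM] := geometric_small B x0 x1 e0.
apply: (le_trans (h (maxn m M) (leq_maxl _ _) _)); first by rewrite leq_max M0 orbT.
exact/hM/leq_maxr.
Qed.

Section direction.
Variable w : CN.
Hypothesis w1 : enorm w = 1.

(** The identity on the line of w and multiplication by l on its orthogonal complement. *)
Definition circle_action (l : C) : 'M[C]_N :=
  l%:M + (1 - l) *: (w *m (map_mx Num.conj w)^T).

Lemma circle_actionE l z : circle_action l *m z = dotc z w *: w + l *: (z - dotc z w *: w).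
Proof.
have E : (map_mx Num.conj w)^T *m z = (dotc z w)%:M.
  apply/matrixP => i j; rewrite (ord1 i) (ord1 j) !mxE eqxx mulr1n.
  by apply: eq_bigr => k _; rewrite !mxE mulrC.
rewrite /circle_action mulmxDl mul_scalar_mx -scalemxAl -mulmxA E mul_mx_scalar.
by apply/matrixP => i j; rewrite !mxE; ring.
Qed.

Lemma dotc_ww : dotc w w = 1.
Proof. by rewrite dotcE w1 expr1n. Qed.

Lemma dotc_circle_action l z : dotc (circle_action l *m z) w = dotc z w.
Proof.
by rewrite circle_actionE dotcDl !dotcZl dotcBl dotcZl dotc_ww mulr1 subrr mulr0 addr0.
Qed.

Lemma enorm_pythagoras z (a l : C) :
  enorm (a *: w + l *: (z - dotc z w *: w)) ^+ 2 =
  cabs a ^+ 2 + cabs l ^+ 2 * enorm (z - dotc z w *: w) ^+ 2.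
Proof.
set p := dotc z w; set y := z - p *: w.
have yw : dotc y w = 0 by rewrite dotcBl dotcZl dotc_ww mulr1 subrr.
have wy : dotc w y = 0 by rewrite dotcC yw rmorph0.
apply: (@complexI R); rewrite -dotcE dotcDl !dotcDr !dotcZl !dotcZr dotc_ww yw wy dotcE.
have -> : (cabs a ^+ 2 + cabs l ^+ 2 * enorm y ^+ 2)%:C =
    (cabs a ^+ 2)%:C + (cabs l ^+ 2)%:C * (enorm y ^+ 2)%:C :> C.
  by rewrite -rmorphM -rmorphD.
by rewrite -!cabs_sqr; ring.
Qed.

Lemma enorm_pythagoras1 z : enorm z ^+ 2 =
  cabs (dotc z w) ^+ 2 + enorm (z - dotc z w *: w) ^+ 2.
Proof.
have := enorm_pythagoras z (dotc z w) 1.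
by rewrite scale1r addrC subrK => ->; rewrite cabs1 expr1n mul1r.
Qed.

Lemma enorm_circle_action l z : cabs l = 1 -> enorm (circle_action l *m z) = enorm z.
Proof.
move=> l1; apply/eqP; rewrite -(@eqrXn2 _ 2)// ?enorm_ge0//; apply/eqP.
by rewrite circle_actionE enorm_pythagoras l1 expr1n mul1r -enorm_pythagoras1.
Qed.

Lemma circle_action_inv l : cabs l = 1 -> exists W, circle_action l *m W = 1%:M.
Proof.
move=> l1; have l0 : l != 0 by rewrite -cabs_eq0 l1 oner_eq0.
exists (circle_action l^-1); apply/matrixP => i j.
suff h (z : CN) : circle_action l *m (circle_action l^-1 *m z) = z.
  have := h (delta_mx j 0); rewrite mulmxA => /(congr1 (fun v : CN => v i 0)).
  by rewrite -colE !mxE eqxx andbT => ->.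
rewrite circle_actionE dotc_circle_action circle_actionE.
rewrite [X in l *: X](_ : _ = l^-1 *: (z - dotc z w *: w)); last by rewrite addrC addKr.
by rewrite scalerA divff// scale1r addrC subrK.
Qed.

Lemma dotc_le1 z : enorm z = 1 -> cabs (dotc z w) <= 1.
Proof. by move=> z1; rewrite (le_trans (dotc_cauchy_schwarz _ _))// z1 w1 mulr1. Qed.

Definition moment n : C :=
  sphere_integral (fun z => dotc z w ^+ n * Num.conj (dotc z w ^+ n)).

Section function.
Variables (f : CN -> C) (r : R) (n : nat).
Hypotheses (hf : hol_ball f) (r0 : 0 <= r) (r1 : r < 1).

Let sbm1 : sbm (fun z => f (r%:C *: z) * Num.conj (dotc z w ^+ n)).
Proof. by apply: sbmM; [exact: sbm_holR|apply/sbmJ/sbmX/sbm_dotc]. Qed.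

Let sbm2 (a : C) : cabs a < 1 -> sbm (fun z => f ((a * dotc z w) *: w) * Num.conj (dotc z w ^+ n)).
Proof.
move=> a1; apply: sbmM; last exact/sbmJ/sbmX/sbm_dotc.
apply: (@sbm_hol_comp R N f (fun z => (a * dotc z w) *: w) (cabs a) (cabs a)) => //.
- exact: cabs_ge0.
- move=> z z1; rewrite enormZ w1 mulr1 cabsM ler_piMr ?cabs_ge0//.
  exact: dotc_le1.
- move=> u z; rewrite -scalerBl enormZ w1 mulr1 -mulrBr cabsM -dotcBl.
  rewrite ler_wpM2l ?cabs_ge0// (le_trans (dotc_cauchy_schwarz _ _))//.
  by rewrite w1 mulr1.
Qed.

(* Averaging over the rotations fixing [w]: by the mean value property only the
   restriction of [f] to the complex line of [w] matters. *)
Lemma sint_disc :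
  sphere_integral (fun z => f (r%:C *: z) * Num.conj (dotc z w ^+ n)) =
  sphere_integral (fun z => f ((r%:C * dotc z w) *: w) * Num.conj (dotc z w ^+ n)).
Proof.
pose x := (1 + r) / 2.
have x0 : 0 < x by rewrite divr_gt0// ltr_pwDl.
have x1 : x < 1 by rewrite ltr_pdivrMr// mul1r -[2]/(1 + 1) ltrD2l.
pose r1' := x * x; have r1'0 : 0 < r1' by rewrite mulr_gt0.
have rr1 : r < r1'.
  have h : 0 < (1 - r) * (1 - r) by rewrite mulr_gt0 ?subr_gt0.
  by rewrite /r1' /x; nra.
have q1 : r / r1' < 1 by rewrite ltr_pdivrMr// mul1r.
have q0 : 0 <= r / r1' by rewrite divr_ge0// ltW.
have [K K0 fK] := hol_ball_bound hf q1.
pose K' := 2 * K + 1; have K'0 : 0 <= K' by rewrite addr_ge0// mulr_ge0.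
have sb1 := sbm1; have sb2 := sbm2 (a := r%:C) ltac:(by rewrite cabsR ger0_norm).
apply: (@small_eq _ _ (2 * (3 * (K' / (1 - x)) ^+ 2) * kappa) x (ltW x0) x1).
exists 0%N => M _ M0; have [om pom] := prim_root_exists R M0.
have [|sb1' ->] := sint_avg M0 pom circle_action_inv enorm_circle_action sb1.
  move=> l l1; under eq_fun do rewrite dotc_circle_action.
  apply: sbmM; last exact/sbmJ/sbmX/sbm_dotc.
  apply: (@sbm_hol_comp R N f (fun z => r%:C *: (circle_action l *m z)) r r) => //.
    by move=> z z1; rewrite enormZ enorm_circle_action// z1 mulr1 cabsR ger0_norm.
  move=> u z; rewrite -scalerBr -mulmxBr enormZ enorm_circle_action//.
  by rewrite cabsR ger0_norm.
rewrite -sintB//.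
have -> : 2 * (3 * (K' / (1 - x)) ^+ 2) * kappa * x ^+ M =
  2 * (3 * (K' / (1 - x)) ^+ 2 * x ^+ M) * kappa by ring.
apply: sint_le => [|z z1]; first exact: sbmB.
set p := dotc z w; set y := z - p *: w.
have avgE : avg M om (fun l => f (r%:C *: (circle_action l *m z)) *
      Num.conj (dotc (circle_action l *m z) w ^+ n)) =
    avg M om (fun l => f (r%:C *: (circle_action l *m z)) * Num.conj 1) * Num.conj (p ^+ n).
  rewrite /avg -mulrA mulr_suml; congr (_ * _); apply: eq_bigr => k _.
  by rewrite dotc_circle_action rmorph1 mulr1.
rewrite avgE -mulrBl cabsM cabsJ cabsX.
have pn1 : cabs p ^+ n <= 1 by rewrite exprn_ile1 ?cabs_ge0// dotc_le1.
apply: (le_trans (ler_wpM2l (cabs_ge0 _) pn1)); rewrite mulr1.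
(* For |l| <= 1 the argument stays in the ball of radius r / r1' < 1, and at l = r1' om ^ k it is
   the rotated point dilated by r. *)
pose F (l : C) := f ((r%:C * p) *: w + l *: ((r / r1')%:C *: y)).
have nF (l : C) : cabs l <= 1 ->
    enorm ((r%:C * p) *: w + l *: ((r / r1')%:C *: y)) <= r / r1'.
  move=> l1.
  have -> : (r%:C * p) *: w + l *: ((r / r1')%:C *: y) =
      (r / r1')%:C *: ((r1'%:C * p) *: w + l *: y).
    have rE : r%:C = (r / r1')%:C * r1'%:C :> C by rewrite -rmorphM divfK ?gt_eqF.
    by rewrite {1}rE; apply/matrixP => i j; rewrite !mxE; ring.
  rewrite enormZ cabsR ger0_norm// ler_piMr//.
  rewrite -(@ler_pXn2r _ 2)// ?nnegrE ?enorm_ge0// expr1n enorm_pythagoras.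
  have -> : (1 : R) = cabs p ^+ 2 + enorm y ^+ 2.
    by rewrite -enorm_pythagoras1 z1 expr1n.
  have r1'1 : cabs (r1'%:C : C) <= 1.
    by rewrite cabsR gtr0_norm// mulr_ile1// ltW.
  apply: lerD; last by rewrite ler_piMl ?sqr_ge0// exprn_ile1 ?cabs_ge0.
  by rewrite cabsM exprMn ler_piMl ?sqr_ge0// exprn_ile1 ?cabs_ge0.
have hF : holo F.
  move=> l l1; apply: hol_at_slice; apply: hf.
  exact: le_lt_trans (nF _ (ltW l1)) q1.
have bF l : cabs l <= x -> cabs (F l) <= K.
  by move=> lx; apply/fK/nF; rewrite (le_trans lx)// ltW.
have [c hc] := power_series hF x0 x1 bF.
have hc' : hasps F c x K' by apply: hasps_le hc => //; rewrite lerDl.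
(* Pairing F with the constant 1, at radius 0, leaves only its coefficient of order 0, the value of
   f on the line of w. *)
have hG : hasps (fun l : C => 1 * l ^+ 0) (fun j => 1 * (j == 0%N)%:R) x K'.
  by apply: hasps_le (hasps_monomial 1 0 x0 (ltW x1)) => //; rewrite cabs1 lerDr mulr_ge0.
have e1 : 0 <= r1' <= x * x by rewrite (ltW r1'0) lexx.
have e2 : 0 <= (0 : R) <= x * x by rewrite lexx (ltW r1'0).
have := avg_ps M0 pom hc' hG K'0 x0 (ltW x0) x1 e1 e2.
have -> : \sum_(j < M) c j * Num.conj (1 * (j == 0%N :> nat)%:R) * (r1' * 0)%:C ^+ j =
    f ((r%:C * p) *: w).
  rewrite (bigD1 (Ordinal M0))//= big1 => [|j j0].
    by rewrite ?mulr1 rmorph1 ?mulr1 addr0 (hasps_coef0 x0 hc) /F scale0r addr0.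
  have /negbTE -> : (j != 0%N :> nat) by move: j0; rewrite -val_eqE.
  by rewrite mulr0 rmorph0 mulr0 mul0r.
have -> : avg M om (fun z0 => F (r1'%:C * z0) * Num.conj (1 * (0%:C * z0) ^+ 0)) =
  avg M om (fun l => f (r%:C *: (circle_action l *m z)) * Num.conj 1).
  congr (_ * _); apply: eq_bigr => k _; rewrite expr0 mulr1 /F circle_actionE -/p -/y.
  have rE : r%:C = r1'%:C * (r / r1')%:C :> C.
    by rewrite -rmorphM mulrC divfK ?gt_eqF.
  by congr (f _ * _); rewrite rE; apply/matrixP => i j; rewrite !mxE; ring.
exact.
Qed.

End function.
End direction.
End reproducing.

Section moments.
Variables (R : realType) (N : nat).
Hypothesis N0 : (0 < N)%N.
Local Notation C := R[i].
Local Notation CN := 'cV[C]_N.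
Local Notation kappa := (@kappa R N).

Lemma conj_real (x : R) : Num.conj (x%:C) = x%:C :> C.
Proof. by apply: complex_eqP; rewrite ?(cReJ, cImJ)//= oppr0. Qed.

Lemma conj_mul (a b : C) : Num.conj (a * b) = Num.conj a * Num.conj b.
Proof. exact: rmorphM. Qed.

Lemma conj_exp (a : C) n : Num.conj (a ^+ n) = Num.conj a ^+ n.
Proof. exact: rmorphXn. Qed.

(* This extracts the coefficient of [b] in the powers of [a + b]. *)
Lemma prim_root_binomial n (om a b : C) : n.+2.-primitive_root om ->
  \sum_(k < n.+2) Num.conj (om ^+ k) * (a + om ^+ k * b) ^+ n.+1 =
  n.+2%:R * (n.+1%:R * (a ^+ n * b)).
Proof.
move=> pom.
transitivity (\sum_(i < n.+2) (a ^+ (n.+1 - i) * b ^+ i) *+ 'C(n.+1, i) *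
    \sum_(k < n.+2) (om ^+ k) ^+ i * Num.conj ((om ^+ k) ^+ 1)).
  under [RHS]eq_bigr do rewrite mulr_sumr.
  rewrite [RHS]exchange_big /=; apply: eq_bigr => k _.
  rewrite exprDn mulr_sumr; apply: eq_bigr => i _.
  rewrite expr1 exprMn mulrnAr mulrnAl; congr (_ *+ _).
  move: (a ^+ _) (b ^+ i) (Num.conj _) ((om ^+ k) ^+ i) => q s t u.
  ring.
under eq_bigr => i _ do rewrite (prim_root_orthogonal (isT : 0 < n.+2)%N pom (ltn_ord i) (isT : 1 < n.+2)%N).
have lt1 : (1 < n.+2)%N by [].
rewrite (bigD1 (Ordinal lt1))//= big1 => [|i i1].
  by rewrite bin1 subn1 expr1 mul1r addr0 /= -mulr_natr mulrC [_ * n.+1%:R]mulrC.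
by move: i1; rewrite -val_eqE /= => /negbTE ->; rewrite mul0r mulr0.
Qed.

Section direction.
Variables (w : CN) (f : CN -> C) (r rho K : R) (n : nat) (c : nat -> C).
Hypotheses (w1 : enorm w = 1) (hf : hol_ball f) (r0 : 0 <= r) (rrho : r < rho) (rho1 : rho < 1).
Hypotheses (K0 : 0 <= K) (hc : hasps (fun l => f (l *: w)) c rho K).

Let sbm2 (a : C) : cabs a < 1 -> sbm (fun z => f ((a * dotc z w) *: w) * Num.conj (dotc z w ^+ n)).
Proof.
move=> a1; apply: sbmM; last exact/sbmJ/sbmX/sbm_dotc.
apply: (@sbm_hol_comp R N f (fun z => (a * dotc z w) *: w) (cabs a) (cabs a)) => //.
- exact: cabs_ge0.
- move=> z z1; rewrite enormZ w1 mulr1 cabsM ler_piMr ?cabs_ge0//.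
  exact: dotc_le1.
- move=> u z; rewrite -scalerBl enormZ w1 mulr1 -mulrBr cabsM -dotcBl.
  rewrite ler_wpM2l ?cabs_ge0// (le_trans (dotc_cauchy_schwarz _ _))//.
  by rewrite w1 mulr1.
Qed.

(** By [sint_disc] only the slice of f along w matters, and averaging over scalar rotations leaves
    its term of degree n. *)
Lemma sint_monomial :
  sphere_integral (fun z => f (r%:C *: z) * Num.conj (dotc z w ^+ n)) =
  c n * r%:C ^+ n * moment w n.
Proof.
have rho0 : 0 < rho by exact: le_lt_trans rrho.
have r1 : r < 1 by exact: lt_trans rrho rho1.
rewrite sint_disc//.
pose x := (1 + r / rho) / 2.
have q0 : 0 <= r / rho by rewrite divr_ge0// ltW.
have q1 : r / rho < 1 by rewrite ltr_pdivrMr// mul1r.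
have x0 : 0 < x by rewrite divr_gt0// ltr_pwDl.
have x1 : x < 1 by rewrite ltr_pdivrMr// mul1r -[2]/(1 + 1) ltrD2l.
have rx : r <= x * rho.
  rewrite -ler_pdivrMr// /x ler_pdivlMr// mulr2n mulrDr mulr1.
  by rewrite lerD2r ltW.
pose s := x * rho; have s0 : 0 < s by rewrite mulr_gt0.
have sC0 : s%:C != 0 :> C by rewrite -cabs_eq0 cabsR normr_eq0 gt_eqF.
pose K' := K + s^-1 ^+ n; have K'0 : 0 <= K' by rewrite addr_ge0// exprn_ge0// invr_ge0 ltW.
have KK' : K <= K' by rewrite lerDl exprn_ge0// invr_ge0 ltW.
have sb := sbm2 (a := r%:C) ltac:(by rewrite cabsR ger0_norm).
pose mom z := dotc z w ^+ n * Num.conj (dotc z w ^+ n).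
have sbmom : sbm mom by apply: sbmM; [|apply: sbmJ]; exact/sbmX/sbm_dotc.
have -> : c n * r%:C ^+ n * moment w n = sphere_integral (fun z => c n * r%:C ^+ n * mom z).
  by rewrite sintZ.
apply: (@small_eq _ _ _ (2 * (3 * (K' / (1 - x)) ^+ 2) * kappa) x (ltW x0) x1).
(* [avg_ps] stops before degree M, so the term of degree n is seen only when M > n. *)
exists n.+1 => M nM M0; have [om pom] := prim_root_exists R M0.
have [|sb' ->] := sint_rotation M0 pom sb.
  move=> l l1; have rl1 : cabs (r%:C * l) < 1 by rewrite cabsM cabsR l1 mulr1 ger0_norm.
  apply: (eq_sbm _ (sbmZ (Num.conj (l ^+ n)) (sbm2 rl1))) => z _.
  by rewrite dotcZl exprMn [in RHS]rmorphM /= mulrCA -!mulrA.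
rewrite -sintB//; last exact: sbmZ.
have -> : 2 * (3 * (K' / (1 - x)) ^+ 2) * kappa * x ^+ M =
  2 * (3 * (K' / (1 - x)) ^+ 2 * x ^+ M) * kappa by ring.
apply: sint_le => // [|z z1]; first by apply: sbmB => //; exact: sbmZ.
pose p := dotc z w; have p1 : cabs p <= 1 by exact: dotc_le1.
(* Scaled so that a l ^ n at the radius s equals (p l) ^ n; s = x rho is the largest radius that
   [avg_ps] allows. *)
pose a := (p / s%:C) ^+ n.
have hF : hasps (fun l => f ((l * p) *: w)) (fun j => c j * p ^+ j) rho K'.
  by apply: hasps_le KK' _ => //; apply: (hasps_scale (F := fun l => f (l *: w))).
have hG : hasps (fun l => a * l ^+ n) (fun j => a * (j == n)%:R) rho K'.
  apply: hasps_le (hasps_monomial a n rho0 (ltW rho1)) => //.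
  apply: (@le_trans _ _ (s^-1 ^+ n)); last by rewrite lerDr.
  rewrite /a cabsX cabsM cabsV cabsR gtr0_norm//.
  rewrite lerXn2r ?nnegrE ?mulr_ge0 ?cabs_ge0 ?invr_ge0 ?(ltW s0)//.
  by rewrite ler_piMl// invr_ge0 ltW.
have aJ : Num.conj a = Num.conj (p ^+ n) / s%:C ^+ n.
  rewrite /a expr_div_n rmorphM /= fmorphV; congr (_ / _).
  by rewrite rmorphXn /= conj_real.
have e1 : 0 <= r <= x * rho by rewrite r0.
have e2 : 0 <= s <= x * rho by rewrite lexx (ltW s0).
have := avg_ps M0 pom hF hG K'0 rho0 (ltW x0) x1 e1 e2.
have -> : \sum_(j < M) c j * p ^+ j * Num.conj (a * (j == n :> nat)%:R) * (r * s)%:C ^+ j =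
    c n * r%:C ^+ n * mom z.
  rewrite (bigD1 (Ordinal nM))//= eqxx mulr1 big1 => [|j jn].
    rewrite addr0 aJ /mom -/p.
    have -> : (r * s)%:C ^+ n = r%:C ^+ n * s%:C ^+ n :> C by rewrite rmorphM exprMn.
    move: (Num.conj (p ^+ n)) => q; have := expf_neq0 n sC0.
    by move: (s%:C ^+ n) => t t0; field.
  have /negbTE -> : (j != n :> nat) by move: jn; rewrite -val_eqE.
  by rewrite mulr0 rmorph0 mulr0 mul0r.
rewrite (_ : avg M om (fun z0 => f ((r%:C * z0 * p) *: w) * Num.conj (a * (s%:C * z0) ^+ n)) =
  avg M om (fun l => f ((r%:C * dotc (l *: z) w) *: w) * Num.conj (dotc (l *: z) w ^+ n)))//.
congr (_ * _); apply: eq_bigr => k _; rewrite dotcZl -/p mulrA; congr (_ * Num.conj _).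
by rewrite /a -exprMn; congr (_ ^+ _); field.
Qed.

End direction.

Lemma hol_dotcX (v : CN) n : hol_ball (fun z => dotc z v ^+ n).
Proof. by move=> z _; apply: hol_atX; exact: hol_at_dotc. Qed.

Lemma sbm_monomials (F : CN -> C) (w : CN) n : sbm F -> sbm (fun z => F z * Num.conj (dotc z w ^+ n)).
Proof. by move=> bF; apply: sbmM => //; exact/sbmJ/sbmX/sbm_dotc. Qed.

(** [sint_monomial] at the radius 1/3, a choice that homogeneity makes immaterial: the power of the
    radius cancels, which gives a formula on the sphere itself. *)
Lemma sint_homogeneous (F : CN -> C) (w : CN) n : hol_ball F -> sbm F ->
  (forall l z, F (l *: z) = l ^+ n * F z) -> enorm w = 1 ->
  sphere_integral (fun z => F z * Num.conj (dotc z w ^+ n)) = F w * moment w n.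
Proof.
move=> hF bF Fh w1; pose r : R := 3^-1; pose rho : R := 2^-1.
have r0 : 0 < r by rewrite invr_gt0.
have rrho : r < rho by rewrite ltf_pV2 ?posrE// ltr_nat.
have rho0 : 0 < rho by rewrite invr_gt0.
have rho1 : rho < 1 by rewrite invf_lt1// ltr1n.
have rC0 : r%:C != 0 :> C by rewrite -cabs_eq0 cabsR normr_eq0 gt_eqF.
have hc : hasps (fun l => F (l *: w)) (fun j => F w * (j == n)%:R) rho (cabs (F w)).
  move=> z m zrho; rewrite Fh mulrC.
  exact: (hasps_monomial (F w) n rho0 (ltW rho1)).
have := sint_monomial n w1 hF (ltW r0) rrho rho1 (cabs_ge0 _) hc.
rewrite eqxx mulr1.
have -> : sphere_integral (fun z => F (r%:C *: z) * Num.conj (dotc z w ^+ n)) =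
    r%:C ^+ n * sphere_integral (fun z => F z * Num.conj (dotc z w ^+ n)).
  rewrite -sintZ; last exact: sbm_monomials.
  by apply: eq_sint => z _; rewrite Fh mulrA.
move=> h; apply: (mulfI (expf_neq0 n rC0)); rewrite h.
by ring.
Qed.

(** The integral of <z,v> ^ n conj(<z,w> ^ n) is computed by [sint_homogeneous] directly, and by
    conjugation with v and w exchanged. *)
Lemma moment_indep (v w : CN) n : enorm v = 1 -> enorm w = 1 -> dotc w v != 0 ->
  moment v n = moment w n.
Proof.
move=> v1 w1 wv.
have bv u : sbm (fun z : CN => dotc z u ^+ n) by exact/sbmX/sbm_dotc.
have hom (u : CN) (l : C) z : dotc (l *: z) u ^+ n = l ^+ n * dotc z u ^+ n.
  by rewrite dotcZl exprMn.
have h1 := sint_homogeneous (@hol_dotcX v n) (bv v) (hom v) w1.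
have h2 := sint_homogeneous (@hol_dotcX w n) (bv w) (hom w) v1.
have h3 : Num.conj (moment v n) = moment v n.
  rewrite /moment -sintJ; last exact/sbm_monomials.
  by apply: eq_sint => z _; rewrite conj_mul conjCK mulrC.
have : sphere_integral (fun z => dotc z v ^+ n * Num.conj (dotc z w ^+ n)) =
    dotc w v ^+ n * moment v n.
  transitivity (Num.conj (sphere_integral (fun z => dotc z w ^+ n * Num.conj (dotc z v ^+ n)))).
    rewrite -sintJ; last exact/sbm_monomials.
    by apply: eq_sint => z _; rewrite conj_mul conjCK mulrC.
  rewrite h2 conj_mul [X in _ * X]h3 conj_exp -dotcC.
  exact: erefl.
by rewrite h1 => /(mulfI (expf_neq0 n wv)) ->.
Qed.

Let e (j : 'I_N) : CN := delta_mx j 0.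

Lemma dotc_delta (z : CN) j : dotc z (delta_mx j 0) = z j 0.
Proof.
rewrite /dotc (bigD1 j)//= mxE !eqxx rmorph1 mulr1 big1 ?addr0// => k kj.
by rewrite mxE (negbTE kj) rmorph0 mulr0.
Qed.

Lemma enorm_delta j : enorm (delta_mx j 0 : CN) = 1.
Proof.
apply/eqP; rewrite -(@eqrXn2 _ 2)// ?enorm_ge0//; apply/eqP; apply: (@complexI R).
by rewrite -dotcE dotc_delta mxE !eqxx expr1n.
Qed.

Let j0 : 'I_N := Ordinal N0.
Let m n := moment (e j0) n.

(** For orthogonal directions the comparison passes through the normalized sum u, which is
    orthogonal to neither. *)
Lemma momentE (w : CN) n : enorm w = 1 -> moment w n = m n.
Proof.
move=> w1; have e1 : enorm (e j0) = 1 by exact: enorm_delta.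
have [wv|wv] := eqVneq (dotc w (e j0)) 0; last exact: (esym (moment_indep n e1 w1 wv)).
have vw : dotc (e j0) w = 0 by rewrite dotcC wv rmorph0.
have s2 : (Num.sqrt 2)^-1%:C != 0 :> C.
  by rewrite -cabs_eq0 cabsR normr_eq0 invr_eq0 sqrtr_eq0 -ltNge.
pose u := (Num.sqrt 2)^-1%:C *: (w + e j0).
have uw : dotc u w = (Num.sqrt 2)^-1%:C.
  by rewrite dotcZl dotcDl vw addr0 dotcE w1 expr1n mulr1.
have uv : dotc u (e j0) = (Num.sqrt 2)^-1%:C.
  by rewrite dotcZl dotcDl wv add0r dotcE e1 expr1n mulr1.
have u1 : enorm u = 1.
  apply/eqP; rewrite -(@eqrXn2 _ 2)// ?enorm_ge0//; apply/eqP; apply: (@complexI R).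
  rewrite -dotcE {2}/u dotcZr dotcDr uw uv conj_real.
  rewrite -rmorphD -rmorphM expr1n; congr (_%:C).
  have t2 : (Num.sqrt 2)^-1 * (Num.sqrt 2)^-1 = 2^-1 :> R.
    by rewrite -invfM -expr2 sqr_sqrtr.
  by rewrite mulrDr t2; field.
have uw0 : dotc u w != 0 by rewrite uw.
have uv0 : dotc u (e j0) != 0 by rewrite uv.
exact: (etrans (moment_indep n w1 u1 uw0) (esym (moment_indep n e1 u1 uv0))).
Qed.

Lemma moment0 : m 0 = kappa%:C.
Proof.
rewrite /m /moment; under eq_sint do rewrite expr0 rmorph1 mulr1.
by rewrite sint_cst mul1r.
Qed.

(* [m n] is the sum of the [B j] because |z|^2 = 1 on the sphere, and [B j] is
   computed by testing on the unit vectors (e_0 + om^k e_j) / sqrt 2. *)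
Lemma moment_step n : m n * n.+1%:R = m n.+1 * (n + N)%:R.
Proof.
pose B j := sphere_integral (fun z : CN => (z j0 0 ^+ n * z j 0) * Num.conj (z j0 0 ^+ n * z j 0)).
have coordE (z : CN) j : z j 0 = dotc z (e j) by rewrite dotc_delta.
have bz j : sbm (fun z : CN => z j 0).
  by apply: (eq_sbm _ (sbm_dotc (e j))) => z _; rewrite dotc_delta.
have bzz j : sbm (fun z : CN => z j0 0 ^+ n * z j 0) by apply: sbmM => //; exact: sbmX.
have bB j : sbm (fun z : CN => (z j0 0 ^+ n * z j 0) * Num.conj (z j0 0 ^+ n * z j 0)).
  by apply: sbmM => //; exact: sbmJ.
have mB : m n = \sum_j B j.
  rewrite /B -(@sint_sum R N _ _ (fun j z => (z j0 0 ^+ n * z j 0) * Num.conj (z j0 0 ^+ n * z j 0)))//.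
  apply: eq_sint => z z1.
  transitivity (dotc z (e j0) ^+ n * Num.conj (dotc z (e j0) ^+ n) * dotc z z).
    by rewrite dotcE z1 expr1n mulr1.
  rewrite /dotc big_distrr /=; apply: eq_bigr => j _.
  by rewrite -/(dotc z (e j0)) -coordE rmorphM; ring.
have B0 : B j0 = m n.+1.
  by apply: eq_sint => z _; rewrite -exprSr coordE.
have Bj j : j != j0 -> n.+1%:R * B j = m n.+1.
  move=> jj0; pose F (z : CN) := z j0 0 ^+ n * z j 0.
  have hF : hol_ball F.
    by move=> z _; apply: hol_atM; [apply: hol_atX|]; exact: hol_at_coord.
  have Fh l z : F (l *: z) = l ^+ n.+1 * F z by rewrite /F !mxE exprMn exprSr; ring.
  (* The order n + 2 exceeds the degree n + 1 of the binomial, so the average isolates a single term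
     of its expansion. *)
  have M0 : (0 < n.+2)%N by [].
  have [om pom] := prim_root_exists R M0.
  pose t : C := (Num.sqrt 2)^-1%:C.
  have t0 : t != 0.
    by rewrite -cabs_eq0 cabsR normr_eq0 invr_eq0 sqrtr_eq0 -ltNge.
  have jE k : dotc (delta_mx j0 0 : CN) (delta_mx k 0) = (j0 == k)%:R.
    by rewrite dotc_delta mxE eqxx andbT eq_sym.
  have Xk k : sphere_integral (fun z => F z * (Num.conj (z j0 0) + om ^+ k * Num.conj (z j 0)) ^+ n.+1)
      = om ^+ k * m n.+1.
    pose w : CN := e j0 + om ^+ k *: e j.
    have om1 : cabs (om ^+ k) = 1 by exact: (cabs_prim_root M0 pom).
    have w2 : dotc w w = (2 : R)%:C.
      rewrite (rmorph_nat (real_complex R)) dotcDl !dotcDr !dotcZl !dotcZr !dotc_delta !mxE !eqxx /= (negbTE jj0).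
      rewrite eq_sym (negbTE jj0) /= !mulr0 addr0 add0r mulr1 cabs_sqr om1 expr1n.
      by rewrite rmorph1.
    have tw : enorm (t *: w) = 1.
      apply/eqP; rewrite -(@eqrXn2 _ 2)// ?enorm_ge0//; apply/eqP; apply: (@complexI R).
      rewrite -dotcE dotcZl dotcZr w2 conj_real mulrA -rmorphM expr1n.
      by rewrite -invfM -expr2 sqr_sqrtr// -rmorphM mulVf.
    have Fw : F (t *: w) = t ^+ n.+1 * om ^+ k.
      rewrite Fh /F !mxE !eqxx /= (negbTE jj0) eq_sym (negbTE jj0) /=.
      by rewrite mulr0 addr0 add0r expr1n mul1r mulr1.
    have := sint_homogeneous hF (bzz j) Fh tw; rewrite Fw [moment _ _]momentE//.
    have -> : sphere_integral (fun z => F z * Num.conj (dotc z (t *: w) ^+ n.+1)) =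
      t ^+ n.+1 * sphere_integral (fun z => F z *
        (Num.conj (z j0 0) + om ^+ k * Num.conj (z j 0)) ^+ n.+1).
      rewrite -sintZ; last first.
        apply: sbmM; first exact: bzz.
        by apply: sbmX; apply: sbmD; [|apply: sbmZ]; exact: sbmJ.
      apply: eq_sint => z _; rewrite mulrCA; congr (_ * _).
      rewrite dotcZr conj_real dotcDr dotcZr !dotc_delta conj_exp conj_mul conj_real exprMn.
      congr (_ * _ ^+ _); rewrite -[LHS]/(Num.conj (_ + _)).
      rewrite (_ : Num.conj (z j0 0 + Num.conj (om ^+ k) * z j 0) =
        Num.conj (z j0 0) + Num.conj (Num.conj (om ^+ k) * z j 0)); last exact: rmorphD.
      by rewrite conj_mul conjCK.
    by rewrite -mulrA => /(mulfI (expf_neq0 n.+1 t0)).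
  have bFk k : sbm (fun z => F z * (Num.conj (z j0 0) + om ^+ k * Num.conj (z j 0)) ^+ n.+1).
    apply: sbmM; first exact: bzz.
    by apply: sbmX; apply: sbmD; [|apply: sbmZ]; exact: sbmJ.
  have key : \sum_(k < n.+2) Num.conj (om ^+ k) * sphere_integral (fun z => F z *
      (Num.conj (z j0 0) + om ^+ k * Num.conj (z j 0)) ^+ n.+1) =
      n.+2%:R * (n.+1%:R * B j).
    transitivity (sphere_integral (fun z => \sum_(k < n.+2) Num.conj (om ^+ k) * (F z *
      (Num.conj (z j0 0) + om ^+ k * Num.conj (z j 0)) ^+ n.+1))).
      rewrite (@sint_sum R N _ _ (fun (k : 'I_n.+2) z => Num.conj (om ^+ k) * (F z *
        (Num.conj (z j0 0) + om ^+ k * Num.conj (z j 0)) ^+ n.+1))) => [|k]; last exact: sbmZ.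
      by apply: eq_bigr => k _; rewrite sintZ.
    rewrite mulrA /B -sintZ//; apply: eq_sint => z _.
    transitivity (F z * \sum_(k < n.+2) Num.conj (om ^+ k) *
        (Num.conj (z j0 0) + om ^+ k * Num.conj (z j 0)) ^+ n.+1).
      by rewrite mulr_sumr; apply: eq_bigr => k _; rewrite mulrCA.
    rewrite -/(F z).
    transitivity (F z * (n.+2%:R * (n.+1%:R * (Num.conj (z j0 0) ^+ n * Num.conj (z j 0))))); last first.
      have -> : Num.conj (F z) = Num.conj (z j0 0) ^+ n * Num.conj (z j 0).
        by rewrite /F conj_mul conj_exp.
      move: (F z) (Num.conj (z j 0)) (Num.conj (z j0 0) ^+ n) (n.+2%:R : C) (n.+1%:R : C) => p q s u v; ring.
    by congr (_ * _); exact: prim_root_binomial.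
  move: key; under eq_bigr => k _.
    rewrite Xk mulrA [Num.conj _ * _]mulrC cabs_sqr (cabs_prim_root M0 pom) expr1n mul1r.
    over.
  rewrite sumr_const card_ord -[_ *+ n.+2]mulr_natl.
  have n2 : n.+2%:R != 0 :> C by rewrite pnatr_eq0.
  by move=> /(mulfI n2) ->.
have {}Bj : (\sum_(j | j != j0) B j) * n.+1%:R = m n.+1 *+ N.-1.
  rewrite mulr_suml (eq_bigr (fun=> m n.+1)) => [|j jj0]; last by rewrite mulrC Bj.
  by rewrite sumr_const cardC1 card_ord.
rewrite mB (bigD1 j0)//= B0 mulrDl Bj -[X in _ + X]mulr_natr -mulrDr -natrD.
by rewrite addSnnS prednK.
Qed.

(** The binomial is the coefficient of t ^ n in (1 - t) ^ -N; its product with the moment is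
    constant, which is why the kernel reproduces. *)
Lemma moment_formula n : m n * 'C(n + N.-1, n)%:R = kappa%:C.
Proof.
elim: n => [|n IH]; first by rewrite bin0 mulr1 moment0.
have n1 : n.+1%:R != 0 :> C by rewrite pnatr_eq0.
apply: (mulIf n1); rewrite -mulrA -natrM mulnC -mul_bin_diag.
have nN : (n.+1 + N.-1 = n + N)%N by rewrite addSnnS prednK.
have nN1 : ((n + N).-1 = n + N.-1)%N by rewrite -nN.
rewrite nN nN1 natrM mulrA -moment_step -IH.
by rewrite -mulrA [n.+1%:R * _]mulrC mulrA.
Qed.

End moments.

(** * The binomial series of negative integer powers of 1 - x *)

Section binomial_series.

Definition binomial_sum (K : pzRingType) k m (x : K) := \sum_(n < m) 'C(n + k, n)%:R * x ^+ n.

Lemma binomial_sum0 (K : comPzRingType) m (x : K) : (1 - x) * binomial_sum 0 m x = 1 - x ^+ m.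
Proof.
elim: m => [|m IH]; first by rewrite /binomial_sum big_ord0 mulr0 expr0 subrr.
rewrite /binomial_sum big_ord_recr /= mulrDr -/(binomial_sum 0 m x) IH addn0 binn exprS.
by ring.
Qed.

(** Pascal's rule: multiplication by 1 - x lowers k by one, up to a boundary term that
    [binomial_coef_small] makes negligible. *)
Lemma binomial_sumS (K : comPzRingType) k m (x : K) :
  (1 - x) * binomial_sum k.+1 m.+1 x =
  binomial_sum k m.+1 x - 'C(m + k.+1, m)%:R * x ^+ m.+1.
Proof.
elim: m => [|m IH].
  by rewrite /binomial_sum !big_ord_recr !big_ord0 /= !bin0 !expr0 expr1; ring.
rewrite /binomial_sum big_ord_recr [in RHS]big_ord_recr /= mulrDr.
rewrite -!/(binomial_sum _ _ x) IH !addSn addnS binS natrD !exprS; ring.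
Qed.

Variable R : realType.
Local Notation C := R[i].

Lemma binomial_sum_ge0 k m (t : R) : 0 <= t -> 0 <= binomial_sum k m t.
Proof. by move=> t0; apply: sumr_ge0 => n _; rewrite mulr_ge0// exprn_ge0. Qed.

Lemma binomial_sum_le k m (t : R) : 0 <= t -> t < 1 -> binomial_sum k m t <= (1 - t) ^- k.+1.
Proof.
move=> t0 t1; have t10 : 0 < 1 - t by rewrite subr_gt0.
elim: k m => [|k IH] m.
  by rewrite expr1 -[leRHS]mul1r ler_pdivlMr// mulrC binomial_sum0 gerBl exprn_ge0.
case: m => [|m]; first by rewrite /binomial_sum big_ord0 invr_ge0 exprn_ge0// ltW.
rewrite exprS invfM mulrC ler_pdivlMr// mulrC binomial_sumS.
by rewrite (le_trans _ (IH m.+1))// gerBl mulr_ge0// exprn_ge0// ltW.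
Qed.

Lemma cabs_binomial_sum k m (z : C) (t : R) : cabs z <= t -> t < 1 ->
  cabs (binomial_sum k m z) <= (1 - t) ^- k.+1.
Proof.
move=> zt t1; have t0 := le_trans (cabs_ge0 z) zt.
rewrite (le_trans _ (binomial_sum_le k m t0 t1))//.
rewrite (le_trans (cabs_sum _ _ _))//; apply: ler_sum => n _.
by rewrite cabsM cabs_nat cabsX ler_wpM2l// lerXn2r// nnegrE ?cabs_ge0.
Qed.

(** For t between x and 1 the coefficient times t ^ m is one term of a bounded sum, and x ^ m gains
    the factor (x / t) ^ m. *)
Lemma binomial_coef_small k (x : R) (e : R) : 0 <= x -> x < 1 -> 0 < e ->
  exists M, forall m, (M <= m)%N -> 'C(m + k, m)%:R * x ^+ m <= e.
Proof.
move=> x0 x1 e0; pose t := (1 + x) / 2.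
have t0 : 0 < t by rewrite /t; lra.
have t1 : t < 1 by rewrite /t; lra.
have xt0 : 0 <= x / t by rewrite divr_ge0// ltW.
have xt1 : x / t < 1 by rewrite ltr_pdivrMr// mul1r /t; lra.
have [M _ hM] := geometric_small ((1 - t) ^- k.+1) xt0 xt1 e0.
exists M => m /hM; apply: le_trans.
rewrite expr_div_n mulrA ler_pdivlMr ?exprn_gt0// mulrAC ler_wpM2r ?exprn_ge0//.
rewrite (le_trans _ (binomial_sum_le k m.+1 (ltW t0) t1))//.
by rewrite /binomial_sum big_ord_recr /= lerDr -/(binomial_sum k m t) binomial_sum_ge0// ltW.
Qed.

Lemma binomial_series k (z : C) (e : R) : cabs z < 1 -> 0 < e ->
  exists M, forall m, (M <= m)%N -> cabs (binomial_sum k m z - (1 - z) ^- k.+1) <= e.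
Proof.
move=> z1; have nz : 1 - z != 0.
  by rewrite subr_eq0; apply/eqP => zE; move: z1; rewrite -zE cabs1 ltxx.
have d0 : 0 < cabs (1 - z) by rewrite cabs_gt0.
elim: k e => [|k IH] e e0.
  have [M hM] := @binomial_coef_small 0 _ _ (cabs_ge0 z) z1 (mulr_gt0 e0 d0).
  exists M => m /hM; rewrite addn0 binn mul1r -ler_pdivrMr// => /(le_trans _); apply.
  rewrite -cabsX -cabsV -cabsM le_eqVlt; apply/orP; left; apply/eqP.
  rewrite -[RHS]cabsN; congr cabs.
  apply: (mulfI nz); rewrite mulrBr binomial_sum0 expr1 divff// mulrN mulrCA divff//.
  by ring.
have e1 : 0 < e / 2 * cabs (1 - z) by rewrite mulr_gt0 ?divr_gt0.
have [M1 h1] := IH _ e1.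
have [M2 h2] := @binomial_coef_small k.+1 _ _ (cabs_ge0 z) z1 e1.
exists (maxn M1 M2).+1 => -[//|m]; rewrite ltnS geq_max => /andP[m1 m2].
have -> : binomial_sum k.+1 m.+1 z - (1 - z) ^- k.+2 =
    ((binomial_sum k m.+1 z - (1 - z) ^- k.+1) - 'C(m + k.+1, m)%:R * z ^+ m.+1) / (1 - z).
  apply: (mulIf nz); rewrite mulfVK// mulrBl mulrC binomial_sumS [_ ^+ k.+2]exprSr invfM mulrVK ?unitfE//.
  by rewrite addrAC.
rewrite cabsM cabsV ler_pdivrMr// (le_trans (cabsB _ _))//.
rewrite (splitr e) mulrDl lerD//; first by apply: h1; rewrite (leq_trans m1).
rewrite cabsM cabs_nat cabsX (le_trans _ (h2 m m2))// ler_wpM2l// exprS.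
by rewrite ler_piMl ?exprn_ge0 ?cabs_ge0// ltW.
Qed.

End binomial_series.

Section reproducing_kernel.
Variables (R : realType) (N : nat).
Hypothesis N0 : (0 < N)%N.
Local Notation C := R[i].
Local Notation CN := 'cV[C]_N.
Local Notation kappa := (@kappa R N).

Lemma cabs_le_eq (X Y : C) : (forall e : R, 0 < e -> cabs (X - Y) <= e) -> X = Y.
Proof.
move=> h; apply/eqP; rewrite -subr_eq0 -cabs_eq0; apply/eqP/le_anti.
by rewrite cabs_ge0 andbT; apply/ler_addgt0Pr => e e0; rewrite add0r h.
Qed.

Lemma near_limits_eq (u v : nat -> C) (X Y : C) : u =1 v ->
  (forall e : R, 0 < e -> \forall m \near \oo, cabs (u m - X) <= e) ->
  (forall e : R, 0 < e -> \forall m \near \oo, cabs (v m - Y) <= e) -> X = Y.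
Proof.
move=> uv hu hv; apply: cabs_le_eq => e e0.
have e2 : 0 < e / 2 by rewrite divr_gt0.
have [M _ hM] := filterI (hu _ e2) (hv _ e2).
have [h1 h2] := hM M (leqnn M).
rewrite (_ : X - Y = (v M - Y) - (u M - X)); last by rewrite uv; ring.
by rewrite (le_trans (cabsB _ _))// (splitr e) lerD.
Qed.

Lemma near_binomial_series (z : C) (e : R) : cabs z < 1 -> 0 < e ->
  \forall m \near \oo, cabs (binomial_sum N.-1 m z - (1 - z) ^- N) <= e.
Proof.
move=> z1 e0; have [M hM] := binomial_series N.-1 z1 e0.
by exists M => // m /hM; rewrite prednK.
Qed.

Lemma sbm_binomial_sum k m F : sbm F -> sbm (fun z : CN => binomial_sum k m (F z)).
Proof. by move=> bF; apply: sbm_sum => n; apply/sbmZ/sbmX. Qed.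

Definition hardy_kernel (w z : CN) : C := (1 - dotc z w) ^- N.

(** Expanding the kernel along the direction u of w, the term of degree n is c n (r ^ 2 s) ^ n times
    a moment and its binomial coefficient, whose product is [kappa]. Both factors are dilated by r,
    whence the point r ^ 2 w. *)
Lemma sint_reproducing f (r : R) w : hol_ball f -> 0 <= r -> r < 1 -> enorm w <= 1 ->
  sphere_integral (fun z => f (r%:C *: z) * Num.conj (hardy_kernel w (r%:C *: z))) =
  kappa%:C * f ((r ^+ 2)%:C *: w).
Proof.
move=> hf r0 r1 w1.
(* When w = 0 the direction u is arbitrary; a basis vector is taken. *)
have [s [u [s0 s1 u1 wE]]] : exists s : R, exists u : CN, [/\ 0 <= s, s <= 1, enorm u = 1 & w = s%:C *: u].
  have [w0|w0] := eqVneq (enorm w) 0.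
    exists 0, (delta_mx (Ordinal N0) 0); split => //; first exact: enorm_delta.
    rewrite scale0r; apply/matrixP => i j; rewrite (ord1 j) mxE; apply/eqP.
    by rewrite -cabs_eq0; apply/eqP/le_anti; rewrite cabs_ge0 andbT -w0 cabs_coord_le.
  exists (enorm w), ((enorm w)^-1%:C *: w); split => //; first exact: enorm_ge0.
    by rewrite enormZ cabsR ger0_norm ?invr_ge0 ?enorm_ge0// mulVf.
  by rewrite scalerA -rmorphM divff// scale1r.
pose rho := (1 + r) / 2.
have rrho : r < rho by rewrite /rho; lra.
have rho1 : rho < 1 by rewrite /rho; lra.
have rho0 : 0 < rho by rewrite /rho; lra.
have [B B0 fB] := hol_ball_bound hf rho1.
have [|c hc] := @slice_ps R N f rho u hf rho0 rho1 _ B fB; first by rewrite u1.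
have K0 : 0 <= 2 * B by rewrite mulr_ge0.
pose F m (z : CN) := f (r%:C *: z) * Num.conj (binomial_sum N.-1 m ((r * s)%:C * dotc z u)).
have dwE z : dotc (r%:C *: z) w = (r * s)%:C * dotc z u.
  by rewrite wE dotcZl dotcZr conj_real mulrA -rmorphM.
have rs1 : r * s < 1 by rewrite (le_lt_trans _ r1)// ler_piMr.
have rs0 : 0 <= r * s by rewrite mulr_ge0.
have d1 z : enorm z = 1 -> cabs ((r * s)%:C * dotc z u) <= r * s.
  by move=> z1; rewrite cabsM cabsR ger0_norm// ler_piMr// dotc_le1.
have bf : sbm (fun z => f (r%:C *: z)) by exact: sbm_holR.
have bF m : sbm (F m).
  by apply: sbmM => //; apply: sbmJ; apply: sbm_binomial_sum; apply: sbmZ; exact: sbm_dotc.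
have FB m z : enorm z = 1 -> cabs (F m z) <= B * (1 - r * s) ^- N.-1.+1.
  move=> z1; rewrite cabsM cabsJ ler_pM ?cabs_ge0//; last by apply: cabs_binomial_sum => //; exact: d1.
  by apply: fB; rewrite enormZ cabsR ger0_norm// z1 mulr1 ltW.
have Fc z : enorm z = 1 -> forall e : R, 0 < e -> \forall m \near \oo,
    cabs (F m z - f (r%:C *: z) * Num.conj (hardy_kernel w (r%:C *: z))) <= e.
  move=> z1 e e0; have B1 : 0 < B + 1 by rewrite ltr_wpDl.
  have dz : cabs ((r * s)%:C * dotc z u) < 1 by rewrite (le_lt_trans (d1 z z1)).
  have := near_binomial_series dz (divr_gt0 e0 B1).
  apply: filterS => m hm; rewrite /F -mulrBr.
  rewrite (_ : Num.conj _ - Num.conj _ = Num.conj (binomial_sum N.-1 m ((r * s)%:C * dotc z u) - (1 - (r * s)%:C * dotc z u) ^- N)); last first.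
    by rewrite /hardy_kernel dwE; exact: esym (rmorphB _ _ _).
  rewrite cabsM cabsJ (le_trans (ler_wpM2l (cabs_ge0 _) hm))//.
  rewrite mulrCA ler_piMr ?(ltW e0)// ler_pdivrMr// mul1r (@le_trans _ _ B) ?lerDl//.
  by apply: fB; rewrite enormZ cabsR ger0_norm// z1 mulr1 ltW.
have [_ lim1] := sint_dominated bF FB Fc.
apply: (near_limits_eq _ lim1 (v := fun m => kappa%:C * \sum_(n < m) c n * ((r ^+ 2 * s)%:C) ^+ n)).
  move=> m; transitivity (sphere_integral (fun z => \sum_(n < m) ('C(n + N.-1, n)%:R * (r * s)%:C ^+ n) *
      (f (r%:C *: z) * Num.conj (dotc z u ^+ n)))).
    apply: eq_sint => z _; rewrite /F /binomial_sum.
    rewrite (_ : Num.conj (\sum_(n < m) _) = \sum_(n < m) Num.conj ('C(n + N.-1, n)%:R * ((r * s)%:C * dotc z u) ^+ n)); last exact: rmorph_sum.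
    rewrite mulr_sumr; apply: eq_bigr => n _.
    rewrite conj_mul exprMn conj_mul (conj_exp (_%:C)) conj_real.
    rewrite (_ : Num.conj ('C(n + N.-1, n)%:R) = 'C(n + N.-1, n)%:R); last exact: rmorph_nat.
    move: (f _) (Num.conj _) (_ ^+ n) (_%:R : C) => p q v t; ring.
  rewrite sint_sum => [|n]; last first.
    by apply/sbmZ/sbmM => //; apply/sbmJ/sbmX/sbm_dotc.
  rewrite mulr_sumr; apply: eq_bigr => n _.
  rewrite sintZ; last by apply: sbmM => //; apply/sbmJ/sbmX/sbm_dotc.
  rewrite (sint_monomial n u1 hf r0 rrho rho1 K0 hc) (momentE N0)//.
  have r2E : (r ^+ 2 * s)%:C = r%:C * (r * s)%:C :> C by rewrite -rmorphM expr2 mulrA.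
  rewrite -(moment_formula R N0 n) r2E exprMn.
  move: (moment _ _) (c n) (_%:R : C) (_ ^+ n) (_ ^+ n) => p q v x y; ring.
move=> e e0.
have r2 : cabs ((r ^+ 2 * s)%:C) < rho.
  rewrite cabsR ger0_norm ?mulr_ge0 ?sqr_ge0//; apply: le_lt_trans rrho.
  by rewrite expr2 -mulrA -[leRHS]mulr1 ler_wpM2l// ltW.
have q1 : cabs ((r ^+ 2 * s)%:C) / rho < 1 by rewrite ltr_pdivrMr// mul1r.
have q0 : 0 <= cabs ((r ^+ 2 * s)%:C) / rho by rewrite divr_ge0 ?cabs_ge0// ltW.
have [M _ hM] := geometric_small (kappa * (2 * B / (1 - cabs ((r ^+ 2 * s)%:C) / rho))) q0 q1 e0.
exists M => // m /= /hM; apply: le_trans.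
have k0 : 0 <= kappa by rewrite ltW// kappa_gt0.
rewrite wE scalerA -rmorphM -mulrBr cabsM [cabs kappa%:C]cabsR (ger0_norm k0) -mulrA ler_wpM2l//.
rewrite -opprB cabsN (le_trans (hc _ m r2))// le_eqVlt; apply/orP; left; apply/eqP.
by rewrite mulrAC.
Qed.

Lemma sbm_bound (F : CN -> C) : sbm F ->
  exists2 M : R, 0 <= M & forall z, enorm z = 1 -> cabs (F z) <= M.
Proof.
move=> /bmeas_bound[M M0 hM]; exists M => // z z1.
by rewrite -(real_tupleK z); apply: hM; rewrite /tuple_sphere /= tuple_norm_cv real_tupleK.
Qed.

Section iterated.
Variables (k : nat) (t : R) (D : CN -> CN -> C) (P Q : CN -> C).
Hypotheses (t1 : t < 1) (Dt : forall z x, enorm z = 1 -> enorm x = 1 -> cabs (D z x) <= t).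
Hypotheses (bD : forall z, sbm (D z)) (bP : sbm P) (bQ : sbm Q).
Hypothesis bI : forall n, sbm (fun z => sphere_integral (fun x => Q x * D z x ^+ n)).

(** Dominated convergence in the inner variable and then in the outer one. The measurability [bI] of
    the inner integrals is supplied by [sint_swap_pow]. *)
Lemma sint_iterated_cvg (e : R) : 0 < e -> \forall m \near \oo,
  cabs (sphere_integral (fun z => P z * sphere_integral (fun x => Q x * binomial_sum N.-1 m (D z x))) -
        sphere_integral (fun z => P z * sphere_integral (fun x => Q x * (1 - D z x) ^- N))) <= e.
Proof.
have [MP MP0 hP] := sbm_bound bP.
have [MQ MQ0 hQ] := sbm_bound bQ.
have t10 : 0 < 1 - t by rewrite subr_gt0.
have bQD m z : sbm (fun x => Q x * binomial_sum N.-1 m (D z x)).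
  by apply: sbmM => //; exact: sbm_binomial_sum.
have QDB m z x : enorm z = 1 -> enorm x = 1 ->
    cabs (Q x * binomial_sum N.-1 m (D z x)) <= MQ * (1 - t) ^- N.-1.+1.
  move=> z1 x1; rewrite cabsM ler_pM ?cabs_ge0//; first exact: hQ.
  by apply: cabs_binomial_sum => //; exact: Dt.
have lim1 z : enorm z = 1 -> forall e : R, 0 < e -> \forall m \near \oo,
    cabs (sphere_integral (fun x => Q x * binomial_sum N.-1 m (D z x)) -
      sphere_integral (fun x => Q x * (1 - D z x) ^- N)) <= e.
  move=> z1; have [|_] := sint_dominated (bQD^~ z) (fun m x => QDB m z x z1)
      (G := fun x => Q x * (1 - D z x) ^- N); last by [].
  move=> x x1 e' e'0; have M1 : 0 < MQ + 1 by rewrite ltr_wpDl.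
  have dz : cabs (D z x) < 1 by rewrite (le_lt_trans (Dt z1 x1)).
  have := near_binomial_series dz (divr_gt0 e'0 M1).
  apply: filterS => m hm; rewrite -mulrBr.
  rewrite cabsM (le_trans (ler_wpM2l (cabs_ge0 _) hm))//.
  rewrite mulrCA ler_piMr ?(ltW e'0)// ler_pdivrMr// mul1r (@le_trans _ _ MQ) ?lerDl//.
  exact: hQ.
have k0 : 0 <= kappa by rewrite ltW// kappa_gt0.
move: e.
have [|||_] := @sint_dominated R N (fun m z => P z * sphere_integral (fun x => Q x * binomial_sum N.-1 m (D z x)))
   (fun z => P z * sphere_integral (fun x => Q x * (1 - D z x) ^- N))
   (MP * (2 * (MQ * (1 - t) ^- N.-1.+1) * kappa)); last by [].
- move=> m; apply: sbmM => //.
  apply: (eq_sbm _ (F := fun z => \sum_(n < m) 'C(n + N.-1, n)%:R * sphere_integral (fun x => Q x * D z x ^+ n))).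
    move=> z _; transitivity (sphere_integral (fun x => \sum_(n < m) 'C(n + N.-1, n)%:R * (Q x * D z x ^+ n))).
      rewrite sint_sum => [|n]; last by apply/sbmZ/sbmM => //; exact: sbmX.
      by apply: eq_bigr => n _; rewrite sintZ//; apply/sbmM => //; exact: sbmX.
    by apply: eq_sint => x _; rewrite mulr_sumr; apply: eq_bigr => n _; rewrite mulrCA.
  by apply: sbm_sum => n; exact: sbmZ.
- move=> m z z1; rewrite cabsM ler_pM ?cabs_ge0//; first exact: hP.
  by apply: sint_le => // x x1; exact: QDB.
- move=> z z1 e e0; have M1 : 0 < MP + 1 by rewrite ltr_wpDl.
  have := lim1 z z1 _ (divr_gt0 e0 M1).
  apply: filterS => m hm; rewrite -mulrBr.
  rewrite cabsM (le_trans (ler_wpM2l (cabs_ge0 _) hm))//.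
  rewrite mulrCA ler_piMr ?(ltW e0)// ler_pdivrMr// mul1r (@le_trans _ _ MP) ?lerDl//.
  exact: hP.
Qed.

End iterated.
End reproducing_kernel.

(** * Exchange of the order of integration *)

Section swap.
Variables (R : realType) (N : nat).
Hypothesis N0 : (0 < N)%N.
Local Notation C := R[i].
Local Notation CN := 'cV[C]_N.
Variables (Phi : CN -> CN) (rho : R).
Hypotheses (bPhi : forall j, sbm (fun z => Phi z j 0)).
Hypotheses (Phi1 : forall z, enorm z = 1 -> enorm (Phi z) <= 1).
Hypotheses (rho0 : 0 <= rho) (rho1 : rho < 1).

Let D z x := dotc (Phi z) (rho%:C *: x).

Let bDx z : sbm (D z).
Proof.
apply: (eq_sbm _ (sbmJ (sbmZ rho%:C (sbm_dotc (Phi z))))) => x _.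
by rewrite /D [RHS]dotcC dotcZl.
Qed.

Let bDz x : sbm (D^~ x).
Proof. by apply: sbm_sum => j; apply: sbmM => //; exact: sbm_cst. Qed.

Let bxj j : sbm (fun x : CN => Num.conj ((rho%:C *: x) j 0)).
Proof.
apply: sbmJ; apply: (eq_sbm _ (sbmZ rho%:C (sbm_dotc (delta_mx j 0)))) => x _.
by rewrite dotc_delta mxE.
Qed.

(** D is a finite sum of products of a function of z and a function of x. The induction splits off
    one factor D and absorbs its two parts into P and Q, which are therefore arbitrary in the
    induction hypothesis. *)
Lemma sint_swap_pow n P Q : sbm P -> sbm Q ->
  [/\ sbm (fun z => sphere_integral (fun x => Q x * D z x ^+ n)),
      sbm (fun x => sphere_integral (fun z => P z * D z x ^+ n)) &
      sphere_integral (fun z => P z * sphere_integral (fun x => Q x * D z x ^+ n)) =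
      sphere_integral (fun x => Q x * sphere_integral (fun z => P z * D z x ^+ n))].
Proof.
elim: n P Q => [|n IH] P Q bP bQ.
  have E F (z : CN) : sphere_integral (fun x : CN => F x * D z x ^+ 0) = sphere_integral F.
    by apply: eq_sint => x _; rewrite expr0 mulr1.
  have E' F (x : CN) : sphere_integral (fun z : CN => F z * D z x ^+ 0) = sphere_integral F.
    by apply: eq_sint => z _; rewrite expr0 mulr1.
  split.
  - by apply: (eq_sbm _ (sbm_cst N (sphere_integral Q))) => z _; rewrite E.
  - by apply: (eq_sbm _ (sbm_cst N (sphere_integral P))) => z _; rewrite E'.
  - transitivity (sphere_integral Q * sphere_integral P).
      by rewrite -sintZ//; apply: eq_sint => z _; rewrite E mulrC.
    by rewrite mulrC -sintZ//; apply: eq_sint => z _; rewrite E' mulrC.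
have bPj j : sbm (fun z => P z * Phi z j 0) by exact: sbmM.
have bQj j : sbm (fun x => Q x * Num.conj ((rho%:C *: x) j 0)) by exact: sbmM.
have bQD j z : sbm (fun x => (Q x * Num.conj ((rho%:C *: x) j 0)) * D z x ^+ n).
  by apply: sbmM => //; exact: sbmX.
have bPD j x : sbm (fun z => (P z * Phi z j 0) * D z x ^+ n).
  by apply: sbmM => //; exact: sbmX.
have h j := IH _ _ (bPj j) (bQj j).
have E z : sphere_integral (fun x => Q x * D z x ^+ n.+1) =
    \sum_j Phi z j 0 * sphere_integral (fun x => (Q x * Num.conj ((rho%:C *: x) j 0)) * D z x ^+ n).
  under eq_bigr => j _ do rewrite -sintZ//.
  rewrite -sint_sum => [|j]; last exact: sbmZ.
  apply: eq_sint => x _; rewrite exprS {1}/D /dotc big_distrl big_distrr; apply: eq_bigr => j _ /=.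
  move: (Phi z j 0) (Num.conj _) (Q x) (_ ^+ n) => p q s t; ring.
have E' x : sphere_integral (fun z => P z * D z x ^+ n.+1) =
    \sum_j Num.conj ((rho%:C *: x) j 0) * sphere_integral (fun z => (P z * Phi z j 0) * D z x ^+ n).
  under eq_bigr => j _ do rewrite -sintZ//.
  rewrite -sint_sum => [|j]; last exact: sbmZ.
  apply: eq_sint => z _; rewrite exprS {1}/D /dotc big_distrl big_distrr; apply: eq_bigr => j _ /=.
  move: (Phi z j 0) (Num.conj _) (P z) (_ ^+ n) => p q s t; ring.
split.
- apply: (eq_sbm (fun z _ => esym (E z))); apply: sbm_sum => j; apply: sbmM; [exact: bPhi|by case: (h j)].
- apply: (eq_sbm (fun z _ => esym (E' z))); apply: sbm_sum => j; apply: sbmM; [exact: bxj|by case: (h j)].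
- transitivity (\sum_j sphere_integral (fun z => (P z * Phi z j 0) *
    sphere_integral (fun x => (Q x * Num.conj ((rho%:C *: x) j 0)) * D z x ^+ n))).
    rewrite -sint_sum => [|j]; last by case: (h j) => c1 c2 _; exact: sbmM.
    by apply: eq_sint => z _; rewrite E mulr_sumr; apply: eq_bigr => j _; rewrite mulrA.
  under eq_bigr => j _ do rewrite (let: And3 _ _ h3 := h j in h3).
  rewrite -sint_sum => [|j]; last by case: (h j) => c1 c2 _; exact: sbmM.
  by apply: eq_sint => x _; rewrite E' mulr_sumr; apply: eq_bigr => j _; rewrite mulrA.
Qed.

Let D1 z x : enorm z = 1 -> enorm x = 1 -> cabs (D z x) <= rho.
Proof.
move=> z1 x1; rewrite (le_trans (dotc_cauchy_schwarz _ _))//.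
by rewrite enormZ x1 mulr1 cabsR ger0_norm// ler_piMl// Phi1.
Qed.

Lemma sint_swap P Q : sbm P -> sbm Q ->
  sphere_integral (fun z => P z * sphere_integral (fun x => Q x * (1 - D z x) ^- N)) =
  sphere_integral (fun x => Q x * sphere_integral (fun z => P z * (1 - D z x) ^- N)).
Proof.
move=> bP bQ; have h n := sint_swap_pow n bP bQ.
have bQD n z : sbm (fun x => Q x * D z x ^+ n) by apply: sbmM => //; exact: sbmX.
have bPD n x : sbm (fun z => P z * D z x ^+ n) by apply: sbmM => //; exact: sbmX.
have l1 := sint_iterated_cvg N0 rho1 D1 bDx bP bQ (fun n => let: And3 b _ _ := h n in b).
have l2 := sint_iterated_cvg N0 rho1 (fun x z x1 z1 => D1 z1 x1) bDz bQ bP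
  (fun n => let: And3 _ b _ := h n in b).
have b1 n : sbm (fun z => P z * sphere_integral (fun x => Q x * D z x ^+ n)).
  by case: (h n) => c1 c2 _; exact: sbmM.
have b2 n : sbm (fun x => Q x * sphere_integral (fun z => P z * D z x ^+ n)).
  by case: (h n) => c1 c2 _; exact: sbmM.
apply: (near_limits_eq _ l1 l2) => m.
transitivity (\sum_(n < m) 'C(n + N.-1, n)%:R *
    sphere_integral (fun z => P z * sphere_integral (fun x => Q x * D z x ^+ n))).
  under [RHS]eq_bigr => n _ do rewrite -(sintZ _ (b1 n)).
  rewrite -sint_sum => [|n]; last by apply/sbmZ/sbmM => //; case: (h n).
  apply: eq_sint => z _; under [RHS]eq_bigr => n _ do rewrite mulrCA -sintZ//.
  rewrite -mulr_sumr -sint_sum => [|n]; last exact: sbmZ.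
  congr (_ * _); apply: eq_sint => x _; rewrite mulr_sumr.
  by apply: eq_bigr => n _; rewrite mulrCA.
under eq_bigr => n _ do rewrite (let: And3 _ _ h3 := h n in h3).
under eq_bigr => n _ do rewrite -(sintZ _ (b2 n)).
rewrite -sint_sum => [|n]; last by apply/sbmZ/sbmM => //; case: (h n).
apply: eq_sint => x _; under eq_bigr => n _ do rewrite mulrCA -sintZ//.
rewrite -mulr_sumr -sint_sum => [|n]; last exact: sbmZ.
congr (_ * _); apply: eq_sint => z _; rewrite mulr_sumr.
by apply: eq_bigr => n _; rewrite mulrCA.
Qed.

End swap.

(** * The weighted composition operator and its adjoint *)

Section conjugation.
Variables (R : realType) (N : nat).
Local Notation C := R[i].
Local Notation CN := 'cV[C]_N.

Lemma conj_mxK m n : involutive (@conj_mx R m n).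
Proof. by move=> M; apply/matrixP => i j; rewrite !mxE conjCK. Qed.

Lemma conj_mxM m n p (M : 'M[C]_(m, n)) (M' : 'M[C]_(n, p)) :
  conj_mx (M *m M') = conj_mx M *m conj_mx M'.
Proof. exact: map_mxM. Qed.

Lemma conj_mxB m n (M M' : 'M[C]_(m, n)) : conj_mx (M - M') = conj_mx M - conj_mx M'.
Proof. by apply/matrixP => i j; rewrite !mxE rmorphB. Qed.

Lemma conj_mxZ m n a (M : 'M[C]_(m, n)) : conj_mx (a *: M) = Num.conj a *: conj_mx M.
Proof. by apply/matrixP => i j; rewrite !mxE rmorphM. Qed.

Lemma conj_sub1 (a : C) : Num.conj (1 - a) = 1 - Num.conj a.
Proof. by rewrite rmorphB rmorph1. Qed.

Lemma conj_inv (a : C) : Num.conj a^-1 = (Num.conj a)^-1.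
Proof. exact: fmorphV. Qed.

Lemma dotc_conj (z w : CN) : dotc (conj_mx z) (conj_mx w) = Num.conj (dotc z w).
Proof.
rewrite /dotc rmorph_sum; apply: eq_bigr => j _.
by rewrite !mxE rmorphM.
Qed.

Lemma enorm_conj (z : CN) : enorm (conj_mx z) = enorm z.
Proof. by rewrite /enorm dotc_conj cReJ. Qed.

(** Symmetry makes the adjoint of A its entrywise conjugate; this is where the conjugate data come
    from. *)
Lemma dotc_symmetric (A : 'M[C]_N) (z w : CN) : A^T = A ->
  dotc (A *m z) w = dotc z (conj_mx A *m w).
Proof.
move=> hA; rewrite /dotc.
transitivity (\sum_i \sum_j A i j * z j 0 * Num.conj (w i 0)).
  by apply: eq_bigr => i _; rewrite mxE mulr_suml.
rewrite exchange_big; apply: eq_bigr => j _ /=.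
rewrite mxE [X in _ * X]rmorph_sum mulr_sumr; apply: eq_bigr => i _.
rewrite rmorphM /= mxE conjCK -[in LHS]hA mxE; move: (Num.conj _) => q; ring.
Qed.

Lemma one_minus_dotc_neq0 (z w : CN) : enorm z < 1 -> enorm w < 1 -> 1 - dotc z w != 0.
Proof.
move=> z1 w1; rewrite subr_eq0; apply/eqP => zw.
have := dotc_cauchy_schwarz z w; rewrite -zw cabs1 leNgt.
by rewrite mulr_ilt1 ?enorm_ge0.
Qed.

End conjugation.

Section weighted_composition_operator.
Variables (R : realType) (N : nat).
Hypothesis N0 : (0 < N)%N.
Local Notation C := R[i].
Local Notation CN := 'cV[C]_N.
Local Notation kappa := (@kappa R N).
Variables (a1 : C) (a0 : CN) (A : 'M[C]_N).
Hypotheses (ha0 : enorm a0 < 1) (hA : A^T = A).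
Hypothesis hphi : forall z, enorm z < 1 -> enorm (frac_map a0 A z) < 1.

Local Notation phi := (frac_map a0 A).
Local Notation psi := (kernel_weight a0 a1).
Local Notation psi' := (kernel_weight (conj_mx a0) (Num.conj a1)).
Local Notation phi' := (frac_map (conj_mx a0) (conj_mx A)).

(** The map with conjugate data is conjugate to [phi] by an isometry, hence also a self-map of the
    ball. *)
Lemma frac_map_conj z : phi' z = conj_mx (phi (conj_mx z)).
Proof.
rewrite /frac_map conj_mxZ conj_mxB conj_mxM conj_mxK dotc_conj conj_mxK; congr (_ *: _).
by rewrite conj_inv conj_sub1 conjCK.
Qed.

Lemma conj_ball z : enorm z < 1 -> enorm (phi' z) < 1.
Proof. by move=> z1; rewrite frac_map_conj enorm_conj hphi// enorm_conj. Qed.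

(** With denominators cleared, both sides are 1 - <y, conj a0> - <a0, u> + <A y, u>. Raised to the
    power -N, this gives the action of W on kernels. *)
Lemma frac_map_kernel y u : enorm y < 1 -> enorm u < 1 ->
  (1 - dotc y (conj_mx a0)) * (1 - dotc (phi y) u) =
  (1 - dotc a0 u) * (1 - dotc y (phi' u)).
Proof.
move=> y1 u1.
have n1 : 1 - dotc y (conj_mx a0) != 0 by rewrite one_minus_dotc_neq0 ?enorm_conj.
have n2 : 1 - dotc a0 u != 0 by rewrite one_minus_dotc_neq0.
have E1 : dotc (phi y) u = (1 - dotc y (conj_mx a0))^-1 * (dotc a0 u - dotc (A *m y) u).
  by rewrite dotcZl dotcBl.
have E2 : dotc y (phi' u) = (1 - dotc a0 u)^-1 * (dotc y (conj_mx a0) - dotc (A *m y) u).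
  rewrite dotcZr dotcBr -dotc_symmetric// conj_mxK; congr (_ * _).
  by rewrite conj_inv conj_sub1 -dotcC.
rewrite E1 E2 mulrBr mulVKf// [RHS]mulrBr mulVKf//; ring.
Qed.

Lemma weighted_composition_kernel y u : enorm y < 1 -> enorm u < 1 ->
  weighted_composition psi phi (hardy_kernel u) y = a1 / (1 - dotc a0 u) ^+ N * hardy_kernel (phi' u) y.
Proof.
move=> y1 u1; rewrite /weighted_composition /kernel_weight /hardy_kernel.
by rewrite -!mulrA -!invfM -!exprMn frac_map_kernel.
Qed.

Lemma hol_ball_kernel (w : CN) : enorm w < 1 -> hol_ball (hardy_kernel w).
Proof.
move=> w1 z z1; apply: hol_atV.
  by rewrite expf_neq0// one_minus_dotc_neq0.
apply: hol_atX; apply: hol_atD; first exact: hol_at_cst.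
rewrite /hol_at; under eq_fun do rewrite -mulN1r.
by apply: hol_atM; [exact: hol_at_cst|exact: hol_at_dotc].
Qed.

Lemma hol_ball_weight : hol_ball psi.
Proof.
have ca0 : enorm (conj_mx a0) < 1 by rewrite enorm_conj.
by move=> z z1; apply: hol_atM; [exact: hol_at_cst|exact: (hol_ball_kernel ca0)].
Qed.

Lemma hol_ball_frac_map j : hol_ball (fun z => phi z j 0).
Proof.
have ca0 : enorm (conj_mx a0) < 1 by rewrite enorm_conj.
move=> z z1; rewrite /hol_at.
have -> : (fun z => phi z j 0) = (fun z => (1 - dotc z (conj_mx a0))^-1 *
    (a0 j 0 + \sum_k (- A j k) * z k 0)).
  apply/funext => y; rewrite !mxE; congr (_ * (_ + _)).
  by rewrite -sumrN; apply: eq_bigr => k _; rewrite mulNr.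
apply: hol_atM.
  apply: hol_atV; first by rewrite one_minus_dotc_neq0.
  apply: hol_atD; first exact: hol_at_cst.
  rewrite /hol_at; under eq_fun do rewrite -mulN1r.
  by apply: hol_atM; [exact: hol_at_cst|exact: hol_at_dotc].
apply: hol_atD; first exact: hol_at_cst.
apply: hol_at_sum => k; apply: hol_atM; first exact: hol_at_cst.
exact: hol_at_coord.
Qed.

Lemma hol_ball_weighted_composition (f : CN -> C) : hol_ball f ->
  hol_ball (weighted_composition psi phi f).
Proof.
move=> hf z z1; apply: hol_atM; first exact: hol_ball_weight.
by apply: hol_at_comp => [j|]; [exact: hol_ball_frac_map|apply: hf; exact: hphi].
Qed.

End weighted_composition_operator.

Section adjoint.
Variables (R : realType) (N : nat).
Hypothesis N0 : (0 < N)%N.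
Local Notation C := R[i].
Local Notation CN := 'cV[C]_N.
Local Notation kappa := (@kappa R N).
Variables (a1 : C) (a0 : CN) (A : 'M[C]_N).
Hypotheses (ha0 : enorm a0 < 1) (hA : A^T = A).
Hypothesis hphi : forall z, enorm z < 1 -> enorm (frac_map a0 A z) < 1.

Local Notation phi := (frac_map a0 A).
Local Notation psi := (kernel_weight a0 a1).
Local Notation psi' := (kernel_weight (conj_mx a0) (Num.conj a1)).
Local Notation phi' := (frac_map (conj_mx a0) (conj_mx A)).

Lemma hol_ball_scale (f : CN -> C) (r : R) : hol_ball f -> 0 <= r -> r <= 1 ->
  hol_ball (fun z => f (r%:C *: z)).
Proof.
move=> hf r0 r1 z z1; apply: hol_at_comp => [j|]; last first.
  by apply: hf; rewrite enormZ cabsR ger0_norm// (le_lt_trans _ z1)// ler_piMl// enorm_ge0.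
rewrite /hol_at; under eq_fun do rewrite mxE.
by apply: hol_atM; [exact: hol_at_cst|exact: hol_at_coord].
Qed.

(* Reproduce the dilation of [f], swap the integrals, and reproduce that of [h]. *)
Lemma sint_weighted_adjoint (f h : CN -> C) (r rho : R) : hol_ball f -> hol_ball h ->
  0 <= r -> r < 1 -> 0 <= rho -> rho < 1 ->
  sphere_integral (fun z => weighted_composition psi phi (fun y => f ((rho ^+ 2)%:C *: y)) (r%:C *: z) *
    Num.conj (h (r%:C *: z))) =
  sphere_integral (fun x => f (rho%:C *: x) *
    Num.conj (weighted_composition psi' phi' (fun y => h ((r ^+ 2)%:C *: y)) (rho%:C *: x))).
Proof.
move=> hf hh r0 r1 rho0 rho1.
have k0 : kappa%:C != 0 :> C by rewrite -cabs_eq0 cabsR normr_eq0 gt_eqF// kappa_gt0.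
have rz (z : CN) : enorm z = 1 -> enorm (r%:C *: z) < 1.
  by move=> z1; rewrite enormZ cabsR ger0_norm// z1 mulr1.
have rx (x : CN) : enorm x = 1 -> enorm (rho%:C *: x) < 1.
  by move=> x1; rewrite enormZ cabsR ger0_norm// x1 mulr1.
have kJ (w y : CN) : Num.conj (hardy_kernel w y) = (1 - dotc w y) ^- N.
  by rewrite /hardy_kernel conj_inv conj_exp conj_sub1 -dotcC.
have f2 : hol_ball (fun y => f ((rho ^+ 2)%:C *: y)).
  by apply: hol_ball_scale => //; [exact: sqr_ge0|rewrite exprn_ile1// ltW].
pose P z := psi (r%:C *: z) * Num.conj (h (r%:C *: z)).
pose Q x := f (rho%:C *: x).
have bh : sbm (fun z => h (r%:C *: z)) by exact: sbm_holR.
have bP : sbm P.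
  apply: sbmM; last exact: (sbmJ bh).
  by apply: (sbm_holR _ r0 r1); exact: hol_ball_weight.
have bQ : sbm Q by exact: sbm_holR.
have bPhi j : sbm (fun z => phi (r%:C *: z) j 0).
  by apply: (@sbm_holR R N (fun z => phi z j 0)) => //; exact: hol_ball_frac_map.
have Phi1 (z : CN) : enorm z = 1 -> enorm (phi (r%:C *: z)) <= 1.
  by move=> z1; rewrite ltW// hphi// rz.
apply: (mulfI k0).
transitivity (sphere_integral (fun z => P z * sphere_integral (fun x => Q x *
    (1 - dotc (phi (r%:C *: z)) (rho%:C *: x)) ^- N))).
  rewrite -sintZ; last first.
    apply: sbmM; last exact: sbmJ.
    exact: (sbm_holR (hol_ball_weighted_composition _ ha0 hphi f2) r0 r1).
  apply: eq_sint => z z1; rewrite /weighted_composition.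
  transitivity (P z * (kappa%:C * f ((rho ^+ 2)%:C *: phi (r%:C *: z)))).
    rewrite /P; move: (psi _) (f _) (Num.conj _) => p q s; ring.
  rewrite -sint_reproducing ?Phi1//; congr (_ * _).
  by apply: eq_sint => x x1; rewrite kJ.
rewrite (sint_swap N0 bPhi Phi1 rho0 rho1 bP bQ) -sintZ; last first.
  apply: (sbmM bQ); apply: sbmJ; apply: (sbm_holR _ rho0 rho1).
  have cA : (conj_mx A)^T = conj_mx A by rewrite /conj_mx map_trmx hA.
  have ca0 : enorm (conj_mx a0) < 1 by rewrite enorm_conj.
  have h2 : hol_ball (fun y => h ((r ^+ 2)%:C *: y)).
    by apply: hol_ball_scale => //; [exact: sqr_ge0|rewrite exprn_ile1// ltW].
  exact: (hol_ball_weighted_composition _ ca0 (conj_ball hphi) h2).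
apply: eq_sint => x x1; rewrite mulrCA; congr (_ * _).
have x1' := rx x x1.
have bk : sbm (fun z => h (r%:C *: z) * Num.conj (hardy_kernel (phi' (rho%:C *: x)) (r%:C *: z))).
  apply: (sbmM bh); apply: sbmJ; apply: (sbm_holR _ r0 r1).
  by apply: hol_ball_kernel; exact: conj_ball.
transitivity (sphere_integral (fun z => a1 / (1 - dotc a0 (rho%:C *: x)) ^+ N *
   Num.conj (h (r%:C *: z) * Num.conj (hardy_kernel (phi' (rho%:C *: x)) (r%:C *: z))))).
  apply: eq_sint => z z1; have z1' := rz z z1.
  have := weighted_composition_kernel a1 ha0 hA z1' x1'; rewrite {1}/weighted_composition => E.
  rewrite conj_mul conjCK mulrCA -E /P.
  by rewrite mulrAC mulrC.
rewrite sintZ; last exact: sbmJ.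
rewrite sintJ// sint_reproducing//; last by rewrite ltW// conj_ball.
rewrite conj_mul conj_real /weighted_composition conj_mul mulrCA; congr (_ * (_ * _)).
rewrite /kernel_weight conj_mul conjCK; congr (_ * _).
by rewrite conj_inv conj_exp conj_sub1 conj_mxK -dotcC.
Qed.

End adjoint.

(** * The Hardy space *)

Section hardy_space.
Variables (R : realType) (N : nat).
Hypothesis N0 : (0 < N)%N.
Local Notation C := R[i].
Local Notation CN := 'cV[C]_N.
Local Notation S := (@tuple_sphere R (N + N)).
Local Notation sigma := (@surface_measure R (N + N)).
Implicit Types f g : CN -> C.

Definition mean_dot f g (r : R) : C :=
  sphere_integral (fun z => f (r%:C *: z) * Num.conj (g (r%:C *: z))).
Definition mean_sqr f (r : R) : R := complex.Re (mean_dot f f r).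
Definition lin_comb f (c : C) g : CN -> C := fun z => f z + c * g z.

Lemma sphere_ball (r : R) (z : CN) : 0 <= r < 1 -> enorm z = 1 -> enorm (r%:C *: z) < 1.
Proof. by move=> /andP[r0 r1] z1; rewrite enormZ cabsR ger0_norm// z1 mulr1. Qed.

Lemma eq_mean_dot f f' g g' (r : R) : 0 <= r < 1 -> (forall z, enorm z < 1 -> f z = f' z) ->
  (forall z, enorm z < 1 -> g z = g' z) -> mean_dot f g r = mean_dot f' g' r.
Proof.
move=> r01 ff' gg'; apply: eq_sint => z z1; have rz := sphere_ball r01 z1.
by rewrite ff'// gg'.
Qed.

Lemma hol_lin_comb f c g : hol_ball f -> hol_ball g -> hol_ball (lin_comb f c g).
Proof.
move=> hf hg z z1; apply: hol_atD; first exact: hf.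
by apply: hol_atM; [exact: hol_at_cst|exact: hg].
Qed.

Lemma mean_sqr_ge0 f (r : R) : hol_ball f -> 0 <= r < 1 -> 0 <= mean_sqr f r.
Proof.
move=> hf r01; rewrite -[0](mul0r (@kappa R N)).
apply: sint_Re_ge => [|z _]; first exact: sbm_pair.
by rewrite cabs_sqr sqr_ge0.
Qed.

Lemma mean_sqr_lin_comb f c g (r : R) : hol_ball f -> hol_ball g -> 0 <= r < 1 ->
  mean_sqr (lin_comb f c g) r = mean_sqr f r + cabs c ^+ 2 * mean_sqr g r +
    2 * complex.Re (Num.conj c * mean_dot f g r).
Proof.
move=> hf hg r01; have bff := sbm_pair hf hf r01 r01.
have bgg := sbm_pair hg hg r01 r01; have bfg := sbm_pair hf hg r01 r01.
have bX : sbm (fun z => Num.conj c * (f (r%:C *: z) * Num.conj (g (r%:C *: z)))) by exact: sbmZ.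
have -> : mean_sqr (lin_comb f c g) r = complex.Re (mean_dot f f r +
    ((cabs c ^+ 2)%:C * mean_dot g g r +
    (Num.conj c * mean_dot f g r + Num.conj (Num.conj c * mean_dot f g r)))).
  rewrite /mean_sqr /mean_dot; congr complex.Re.
  rewrite -(sintZ (Num.conj c) bfg) -(sintJ bX) -(sintD bX (sbmJ bX)).
  rewrite -(sintZ _ bgg) -sintD; last 2 first.
  - exact: sbmZ.
  - by apply: sbmD => //; exact: sbmJ.
  rewrite -sintD//; last by apply: sbmD; [exact: sbmZ|apply: sbmD => //; exact: sbmJ].
  apply: eq_sint => z _; rewrite /lin_comb.
  have -> (a b : C) : Num.conj (a + c * b) = Num.conj a + Num.conj c * Num.conj b.
    by rewrite rmorphD -conj_mul.
  rewrite !conj_mul !conjCK -cabs_sqr.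
  move: (f _) (g _) => a b; move: (Num.conj a) (Num.conj b) (Num.conj c) => a' b' c'.
  by ring.
rewrite !cReD cReJ cReM /= mul0r subr0 addrA; congr (_ + _).
by rewrite mulr2n mulrDl !mul1r.
Qed.

Lemma mean_sqr_mono f (r r' : R) : hol_ball f -> 0 <= r -> r <= r' -> r' < 1 ->
  mean_sqr f r <= mean_sqr f r'.
Proof. exact: sint_mono. Qed.

Lemma hardyP f : hardy f <->
  hol_ball f /\ exists M : R, forall r, 0 < r < 1 -> mean_sqr f r <= M.
Proof.
have E r : hol_ball f -> 0 < r < 1 -> (\int[sigma]_(x in S)
    ((complex.Re `|f (r%:C *: complex_vector x)| ^+ 2)%:E))%E = (mean_sqr f r)%:E.
  move=> hf /andP[r0 r1]; have r01 : 0 <= r < 1 by rewrite ltW.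
  have [ib _] := bmeas_integrable (@measurable_tuple_sphere R (N + N))
    (surface_measure_lty R (N + N)) (sbm_pair hf hf r01 r01).
  have e x : complex.Re (f (r%:C *: complex_vector x) * Num.conj (f (r%:C *: complex_vector x))) =
      complex.Re `|f (r%:C *: complex_vector x)| ^+ 2 by rewrite cabs_sqr.
  under eq_integral do rewrite -e.
  rewrite /mean_sqr /mean_dot /sphere_integral /= /Rintegral fineK//.
  by apply: integrable_fin_num => //; exact: measurable_tuple_sphere.
split=> [[hf bf]|[hf [M hM]]].
  split; first exact: hf.
  move: bf; set s := ereal_sup _ => bf.
  have le r : 0 < r < 1 -> ((mean_sqr f r)%:E <= s)%E.
    by move=> r01; apply: ereal_sup_ubound; exists r => //; exact: E.
  case: s le bf => [M|//|] le bf; first by exists M => r /le; rewrite lee_fin.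
  by exists 0 => r /le.
split; first exact: hf.
apply: (@le_lt_trans _ _ M%:E); last exact: ltry.
by apply: ge_ereal_sup => _ [r r01 <-]; rewrite E// lee_fin hM.
Qed.

Lemma hardy_hol f : hardy f -> hol_ball f.
Proof. by case/hardyP. Qed.

Lemma hardy_lin_comb f c g : hardy f -> hardy g -> hardy (lin_comb f c g).
Proof.
move=> /hardyP[hf [M hM]] /hardyP[hg [M' hM']]; apply/hardyP.
split; first exact: hol_lin_comb.
exists (2 * M + 2 * (cabs c ^+ 2 * M')) => r /[dup] r01 /andP[r0 r1].
have r01' : 0 <= r < 1 by rewrite ltW.
(* Positivity of the mean of |f - c g| ^ 2 bounds the cross term, as in the parallelogram law. *)
have := mean_sqr_ge0 (hol_lin_comb (- c) hf hg) r01'.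
rewrite !mean_sqr_lin_comb// cabsN.
have -> : Num.conj (- c) = - Num.conj c by exact: rmorphN.
rewrite mulNr cReN; have := hM r r01; have : cabs c ^+ 2 * mean_sqr g r <= cabs c ^+ 2 * M'.
  by rewrite ler_wpM2l ?sqr_ge0// hM'.
move: (mean_sqr f r) (_ * mean_sqr g r) (_ * M') (complex.Re _) => a b d e; lra.
Qed.

Definition hardy_sqr f : R := lim (mean_sqr f r @[r --> 1^'-]).

Lemma near_left1 : \forall r \near (1 : R)^'-, 0 < r < 1.
Proof.
near=> r; apply/andP; split; near: r; first exact: nbhs_left_gt.
exact: nbhs_left_lt.
Unshelve. all: by end_near. Qed.

Lemma near_left1_fmap (u v : R -> R) : (\forall r \near (1 : R)^'-, u r = v r) ->
  (u r @[r --> (1 : R)^'-]) = (v r @[r --> (1 : R)^'-]).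
Proof.
move=> uv; apply/funext => X; apply/propext; rewrite /fmap /=.
by split; apply: filterS2 uv => r e; rewrite /preimage /= e.
Qed.

Lemma left1_cvg_half (u v w : R -> R) (a b c : R) :
  u r @[r --> (1 : R)^'-] --> a -> v r @[r --> (1 : R)^'-] --> b ->
  w r @[r --> (1 : R)^'-] --> c ->
  (u r - v r - w r) * 2^-1 @[r --> (1 : R)^'-] --> (a - b - c) / 2.
Proof.
move=> ua vb wc; apply: cvgM; last exact: cvg_cst.
by apply: cvgB => //; exact: cvgB.
Qed.

(** The means are bounded and, by [sint_mono], nondecreasing in r. *)
Lemma mean_sqr_cvg f : hardy f -> mean_sqr f r @[r --> 1^'-] --> hardy_sqr f.
Proof.
move=> /hardyP[hf [M hM]]; suff : cvg (mean_sqr f r @[r --> 1^'-]) by [].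
have p0 : \forall x \near (1 : R)^'-, 0 < x by exact: nbhs_left_gt.
apply: nondecreasing_at_left_is_cvgr; move: p0; apply: filterS => x x0.
  move=> y z; rewrite !in_itv /= => /andP[xy y1] /andP[xz z1] yz.
  by apply: mean_sqr_mono => //; rewrite ltW// (lt_trans x0).
exists M => _ [y yx <-]; move: yx; rewrite /= in_itv /= => /andP[xy y1].
by apply: hM; rewrite (lt_trans x0).
Qed.

Lemma mean_sqr_le f (r : R) : hardy f -> 0 <= r < 1 -> mean_sqr f r <= hardy_sqr f.
Proof.
move=> hf /andP[r0 r1]; apply: limr_ge; first by apply/cvg_ex; exists (hardy_sqr f); exact: mean_sqr_cvg.
near=> s; apply: mean_sqr_mono => //; first exact: hardy_hol.
  by near: s; exact: nbhs_left_ge.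
Unshelve. all: by end_near. Qed.

Lemma hardy_sqr_le f (M : R) : hardy f -> (forall r, 0 < r < 1 -> mean_sqr f r <= M) ->
  hardy_sqr f <= M.
Proof.
move=> hf hM; apply: limr_le; first by apply/cvg_ex; exists (hardy_sqr f); exact: mean_sqr_cvg.
near=> s; apply: hM; near: s; exact: near_left1.
Unshelve. all: by end_near. Qed.

Lemma hardy_dot_cvg f g (L : C) :
  (complex.Re (mean_dot f g r) @[r --> 1^'-] --> complex.Re L) ->
  (complex.Im (mean_dot f g r) @[r --> 1^'-] --> complex.Im L) -> hardy_dot f g = L.
Proof.
move=> h1 h2; rewrite /hardy_dot.
apply: complex_eqP; [exact: (cvg_lim _ h1)|exact: (cvg_lim _ h2)].
Qed.

(** Polarization with the coefficients 1 and i for the two parts; in particular the limits defining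
    [hardy_dot] exist. *)
Lemma hardy_dotE f g : hardy f -> hardy g -> hardy_dot f g =
  ((hardy_sqr (lin_comb f 1 g) - hardy_sqr f - hardy_sqr g) / 2) +i*
  ((hardy_sqr (lin_comb f (0 +i* 1) g) - hardy_sqr f - hardy_sqr g) / 2).
Proof.
move=> Hf Hg; have hf := hardy_hol Hf; have hg := hardy_hol Hg.
have cf := mean_sqr_cvg Hf; have cg := mean_sqr_cvg Hg.
have h c : cabs c = 1 -> complex.Re (Num.conj c * mean_dot f g r) @[r --> 1^'-] -->
    (hardy_sqr (lin_comb f c g) - hardy_sqr f - hardy_sqr g) / 2.
  move=> cc; have c1 := mean_sqr_cvg (hardy_lin_comb c Hf Hg).
  have c2 : (mean_sqr (lin_comb f c g) r - mean_sqr f r - mean_sqr g r) * 2^-1 @[r --> (1 : R)^'-] -->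
      (hardy_sqr (lin_comb f c g) - hardy_sqr f - hardy_sqr g) / 2.
    exact: (left1_cvg_half c1 cf cg).
  move: c2; rewrite (_ : (_ @[_ --> _]) = (complex.Re (Num.conj c * mean_dot f g r) @[r --> (1 : R)^'-]))//.
    apply: near_left1_fmap; move: near_left1; apply: filterS => r /andP[r0 r1].
  have r01 : 0 <= r < 1 by rewrite ltW.
  rewrite mean_sqr_lin_comb// cc expr1n mul1r; field.
  by [].
apply: (@hardy_dot_cvg f g (_ +i* _)) => /=.
  have := h 1 (cabs1 _); rewrite rmorph1.
  by under eq_fun do rewrite mul1r.
have ci : cabs (0 +i* 1 : C) = 1 by rewrite cabsE /= expr0n expr1n add0r sqrtr1.
have := h _ ci; under eq_fun do rewrite cReM cReJ cImJ /= mul0r mulN1r opprK add0r.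
by [].
Qed.

Lemma hardy_dot_isometry (W : (CN -> C) -> CN -> C) :
  (forall f, hardy f -> hardy (W f)) ->
  (forall f c g, W (lin_comb f c g) = lin_comb (W f) c (W g)) ->
  (forall f, hardy f -> hardy_sqr (W f) = hardy_sqr f) ->
  forall f g, hardy f -> hardy g -> hardy_dot (W f) (W g) = hardy_dot f g.
Proof.
move=> hW Wlin Wsqr f g hf hg.
rewrite (hardy_dotE (hW _ hf) (hW _ hg)) (hardy_dotE hf hg) -!Wlin.
rewrite (Wsqr _ hf) (Wsqr _ hg) (Wsqr _ (hardy_lin_comb 1 hf hg)).
by rewrite (Wsqr _ (hardy_lin_comb _ hf hg)).
Qed.

Lemma hardy_dot_lim f g : hardy_dot f g =
  lim (complex.Re (mean_dot f g r) @[r --> (1 : R)^'-]) +i*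
  lim (complex.Im (mean_dot f g r) @[r --> (1 : R)^'-]).
Proof. exact: erefl. Qed.

Lemma eq_hardy_dot f f' g g' : eq_on_ball f f' -> eq_on_ball g g' ->
  hardy_dot f g = hardy_dot f' g'.
Proof.
move=> ff' gg'.
have E : \forall r \near (1 : R)^'-, mean_dot f g r = mean_dot f' g' r.
  move: near_left1; apply: filterS => r /andP[r0 r1].
  by apply: eq_mean_dot; rewrite ?ltW.
have E1 : \forall r \near (1 : R)^'-, complex.Re (mean_dot f g r) = complex.Re (mean_dot f' g' r).
  by move: E; apply: filterS => r E; congr complex.Re.
have E2 : \forall r \near (1 : R)^'-, complex.Im (mean_dot f g r) = complex.Im (mean_dot f' g' r).
  by move: E; apply: filterS => r E; congr complex.Im.
by rewrite !hardy_dot_lim (near_left1_fmap E1) (near_left1_fmap E2).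
Qed.

End hardy_space.

(** * Sufficiency of the conditions *)

Section contraction.
Variables (R : realType) (N : nat).
Hypothesis N0 : (0 < N)%N.
Local Notation C := R[i].
Local Notation CN := 'cV[C]_N.

(** A sequence of radii tending to 1, since [sint_dominated] is a statement about sequences. *)
Definition radius n : R := 1 - 2^-1 ^+ n.+1.

Lemma radius_01 n : 0 <= radius n < 1.
Proof.
have h : 0 < 2^-1 ^+ n.+1 :> R by rewrite exprn_gt0.
rewrite /radius; apply/andP; split; last lra.
by rewrite subr_ge0 exprn_ile1// invf_le1// ler1n.
Qed.

Lemma radius_sqr n : 0 <= radius n ^+ 2 < 1.
Proof.
have /andP[h0 h1] := radius_01 n.
by rewrite sqr_ge0 /= expr2 (le_lt_trans _ h1)// ler_piMl// ltW.
Qed.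

Lemma radius_sqr_near n : cabs ((radius n ^+ 2)%:C - 1 : C) <= 2^-1 ^+ n.
Proof.
rewrite -(rmorph1 (real_complex R)) -rmorphB cabsR.
have h : 0 < 2^-1 ^+ n.+1 :> R by rewrite exprn_gt0.
have h1 : 2^-1 ^+ n.+1 <= 1 :> R by rewrite exprn_ile1// invf_le1// ler1n.
have -> : 2^-1 ^+ n = 2 * 2^-1 ^+ n.+1 :> R by rewrite exprS mulrA divff// mul1r.
rewrite /radius; move: (_ ^+ n.+1) h h1 => x x0 x1.
rewrite ler_norml; apply/andP; split; nra.
Qed.

Lemma radius_cvg (r : R) : r < 1 -> \forall n \near \oo, r <= radius n.
Proof.
move=> r1; have e0 : 0 < 1 - r by rewrite subr_gt0.
have h0 : (0 : R) <= 2^-1 by rewrite invr_ge0.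
have h1 : (2^-1 : R) < 1 by rewrite invf_lt1// ltr1n.
have [M _ hM] := geometric_small 1 h0 h1 e0.
exists M => // n /= Mn; rewrite /radius; have := hM n.+1 (leqW Mn).
by rewrite mul1r; move: (_ ^+ n.+1) => x; lra.
Qed.

Lemma ctsat_radius (g : CN -> C) w : ctsat g w -> forall e : R, 0 < e ->
  \forall n \near \oo, cabs (g ((radius n ^+ 2)%:C *: w) - g w) <= e.
Proof.
move=> gw e e0; have [del d0 hd] := gw e e0.
have h0 : (0 : R) <= 2^-1 by rewrite invr_ge0.
have h1 : (2^-1 : R) < 1 by rewrite invf_lt1// ltr1n.
have [M _ hM] := geometric_small (enorm w) h0 h1 d0.
exists M => // n /hM hn; apply: hd; apply: le_trans hn.
rewrite -[X in _ - X]scale1r -scalerBl enormZ mulrC ler_wpM2l ?enorm_ge0//.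
exact: radius_sqr_near.
Qed.

Variables (a1 : C) (a0 : CN) (A : 'M[C]_N).
Hypotheses (ha0 : enorm a0 < 1) (hA : A^T = A).
Hypothesis hphi : forall z, enorm z < 1 -> enorm (frac_map a0 A z) < 1.

Local Notation phi := (frac_map a0 A).
Local Notation psi := (kernel_weight a0 a1).
Local Notation psi' := (kernel_weight (conj_mx a0) (Num.conj a1)).
Local Notation phi' := (frac_map (conj_mx a0) (conj_mx A)).
Local Notation W := (weighted_composition psi phi).
Local Notation T := (weighted_composition psi' phi').

(** This and [phi_bound] are all that the section takes from the three conditions. Both hold again
    for the conjugate data, so its results apply to T as well as to W. *)
Hypothesis TW : forall f z, enorm z < 1 -> T (W f) z = f z.
Hypothesis phi_bound : forall r : R, 0 <= r -> r < 1 ->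
  exists2 t : R, t < 1 & forall z, enorm z <= r -> enorm (phi z) <= t.

Let cA : (conj_mx A)^T = conj_mx A. Proof. by rewrite /conj_mx map_trmx hA. Qed.
Let ca0 : enorm (conj_mx a0) < 1. Proof. by rewrite enorm_conj. Qed.

Lemma weight_bounded : exists2 M : R, 0 <= M & forall z, enorm z < 1 -> cabs (psi z) <= M.
Proof.
have d0 : 0 < 1 - enorm a0 by rewrite subr_gt0.
exists (cabs a1 / (1 - enorm a0) ^+ N).
  by rewrite divr_ge0 ?cabs_ge0// exprn_ge0// ltW.
move=> z z1; rewrite /kernel_weight cabsM cabsV cabsX ler_wpM2l ?cabs_ge0//.
have h : 1 - enorm a0 <= cabs (1 - dotc z (conj_mx a0)).
  rewrite lerBlDr -{1}(cabs1 R) -{1}(subrK (dotc z (conj_mx a0)) 1).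
  rewrite (le_trans (cabsD _ _))// lerD2l (le_trans (dotc_cauchy_schwarz _ _))//.
  by rewrite enorm_conj ler_piMl ?enorm_ge0// ltW.
rewrite lef_pV2 ?posrE ?exprn_gt0//; last exact: lt_le_trans h.
by rewrite lerXn2r// nnegrE ?cabs_ge0// ltW.
Qed.

Section dilated.
Variables (f : CN -> C) (rho : R).
Hypotheses (hf : hol_ball f) (rho0 : 0 <= rho) (rho1 : rho < 1).

Let F := W (fun y => f ((rho ^+ 2)%:C *: y)).

(* [F] is its own test function in the adjoint formula, and [T] maps it back to
   the dilation of [f]. *)
Lemma mean_sqr_dilated (r : R) : 0 <= r < 1 -> mean_sqr F r <= mean_sqr f (rho ^+ 2).
Proof.
move=> /andP[r0 r1].
have s01 : 0 <= rho ^+ 2 < 1.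
  by rewrite sqr_ge0 /= expr2 (le_lt_trans _ rho1)// ler_piMl// ltW.
have /andP[s0 s1] := s01.
have hF : hol_ball F.
  apply: hol_ball_weighted_composition => //.
  by apply: hol_ball_scale => //; exact: ltW.
(* The dilated function is bounded on the whole ball, hence so is F; this dominates [G n] uniformly
   in n. *)
have [MF MF0 hMF] : exists2 M : R, 0 <= M & forall z, enorm z < 1 -> cabs (F z) <= M.
  have [M1 M10 hM1] := weight_bounded; have [M2 M20 hM2] := hol_ball_bound hf s1.
  exists (M1 * M2) => [|z z1]; first exact: mulr_ge0.
  rewrite cabsM ler_pM ?cabs_ge0//; first exact: hM1.
  apply: hM2; rewrite enormZ cabsR ger0_norm// ler_piMr// ltW//; exact: hphi.
have hpsi' : hol_ball psi' by exact: hol_ball_weight.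
have [Mp Mp0 hMp] := hol_ball_bound hpsi' rho1.
have [Mf Mf0 hMf] := hol_ball_bound hf rho1.
have rx (x : CN) : enorm x = 1 -> enorm (rho%:C *: x) = rho.
  by move=> x1; rewrite enormZ cabsR ger0_norm// x1 mulr1.
have rx1 (x : CN) : enorm x = 1 -> enorm (rho%:C *: x) < 1 by move=> x1; rewrite rx.
pose G n (x : CN) := f (rho%:C *: x) *
  Num.conj (T (fun y => F ((radius n ^+ 2)%:C *: y)) (rho%:C *: x)).
have bG n : sbm (G n).
  have /andP[n0 n1] := radius_sqr n.
  apply: sbmM; first exact: sbm_holR.
  apply: sbmJ; apply: (sbm_holR _ rho0 rho1).
  have h2 : hol_ball (fun y => F ((radius n ^+ 2)%:C *: y)).
    by apply: (hol_ball_scale hF n0); exact: ltW.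
  exact: (hol_ball_weighted_composition _ ca0 (conj_ball hphi) h2).
have GE n : mean_dot F F (radius n) = sphere_integral (G n).
  by have /andP[n0 n1] := radius_01 n; exact: sint_weighted_adjoint.
have GM n x : enorm x = 1 -> cabs (G n x) <= Mf * (Mp * MF).
  move=> x1; have /andP[n0 n1] := radius_sqr n.
  rewrite cabsM cabsJ ler_pM ?cabs_ge0//; first by apply: hMf; rewrite rx.
  rewrite cabsM ler_pM ?cabs_ge0//; first by apply: hMp; rewrite rx.
  have p1 := conj_ball hphi (rx1 x x1).
  apply: hMF; rewrite enormZ cabsR ger0_norm// (le_lt_trans _ p1)//.
  by rewrite ler_piMl ?enorm_ge0// ltW.
have GL x : enorm x = 1 -> forall e : R, 0 < e -> \forall n \near \oo,
    cabs (G n x - f (rho%:C *: x) * Num.conj (f ((rho ^+ 2)%:C *: (rho%:C *: x)))) <= e.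
  move=> x1 e e0; have B0 : 0 < Mf * Mp + 1 by rewrite ltr_wpDl// mulr_ge0.
  have p1 := conj_ball hphi (rx1 x x1).
  have cF : ctsat F (phi' (rho%:C *: x)) by exact: hol_ball_ctsat.
  move: (ctsat_radius cF (divr_gt0 e0 B0)); apply: filterS => n hn.
  have TF := TW (fun y => f ((rho ^+ 2)%:C *: y)) (rx1 x x1); rewrite -/F in TF.
  rewrite /G -TF /weighted_composition -/F -mulrBr.
  rewrite (_ : Num.conj _ - Num.conj _ = Num.conj (psi' (rho%:C *: x) *
    (F ((radius n ^+ 2)%:C *: phi' (rho%:C *: x)) - F (phi' (rho%:C *: x))))); last first.
    by rewrite mulrBr; exact: esym (rmorphB _ _ _).
  rewrite cabsM cabsJ cabsM mulrA.
  have h1 : cabs (f (rho%:C *: x)) * cabs (psi' (rho%:C *: x)) <= Mf * Mp.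
    by rewrite ler_pM ?cabs_ge0//; [apply: hMf|apply: hMp]; rewrite rx.
  rewrite (le_trans (ler_pM _ _ h1 hn)) ?mulr_ge0 ?cabs_ge0//.
  by rewrite mulrCA ler_piMr ?(ltW e0)// ler_pdivrMr// mul1r lerDl.
have [_ lim] := sint_dominated bG GM GL.
(* The limit has radii rho and rho ^ 3, whose product is that of the radii rho ^ 2 and rho ^ 2. *)
have XE : sphere_integral (fun x => f (rho%:C *: x) *
    Num.conj (f ((rho ^+ 2)%:C *: (rho%:C *: x)))) = mean_dot f f (rho ^+ 2).
  under eq_sint do rewrite scalerA -rmorphM.
  have t01 : 0 <= rho ^+ 2 * rho < 1.
    by rewrite mulr_ge0//= (le_lt_trans _ rho1)// ler_piMl// ltW.
  by apply: sint_two_radii; rewrite ?rho0 ?rho1//; ring.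
rewrite XE in lim.
apply/ler_addgt0Pr => e e0.
have [M _ hM] := filterI (lim e e0) (radius_cvg r1).
have [h1 h2] := hM M (leqnn M); have /andP[n0 n1] := radius_01 M.
apply: (le_trans (mean_sqr_mono hF r0 h2 n1)).
rewrite /mean_sqr GE -lerBlDl -cReN -cReD.
apply: (le_trans (ler_norm _)); apply: (le_trans (ler_Re _)); exact: h1.
Qed.

End dilated.

(** On the sphere of radius r the images under [phi] stay in a ball of radius t < 1, where f is
    bounded. Hence W of the dilations of f converges to W f there with a common bound, and
    [mean_sqr_dilated] passes to the limit. *)
Lemma mean_sqr_weighted_composition f (r : R) : hardy f -> 0 <= r < 1 ->
  mean_sqr (W f) r <= hardy_sqr f.
Proof.
move=> Hf r01; have /andP[r0 r1] := r01; have hf := hardy_hol Hf.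
have [t t1 ht] := phi_bound r0 r1.
have [Mf Mf0 hMf] := hol_ball_bound hf t1.
have [Mp Mp0 hMp] := weight_bounded.
have rz (z : CN) : enorm z = 1 -> enorm (r%:C *: z) < 1 by exact: sphere_ball.
have tz (z : CN) : enorm z = 1 -> enorm (phi (r%:C *: z)) <= t.
  by move=> z1; apply: ht; rewrite enormZ cabsR ger0_norm// z1 mulr1.
pose F n := W (fun y => f ((radius n ^+ 2)%:C *: y)).
pose G n (z : CN) := F n (r%:C *: z) * Num.conj (F n (r%:C *: z)).
have hF n : hol_ball (F n).
  have /andP[n0 n1] := radius_sqr n.
  have h2 : hol_ball (fun y => f ((radius n ^+ 2)%:C *: y)).
    by apply: (hol_ball_scale hf n0); exact: ltW.
  exact: (hol_ball_weighted_composition _ ha0 hphi h2).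
have bG n : sbm (G n) by exact: sbm_pair.
have FM n z : enorm z = 1 -> cabs (F n (r%:C *: z)) <= Mp * Mf.
  move=> z1; have /andP[n0 n1] := radius_sqr n.
  rewrite cabsM ler_pM ?cabs_ge0//; first by apply: hMp; exact: rz.
  apply: hMf; apply: (le_trans _ (tz z z1)); rewrite enormZ cabsR (ger0_norm n0).
  by rewrite ler_piMl ?enorm_ge0// ltW.
have WM z : enorm z = 1 -> cabs (W f (r%:C *: z)) <= Mp * Mf.
  move=> z1; rewrite cabsM ler_pM ?cabs_ge0//; first by apply: hMp; exact: rz.
  by apply: hMf; exact: tz.
have M0 : 0 <= Mp * Mf by exact: mulr_ge0.
have GM n z : enorm z = 1 -> cabs (G n z) <= (Mp * Mf) * (Mp * Mf).
  by move=> z1; rewrite cabsM cabsJ ler_pM ?cabs_ge0// FM.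
have GL z : enorm z = 1 -> forall e : R, 0 < e -> \forall n \near \oo,
    cabs (G n z - W f (r%:C *: z) * Num.conj (W f (r%:C *: z))) <= e.
  move=> z1 e e0; have B0 : 0 < Mp * (2 * (Mp * Mf)) + 1.
    by rewrite ltr_wpDl// mulr_ge0// mulr_ge0.
  have cf : ctsat f (phi (r%:C *: z)) by apply: hol_ball_ctsat => //; exact/hphi/rz.
  move: (ctsat_radius cf (divr_gt0 e0 B0)); apply: filterS => n hn.
  have d1 : cabs (F n (r%:C *: z) - W f (r%:C *: z)) <= Mp * (e / (Mp * (2 * (Mp * Mf)) + 1)).
    rewrite /F /weighted_composition -mulrBr cabsM ler_pM ?cabs_ge0//.
    by apply: hMp; exact: rz.
  move: (FM n z z1) (WM z z1) d1; rewrite /G.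
  move: (F n _) (W f _) => a b am bm abm.
  have -> : a * Num.conj a - b * Num.conj b = (a - b) * Num.conj a + b * Num.conj (a - b).
    have -> : Num.conj (a - b) = Num.conj a - Num.conj b by exact: rmorphB.
    by ring.
  rewrite (le_trans (cabsD _ _))// !cabsM !cabsJ.
  have h1 : cabs (a - b) * cabs a <= Mp * (e / (Mp * (2 * (Mp * Mf)) + 1)) * (Mp * Mf).
    by rewrite ler_pM ?cabs_ge0.
  have h2 : cabs b * cabs (a - b) <= Mp * Mf * (Mp * (e / (Mp * (2 * (Mp * Mf)) + 1))).
    by rewrite ler_pM ?cabs_ge0.
  apply: (le_trans (lerD h1 h2)).
  have -> : Mp * (e / (Mp * (2 * (Mp * Mf)) + 1)) * (Mp * Mf) +
      Mp * Mf * (Mp * (e / (Mp * (2 * (Mp * Mf)) + 1))) =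
      (Mp * (2 * (Mp * Mf))) * (e / (Mp * (2 * (Mp * Mf)) + 1)) by ring.
  by rewrite mulrCA ler_piMr ?(ltW e0)// ler_pdivrMr// mul1r lerDl.
have [_ lim] := sint_dominated bG GM GL.
apply/ler_addgt0Pr => e e0.
have [M _ hM] := lim e e0; have h1 := hM M (leqnn M).
have /andP[n0 n1] := radius_01 M.
have h2 : mean_sqr (F M) r <= hardy_sqr f.
  apply: (le_trans (mean_sqr_dilated hf n0 n1 r01)).
  by apply: mean_sqr_le => //; exact: radius_sqr.
have h3 : mean_sqr (W f) r - mean_sqr (F M) r <= e.
  rewrite /mean_sqr -cReN -cReD; apply: (le_trans (ler_norm _)); apply: (le_trans (ler_Re _)).
  rewrite -cabsN opprB; exact: h1.
by rewrite -(subrK (mean_sqr (F M) r) (mean_sqr (W f) r)) addrC; exact: lerD.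
Qed.

Lemma hardy_weighted_composition f : hardy f -> hardy (W f).
Proof.
move=> Hf; apply/hardyP; split.
  by apply: hol_ball_weighted_composition => //; exact: hardy_hol.
exists (hardy_sqr f) => r /andP[r0 r1].
by apply: mean_sqr_weighted_composition => //; rewrite ltW.
Qed.

Lemma hardy_sqr_weighted_composition f : hardy f -> hardy_sqr (W f) <= hardy_sqr f.
Proof.
move=> Hf; apply: hardy_sqr_le; first exact: hardy_weighted_composition.
by move=> r /andP[r0 r1]; apply: mean_sqr_weighted_composition => //; rewrite ltW.
Qed.

End contraction.

Section sufficiency.
Variables (R : realType) (N : nat).
Hypothesis N0 : (0 < N)%N.
Local Notation C := R[i].
Local Notation CN := 'cV[C]_N.

(** The unimodular factor of the theorem is eliminated by taking moduli; [unimodular_factor]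
    restores it. *)
Definition unitary_conditions (a1 : C) (a0 : CN) (A : 'M[C]_N) : Prop :=
  [/\ cabs a1 ^+ 2 = (1 - enorm a0 ^+ 2) ^+ N,
      conj_mx A *m A - conj_mx a0 *m a0^T = ((1 - enorm a0 ^+ 2)%:C)%:M &
      A *m conj_mx a0 = a0].

Lemma rank_one_mul (a0 z : CN) :
  (conj_mx a0 *m a0^T) *m z = dotc z (conj_mx a0) *: conj_mx a0.
Proof.
have -> : conj_mx a0 *m a0^T *m z = conj_mx a0 *m (a0^T *m z) by rewrite mulmxA.
have -> : a0^T *m z = (dotc z (conj_mx a0))%:M.
  apply/matrixP => i j; rewrite (ord1 i) (ord1 j) !mxE eqxx mulr1n.
  by apply: eq_bigr => k _; rewrite !mxE conjCK mulrC.
by rewrite mul_mx_scalar.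
Qed.

(** The conditions are stable under conjugation of the data, so whatever they imply for W holds for
    T. *)
Lemma unitary_conditions_conj a1 a0 A : unitary_conditions a1 a0 A ->
  unitary_conditions (Num.conj a1) (conj_mx a0) (conj_mx A).
Proof.
move=> [h1 h2 h3]; split.
- by rewrite cabsJ enorm_conj.
- have := congr1 (@conj_mx R N N) h2.
  rewrite conj_mxB !conj_mxM enorm_conj => h.
  have -> : (conj_mx a0)^T = conj_mx a0^T by rewrite /conj_mx map_trmx.
  rewrite h.
  by apply/matrixP => i j; rewrite !mxE; case: (i == j); rewrite ?mulr1n ?mulr0n ?rmorph0 // conj_real.
- by rewrite -conj_mxM h3.
Qed.

Section inverse.
Variables (a1 : C) (a0 : CN) (A : 'M[C]_N).
Hypotheses (ha0 : enorm a0 < 1) (hA : A^T = A).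
Hypothesis hphi : forall z, enorm z < 1 -> enorm (frac_map a0 A z) < 1.
Hypothesis hU : unitary_conditions a1 a0 A.

Local Notation phi := (frac_map a0 A).
Local Notation psi := (kernel_weight a0 a1).
Local Notation psi' := (kernel_weight (conj_mx a0) (Num.conj a1)).
Local Notation phi' := (frac_map (conj_mx a0) (conj_mx A)).
Local Notation c := (1 - enorm a0 ^+ 2).

Let c0 : 0 < c.
Proof. by rewrite subr_gt0 exprn_ilt1// enorm_ge0. Qed.

Let cC0 : c%:C != 0 :> C.
Proof. by rewrite -cabs_eq0 cabsR normr_eq0 gt_eqF. Qed.

Let mulAA z : conj_mx A *m (A *m z) = c%:C *: z + dotc z (conj_mx a0) *: conj_mx a0.
Proof.
have [_ h2 _] := hU.
by rewrite mulmxA -(subrK (conj_mx a0 *m a0^T) (_ *m _)) h2 mulmxDl mul_scalar_mx rank_one_mul.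
Qed.

Let cA0 : conj_mx A *m a0 = conj_mx a0.
Proof. by have [_ _ h3] := hU; rewrite -[in LHS](conj_mxK a0) -conj_mxM h3. Qed.

Let den z : enorm z < 1 -> 1 - dotc z (conj_mx a0) != 0.
Proof. by move=> z1; rewrite one_minus_dotc_neq0 ?enorm_conj. Qed.

(** This is the denominator of [phi'] at [phi z]. As conj A maps a0 to conj a0, its product with the
    denominator of [phi] at z is the constant c. *)
Lemma frac_map_den z : enorm z < 1 ->
  1 - dotc (phi z) a0 = c%:C / (1 - dotc z (conj_mx a0)).
Proof.
move=> z1; have d0 := den z1; apply: (mulIf d0); rewrite mulfVK// /frac_map dotcZl dotcBl.
rewrite dotc_symmetric// cA0 dotcE rmorphB rmorph1.
move: d0; set d := dotc z (conj_mx a0) => d0; rewrite mulrBl mul1r mulrAC mulVf// mul1r.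
by rewrite opprB addrA subrK.
Qed.

Lemma frac_mapK z : enorm z < 1 -> phi' (phi z) = z.
Proof.
move=> z1; have d0 := den z1; rewrite {1}/frac_map conj_mxK frac_map_den//.
rewrite {1}/frac_map -scalemxAr mulmxBr cA0 mulAA.
set d := dotc z (conj_mx a0) in d0 *.
have -> : conj_mx a0 - (1 - d)^-1 *: (conj_mx a0 - (c%:C *: z + d *: conj_mx a0)) =
    (c%:C / (1 - d)) *: z.
  apply: (scalerI d0); rewrite scalerBr !scalerA divff// scale1r mulrCA divff// mulr1.
  by rewrite scalerBl scale1r; apply/matrixP => i j; rewrite !mxE; ring.
by rewrite scalerA mulVf ?scale1r// mulf_neq0// invr_neq0.
Qed.

(** Along [phi] the two weights multiply to |a1| ^ 2 / c ^ N, which the first condition makes 1. *)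
Lemma weighted_compositionK f z : enorm z < 1 ->
  weighted_composition psi phi (weighted_composition psi' phi' f) z = f z.
Proof.
move=> z1; have d0 := den z1; rewrite /weighted_composition frac_mapK// mulrA.
rewrite -[RHS]mul1r; congr (_ * _).
rewrite /kernel_weight conj_mxK frac_map_den//.
have [h1 _ _] := hU.
move: d0; set d := 1 - dotc z (conj_mx a0) => d0.
have cN : c%:C ^+ N != 0 :> C by rewrite expf_neq0.
have dN : d ^+ N != 0 by rewrite expf_neq0.
transitivity ((a1 * Num.conj a1) / c%:C ^+ N).
  by rewrite expr_div_n; field; rewrite cN dN.
by rewrite cabs_sqr h1 rmorphXn divff.
Qed.

(** [frac_map_kernel] at u = phi z, combined with [frac_mapK], gives |1 - <z, conj a0>| ^ 2 (1 -
    |phi z| ^ 2) = c (1 - |z| ^ 2). The 4 in X bounds the first factor. *)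
Lemma frac_map_bound (r : R) : 0 <= r -> r < 1 ->
  exists2 t : R, t < 1 & forall z, enorm z <= r -> enorm (phi z) <= t.
Proof.
move=> r0 r1; pose X := 1 - c * (1 - r ^+ 2) / 4.
have r2 : 0 < 1 - r ^+ 2 by rewrite subr_gt0 exprn_ilt1.
have X1 : X < 1 by rewrite /X ltrBlDr ltrDl divr_gt0// mulr_gt0.
exists (Num.sqrt X) => [|z zr].
  by rewrite -[ltRHS]sqrtr1 ltr_sqrt// X1.
have z1 : enorm z < 1 by exact: le_lt_trans r1.
rewrite -[leLHS]ger0_norm ?enorm_ge0// -sqrtr_sqr ler_wsqrtr//.
have d0 := den z1; have dJ : Num.conj (1 - dotc z (conj_mx a0)) != 0 by rewrite -cabs_eq0 cabsJ cabs_eq0.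
have := frac_map_kernel ha0 hA z1 (hphi z1); rewrite frac_mapK//.
have -> : 1 - dotc a0 (phi z) = c%:C / Num.conj (1 - dotc z (conj_mx a0)).
  by rewrite -[RHS](conjCK) -(conj_real c) -conj_inv -conj_mul -frac_map_den// !conj_sub1 conjCK dotcC.
rewrite !dotcE => E.
have {}E : cabs (1 - dotc z (conj_mx a0)) ^+ 2 * (1 - enorm (phi z) ^+ 2) = c * (1 - enorm z ^+ 2).
  have rM (x y : R) : (x * y)%:C = x%:C * y%:C :> C by exact: rmorphM.
  have rB (x : R) : (1 - x)%:C = 1 - x%:C :> C by rewrite rmorphB rmorph1.
  apply: (@complexI R); rewrite [LHS]rM [RHS]rM -cabs_sqr (rB (enorm (phi z) ^+ 2)) (rB (enorm z ^+ 2)) mulrAC E; move: dJ; move: (Num.conj _) => d' d'0.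
  by rewrite mulrAC mulfVK.
have d2 : cabs (1 - dotc z (conj_mx a0)) ^+ 2 <= 4.
  have -> : 4 = 2 ^+ 2 :> R by rewrite -natrX.
  rewrite lerXn2r ?nnegrE ?cabs_ge0// (le_trans (cabsB _ _))// cabs1 -[leRHS]/(1 + 1 : R).
  rewrite lerD2l (le_trans (dotc_cauchy_schwarz _ _))// enorm_conj.
  by rewrite mulr_ile1 ?enorm_ge0// ltW.
have p2 : 0 <= 1 - enorm (phi z) ^+ 2.
  by rewrite subr_ge0 exprn_ile1 ?enorm_ge0// ltW// hphi.
have zr2 : enorm z ^+ 2 <= r ^+ 2 by rewrite lerXn2r ?nnegrE ?enorm_ge0.
have h1 : cabs (1 - dotc z (conj_mx a0)) ^+ 2 * (1 - enorm (phi z) ^+ 2) <= 4 * (1 - enorm (phi z) ^+ 2).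
  by rewrite ler_wpM2r.
have h2 : c * (1 - r ^+ 2) <= c * (1 - enorm z ^+ 2) by rewrite ler_wpM2l ?lerB// ltW.
move: h1 h2; rewrite E /X; move: (enorm (phi z) ^+ 2) (c * _) (c * _) => a b e; lra.
Qed.

End inverse.
End sufficiency.

Section unitary.
Variables (R : realType) (N : nat).
Hypothesis N0 : (0 < N)%N.
Local Notation C := R[i].
Local Notation CN := 'cV[C]_N.
Local Notation kappa := (@kappa R N).

Lemma near_left1_impl (P Q : R -> Prop) : (\forall r \near (1 : R)^'-, P r) ->
  (forall r : R, 0 < r < 1 -> P r -> Q r) -> \forall r \near (1 : R)^'-, Q r.
Proof.
by move=> hP PQ; move: hP (@near_left1 R); apply: filterS2 => r /[swap]; exact: PQ.
Qed.

Lemma eq_hardy_sqr (f f' : CN -> C) : eq_on_ball f f' -> hardy_sqr f = hardy_sqr f'.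
Proof.
move=> ff'; rewrite /hardy_sqr (@near_left1_fmap _ (mean_sqr f) (mean_sqr f'))//.
move: (@near_left1 R); apply: filterS => r /andP[r0 r1]; rewrite /mean_sqr.
by congr complex.Re; apply: eq_mean_dot => //; rewrite ltW.
Qed.

Lemma weighted_composition_lin_comb (psi : CN -> C) (phi : CN -> CN) f c g :
  weighted_composition psi phi (lin_comb f c g) =
  lin_comb (weighted_composition psi phi f) c (weighted_composition psi phi g).
Proof.
by apply/funext => z; rewrite /lin_comb /weighted_composition mulrDr [in LHS]mulrCA.
Qed.

Section operator.
Variables (a1 : C) (a0 : CN) (A : 'M[C]_N).
Hypotheses (ha0 : enorm a0 < 1) (hA : A^T = A).
Hypothesis hphi : forall z, enorm z < 1 -> enorm (frac_map a0 A z) < 1.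

Local Notation phi := (frac_map a0 A).
Local Notation psi := (kernel_weight a0 a1).
Local Notation psi' := (kernel_weight (conj_mx a0) (Num.conj a1)).
Local Notation phi' := (frac_map (conj_mx a0) (conj_mx A)).
Local Notation W := (weighted_composition psi phi).
Local Notation T := (weighted_composition psi' phi').
Local Notation c := (1 - enorm a0 ^+ 2).

Let cA : (conj_mx A)^T = conj_mx A. Proof. by rewrite /conj_mx map_trmx hA. Qed.
Let ca0 : enorm (conj_mx a0) < 1. Proof. by rewrite enorm_conj. Qed.
Let cphi z : enorm z < 1 -> enorm (phi' z) < 1. Proof. exact: conj_ball. Qed.

Lemma unitary_of_conditions : unitary_conditions a1 a0 A -> hardy_unitary W.
Proof.
move=> hU; have hU' := unitary_conditions_conj hU.
have WT f z : enorm z < 1 -> W (T f) z = f z by exact: weighted_compositionK.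
have TW f z : enorm z < 1 -> T (W f) z = f z.
  by move=> z1; have := weighted_compositionK ca0 cA hU' f z1; rewrite !conj_mxK conjCK.
have bphi := frac_map_bound ha0 hA hphi hU.
have bphi' := frac_map_bound ca0 cA cphi hU'.
have hW f : hardy f -> hardy (W f) by exact: (hardy_weighted_composition N0 ha0 hA hphi TW bphi).
have WT' f z : enorm z < 1 -> weighted_composition
    (kernel_weight (conj_mx (conj_mx a0)) (Num.conj (Num.conj a1)))
    (frac_map (conj_mx (conj_mx a0)) (conj_mx (conj_mx A))) (T f) z = f z.
  by rewrite !conj_mxK conjCK; exact: WT.
have hT f : hardy f -> hardy (T f).
  exact: (hardy_weighted_composition N0 ca0 cA cphi WT' bphi').
have sW f : hardy f -> hardy_sqr (W f) = hardy_sqr f.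
  move=> hf; apply/le_anti/andP; split.
    exact: (hardy_sqr_weighted_composition N0 ha0 hA hphi TW bphi hf).
  rewrite -(@eq_hardy_sqr (T (W f)) f); last by move=> z; exact: TW.
  exact: (hardy_sqr_weighted_composition N0 ca0 cA cphi WT' bphi' (hW f hf)).
split; first exact: hW.
exists T; split; first exact: hT.
- move=> f g hf hg.
  (* With g written as W (T g) on the ball, adjointness is the isometry of W. *)
  rewrite (@eq_hardy_dot _ _ (W f) (W f) g (W (T g))) => [|z _|z z1].
  + apply: (hardy_dot_isometry hW _ sW hf (hT g hg)).
    exact: weighted_composition_lin_comb.
  + by [].
  + by rewrite WT.
- by move=> f hf z; exact: TW.
- by move=> f hf z; exact: WT.
Qed.

Lemma mean_dot_kernel (u w : CN) (al be : C) (r : R) : enorm u < 1 -> enorm w < 1 ->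
  0 <= r < 1 ->
  mean_dot (fun z => al * hardy_kernel u z) (fun z => be * hardy_kernel w z) r =
  al * Num.conj be * (kappa%:C * hardy_kernel u ((r ^+ 2)%:C *: w)).
Proof.
move=> u1 w1 r01; have /andP[r0 r1] := r01.
have ku := hol_ball_kernel u1; have kw := hol_ball_kernel w1.
rewrite -(sint_reproducing N0 ku r0 r1 (ltW w1)) /mean_dot -sintZ; last exact: sbm_pair.
apply: eq_sint => z _; rewrite conj_mul; move: (hardy_kernel u _) (Num.conj be) (Num.conj _) => p q s.
ring.
Qed.

Lemma hardy_kernel_hardy (u : CN) : enorm u < 1 -> hardy (hardy_kernel u).
Proof.
move=> u1; apply/hardyP; split; first exact: hol_ball_kernel.
have [M M0 hM] := hol_ball_bound (hol_ball_kernel u1) u1.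
exists (kappa * M) => r /andP[r0 r1].
have r01 : 0 <= r < 1 by rewrite ltW.
have := @mean_dot_kernel u u 1 1 r u1 u1 r01; rewrite conj_real /mean_sqr.
have -> : (fun z : CN => 1 * hardy_kernel u z) = hardy_kernel u.
  by apply/funext => z; rewrite mul1r.
have k0 : 0 <= kappa by rewrite ltW// kappa_gt0.
rewrite !mul1r => ->; rewrite (le_trans (ler_norm _))// (le_trans (ler_Re _))//.
rewrite cabsM cabsR (ger0_norm k0) ler_wpM2l// hM// enormZ cabsR ger0_norm ?sqr_ge0//.
by rewrite ler_piMl ?enorm_ge0// exprn_ile1// ltW.
Qed.

Lemma left1_ctsat (g : CN -> C) (w : CN) (e : R) : ctsat g w -> 0 < e ->
  \forall r \near (1 : R)^'-, cabs (g ((r ^+ 2)%:C *: w) - g w) <= e.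
Proof.
move=> gw e0; have [del d0 hd] := gw e e0.
have B0 : 0 < 2 * (enorm w + 1) by rewrite mulr_gt0// ltr_wpDl ?enorm_ge0.
have dB0 : 0 < del / (2 * (enorm w + 1)) by rewrite divr_gt0.
have near1 : \forall r \near (1 : R)^'-, 1 - del / (2 * (enorm w + 1)) < r.
  by apply: nbhs_left_gt; rewrite ltrBlDr ltrDl.
apply: (near_left1_impl near1) => r /andP[r0 r1] h.
apply: hd; rewrite -[X in _ - X]scale1r -scalerBl enormZ -(rmorph1 (real_complex R)) -rmorphB cabsR.
have h1 : `|r ^+ 2 - 1| <= 2 * (del / (2 * (enorm w + 1))).
  move: (del / _) h => x h; rewrite ler_norml; apply/andP; split; nra.
rewrite (le_trans (ler_wpM2r (enorm_ge0 _) h1))//.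
have -> : 2 * (del / (2 * (enorm w + 1))) * enorm w = del * (enorm w / (enorm w + 1)).
  by field; rewrite gt_eqF// ltr_wpDl ?enorm_ge0.
rewrite ler_piMr ?(ltW d0)// ler_pdivrMr ?ltr_wpDl ?enorm_ge0//.
by rewrite mul1r lerDl.
Qed.

Lemma hardy_dot_kernel (u w : CN) (al be : C) : enorm u < 1 -> enorm w < 1 ->
  hardy_dot (fun z => al * hardy_kernel u z) (fun z => be * hardy_kernel w z) =
  al * Num.conj be * (kappa%:C * hardy_kernel u w).
Proof.
move=> u1 w1; set B := al * Num.conj be * kappa%:C.
have lim (e : R) : 0 < e -> \forall r \near (1 : R)^'-,
    cabs (B * hardy_kernel u w - mean_dot (fun z => al * hardy_kernel u z) (fun z => be * hardy_kernel w z) r) <= e.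
  move=> e0; have B0 : 0 < cabs B + 1 by rewrite ltr_wpDl ?cabs_ge0.
  have cu : ctsat (hardy_kernel u) w by apply: hol_ball_ctsat => //; exact: hol_ball_kernel.
  apply: (near_left1_impl (left1_ctsat cu (divr_gt0 e0 B0))) => r /andP[r0 r1] h.
  rewrite mean_dot_kernel ?(ltW r0)// mulrA -/B -mulrBr cabsM -opprB cabsN.
  rewrite (le_trans (ler_wpM2l (cabs_ge0 _) h))// mulrCA ler_piMr ?(ltW e0)//.
  by rewrite ler_pdivrMr// mul1r lerDl.
rewrite mulrA -/B; apply: hardy_dot_cvg.
  apply/cvgrPdist_le => e /lim; apply: filterS => r; apply: le_trans.
  by rewrite -cReN -cReD; exact: ler_Re.
apply/cvgrPdist_le => e /lim; apply: filterS => r; apply: le_trans.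
by rewrite -cImN -cImD; exact: ler_Im.
Qed.

(** All denominators are cleared, so that the identity is polynomial in w and in the conjugate of u
    and can be expanded at the origin. *)
Lemma unitary_kernel_identity : hardy_unitary W -> forall w u, enorm w < 1 -> enorm u < 1 ->
  (cabs a1 ^+ 2)%:C * (1 - dotc w u) ^+ N =
  ((1 - dotc a0 u) * (1 - dotc w a0) -
   dotc (conj_mx a0 - conj_mx A *m w) (conj_mx a0 - conj_mx A *m u)) ^+ N.
Proof.
move=> [hW [T [hT hadj hTW _]]] w u w1 u1.
have ku := hardy_kernel_hardy u1; have kw := hardy_kernel_hardy w1.
have k0 : kappa%:C != 0 :> C by rewrite -cabs_eq0 cabsR normr_eq0 gt_eqF// kappa_gt0.
(* Moving W across as its adjoint T and using T W = 1 makes W isometric on kernels. *)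
have iso : hardy_dot (W (hardy_kernel u)) (W (hardy_kernel w)) = hardy_dot (hardy_kernel u) (hardy_kernel w).
  rewrite (hadj _ _ ku (hW _ kw)).
  by apply: eq_hardy_dot => //; exact: hTW.
have E v : enorm v < 1 -> eq_on_ball (W (hardy_kernel v))
    (fun z => a1 / (1 - dotc a0 v) ^+ N * hardy_kernel (phi' v) z).
  by move=> v1 z z1; exact: weighted_composition_kernel.
move: iso; rewrite (eq_hardy_dot (E u u1) (E w w1)) hardy_dot_kernel ?cphi//.
have -> : hardy_dot (hardy_kernel u) (hardy_kernel w) = kappa%:C * hardy_kernel u w.
  have := hardy_dot_kernel 1 1 u1 w1; rewrite conj_real !mul1r => <-.
  by apply: eq_hardy_dot => z _; rewrite mul1r.
rewrite mulrCA => /(mulfI k0).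
have d1 : 1 - dotc a0 u != 0 by exact: one_minus_dotc_neq0.
have d2 : 1 - dotc w a0 != 0 by exact: one_minus_dotc_neq0.
have d3 : 1 - dotc w u != 0 by exact: one_minus_dotc_neq0.
have d4 : 1 - dotc (phi' w) (phi' u) != 0 by rewrite one_minus_dotc_neq0 ?cphi.
have -> : (1 - dotc a0 u) * (1 - dotc w a0) -
   dotc (conj_mx a0 - conj_mx A *m w) (conj_mx a0 - conj_mx A *m u) =
   (1 - dotc a0 u) * (1 - dotc w a0) * (1 - dotc (phi' w) (phi' u)).
  rewrite /frac_map dotcZl dotcZr conj_mxK conj_inv conj_sub1 -dotcC.
  move: (dotc (_ - _) _) d1 d2 => X.
  move: (1 - dotc a0 u) (1 - dotc w a0) => p q p0 q0.
  by field; rewrite p0 q0.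
rewrite conj_mul conj_inv conj_exp conj_sub1 -dotcC /hardy_kernel -cabs_sqr !exprMn.
move: (Num.conj a1) d1 d2 d3 d4 => b.
move: (1 - dotc a0 u) (1 - dotc w a0) (1 - dotc w u) (1 - dotc (phi' w) (phi' u)) => p q x y.
move=> /(expf_neq0 N) + /(expf_neq0 N) + /(expf_neq0 N) + /(expf_neq0 N).
move: (p ^+ N) (q ^+ N) (x ^+ N) (y ^+ N) => {}p {}q {}x {}y p0 q0 x0 y0 h.
transitivity (a1 / p * (b / q) / y * (p * q * y) * x).
  by field; rewrite p0 q0 y0.
by rewrite h mulrC mulVKf.
Qed.

End operator.
End unitary.

(** * Necessity of the conditions *)

Section necessity.
Variables (R : realType) (N : nat).
Hypothesis N0 : (0 < N)%N.
Local Notation C := R[i].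
Local Notation CN := 'cV[C]_N.

(* The two polynomials in t agree at infinitely many points, so their
   derivatives at 0 agree. *)
Lemma affine_power_inj (a p q : C) : a != 0 ->
  (forall t : R, 0 < t < 1 -> (a + t%:C * p) ^+ N = (a + t%:C * q) ^+ N) -> p = q.
Proof.
move=> a0 h; pose P (x : C) : {poly C} := (a%:P + x%:P * 'X) ^+ N.
have PE x t : (P x).[t] = (a + t * x) ^+ N.
  by rewrite /P horner_exp !hornerE mulrC.
have PQ : P p = P q.
  apply/eqP; rewrite -subr_eq0; apply/eqP.
  (* Distinct points 1 / (i + 2) of ]0, 1[, as many as the size of the difference, which exceeds its
     degree. *)
  pose s : seq C := [seq ((i.+2)%:R^-1 : R)%:C | i <- iota 0 (size (P p - P q))].
  apply: (@roots_geq_poly_eq0 _ _ s).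
  - apply/allP => _ /mapP[i _ ->]; rewrite rootE hornerD hornerN !PE subr_eq0.
    apply/eqP; apply: h; rewrite invr_gt0 ltr0n /=.
    by rewrite invf_lt1 ?ltr0n// ltr1n.
  - rewrite map_inj_in_uniq ?iota_uniq// => i j _ _ /complexI /invr_inj /eqP.
    by rewrite eqr_nat => /eqP[].
  - by rewrite size_map size_iota.
have dP x : ((P x)^`()).[0] = x * a ^+ N.-1 *+ N.
  rewrite /P deriv_exp derivD derivC add0r derivM derivC derivX mul0r add0r mulr1.
  rewrite hornerMn hornerM horner_exp hornerD hornerM !hornerC hornerX.
  by rewrite mulr0 addr0.
have := dP p; rewrite PQ dP => /eqP; rewrite -mulr_natr -[X in _ == X]mulr_natr.
have n0 : N%:R != 0 :> C by rewrite pnatr_eq0 -lt0n.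
by rewrite (inj_eq (mulIf n0)) (inj_eq (mulIf (expf_neq0 _ a0))) => /eqP ->.
Qed.

Lemma dotc_inj (v1 v2 : CN) : (forall w, dotc w v1 = dotc w v2) -> v1 = v2.
Proof.
move=> h; apply/matrixP => i j; rewrite (ord1 j) -!dotc_delta dotcC h -dotcC.
by [].
Qed.

Lemma mulmx_cV_inj (M M' : 'M[C]_N) : (forall z : CN, M *m z = M' *m z) -> M = M'.
Proof.
move=> h; apply/matrixP => i j; have := congr1 (fun v : CN => v i 0) (h (delta_mx j 0)).
by rewrite -!colE !mxE.
Qed.

Lemma scale_into_ball (w : CN) : exists2 s : R, 0 < s & enorm (s%:C *: w) < 1.
Proof.
have w0 : 0 < 1 + enorm w by rewrite ltr_pwDl// enorm_ge0.
exists (1 + enorm w)^-1; first by rewrite invr_gt0.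
by rewrite enormZ cabsR ger0_norm ?invr_ge0 ?(ltW w0)// mulrC ltr_pdivrMr// mul1r ltrDr.
Qed.

Variables (a1 : C) (a0 : CN) (A : 'M[C]_N).
Hypotheses (ha0 : enorm a0 < 1) (hA : A^T = A).
Hypothesis hphi : forall z, enorm z < 1 -> enorm (frac_map a0 A z) < 1.

Local Notation W := (weighted_composition (kernel_weight a0 a1) (frac_map a0 A)).
Local Notation c := (1 - enorm a0 ^+ 2).

Let cA : (conj_mx A)^T = conj_mx A. Proof. by rewrite /conj_mx map_trmx hA. Qed.

Let c0 : 0 < c.
Proof. by rewrite subr_gt0 exprn_ilt1// enorm_ge0. Qed.

Let cC0 : c%:C != 0 :> C.
Proof. by rewrite -cabs_eq0 cabsR normr_eq0 gt_eqF. Qed.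

Let dotc00 : dotc (conj_mx a0) (conj_mx a0) = 1 - c%:C.
Proof. by rewrite dotcE enorm_conj rmorphB rmorph1 opprB addrC subrK. Qed.

(** The kernel identity at w = u = 0 gives the modulus of a1, at u = 0 it gives A conj(a0) = a0, and
    in general the matrix equation. The N-th powers are compared along the ray t w, where both sides
    take the form (c + t p) ^ N of [affine_power_inj]. *)
Lemma conditions_of_unitary : hardy_unitary W -> unitary_conditions a1 a0 A.
Proof.
move=> hW; have key := unitary_kernel_identity N0 ha0 hA hphi hW.
have e0 : enorm (0 : CN) < 1 by rewrite enorm0.
have h1 : (cabs a1 ^+ 2)%:C = c%:C ^+ N.
  have := key 0 0 e0 e0; rewrite !mulmx0 !subr0 dotc0l dotc0r dotc0l dotc00 !subr0.
  by rewrite expr1n !mulr1 opprB addrC subrK.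
have tball (t s : R) (w : CN) : 0 < t < 1 -> enorm (s%:C *: w) < 1 -> enorm ((t * s)%:C *: w) < 1.
  move=> /andP[t0 t1] sw; rewrite rmorphM -scalerA enormZ cabsR gtr0_norm//.
  by rewrite (le_lt_trans _ sw)// ler_piMl ?enorm_ge0// ltW.
have h2 (w : CN) : dotc (conj_mx A *m w) (conj_mx a0) = dotc w a0.
  have [s s0 sw] := scale_into_ball w.
  have sC0 : s%:C != 0 :> C by rewrite -cabs_eq0 cabsR normr_eq0 gt_eqF.
  have : s%:C * (dotc (conj_mx A *m w) (conj_mx a0) - dotc w a0) = 0.
    apply: (affine_power_inj cC0) => t t01.
    have := key _ _ (tball t s w t01 sw) e0.
    rewrite !mulmx0 !subr0 !dotc0r subr0 mul1r expr1n mulr1 h1 mulr0 addr0 => ->.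
    rewrite dotcBl dotc00 -scalemxAr !dotcZl rmorphM; congr (_ ^+ _).
    by move: (dotc _ _) (dotc _ _) => x y; ring.
  by move=> /eqP; rewrite mulf_eq0 (negbTE sC0) /= subr_eq0 => /eqP.
have h2' (u : CN) : dotc (conj_mx a0) (conj_mx A *m u) = dotc a0 u.
  by rewrite dotcC h2 -dotcC.
have h3 (w u : CN) : dotc (conj_mx A *m w) (conj_mx A *m u) =
    c%:C * dotc w u + dotc w a0 * dotc a0 u.
  have [s s0 sw] := scale_into_ball w; have [s' s'0 su] := scale_into_ball u.
  have sC0 : s%:C != 0 :> C by rewrite -cabs_eq0 cabsR normr_eq0 gt_eqF.
  have s'C0 : s'%:C != 0 :> C by rewrite -cabs_eq0 cabsR normr_eq0 gt_eqF.
  have : s%:C * s'%:C * (dotc w a0 * dotc a0 u - dotc (conj_mx A *m w) (conj_mx A *m u)) =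
      s%:C * s'%:C * (- (c%:C * dotc w u)).
    apply: (affine_power_inj cC0) => t t01.
    have := key _ _ (tball t s w t01 sw) su.
    rewrite h1 -exprMn dotcBl !dotcBr h2 h2' dotc00 -!scalemxAr !dotcZl !dotcZr !conj_real rmorphM.
    move: (dotc (_ *m _) _) (dotc w a0) (dotc a0 u) (dotc w u) => x y z v E.
    apply: (etrans _ (etrans (esym E) _)); congr (_ ^+ _); ring.
  move=> /(mulfI (mulf_neq0 sC0 s'C0)) h.
  by rewrite -[LHS]opprK -[X in - X](addKr (dotc w a0 * dotc a0 u)) h; ring.
have h4 (u : CN) : A *m (conj_mx A *m u) = c%:C *: u + dotc u a0 *: a0.
  apply: dotc_inj => w; rewrite dotcDr !dotcZr conj_real -dotcC [_ * dotc w a0]mulrC -h3.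
  by rewrite dotc_symmetric// conj_mxK.
split.
- by apply: (@complexI R); rewrite h1 rmorphXn.
- apply: mulmx_cV_inj => z; rewrite mulmxBl rank_one_mul mul_scalar_mx -mulmxA.
  have := congr1 (@conj_mx R N 1) (h4 (conj_mx z)); rewrite !conj_mxM !conj_mxK => ->.
  have -> : conj_mx (c%:C *: conj_mx z + dotc (conj_mx z) a0 *: a0) =
      conj_mx (c%:C *: conj_mx z) + conj_mx (dotc (conj_mx z) a0 *: a0) by exact: map_mxD.
  rewrite !conj_mxZ conj_real conj_mxK -dotc_conj conj_mxK.
  by rewrite addrK.
- apply: dotc_inj => w; rewrite -h2 dotc_symmetric// conj_mxK.
  by [].
Qed.

End necessity.

(** * The conditions in the form of the theorem *)

Section equivalent_conditions.
Variables (R : realType) (N : nat).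
Hypothesis N0 : (0 < N)%N.
Local Notation C := R[i].
Local Notation CN := 'cV[C]_N.

Lemma unimodular_factor (a : C) (x : R) : 0 < x ->
  (exists2 l : C, `|l| = 1 & a = l * (x `^ (N%:R / 2))%:C) <-> cabs a ^+ 2 = x ^+ N.
Proof.
move=> x0; have p0 : 0 < x `^ (N%:R / 2) by exact: powR_gt0.
have p2 : (x `^ (N%:R / 2)) ^+ 2 = x ^+ N.
  by rewrite -powR_mulrn ?powR_ge0// -powRrM mulfVK// powR_mulrn// ltW.
split=> [[l l1 ->]|h].
  have {}l1 : cabs l = 1 by apply: (@complexI R); rewrite -normr_cabs l1.
  by rewrite cabsM l1 mul1r cabsR gtr0_norm.
have pC0 : (x `^ (N%:R / 2))%:C != 0 :> C by rewrite -cabs_eq0 cabsR normr_eq0 gt_eqF.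
exists (a / (x `^ (N%:R / 2))%:C); last by rewrite mulfVK.
rewrite normr_cabs cabsM cabsV cabsR gtr0_norm//.
have -> : cabs a = x `^ (N%:R / 2).
  by apply/eqP; rewrite -(@eqrXn2 _ 2)// ?cabs_ge0 ?(ltW p0)// h p2.
by rewrite divff// gt_eqF.
Qed.

(** The adjoint of a symmetric A is conj A, and for square matrices conj A A = 1 is equivalent to A
    conj A = 1. *)
Lemma unitary_conditions0 (a1 : C) (A : 'M[C]_N) : A^T = A ->
  unitary_conditions a1 0 A <-> cabs a1 = 1 /\ A \is unitarymx.
Proof.
move=> hA; have z0 : conj_mx (0 : CN) = 0 by apply/matrixP => i j; rewrite !mxE rmorph0.
have e : 1 - enorm (0 : CN) ^+ 2 = 1 :> R by rewrite enorm0 expr0n subr0.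
have tA : map_mx Num.conj A^T = conj_mx A by rewrite hA.
rewrite /unitary_conditions e z0 mul0mx subr0 mulmx0 expr1n rmorph1.
split=> [[h1 h2 _]|[h1 h2]]; split.
- by apply/eqP; rewrite -(@eqrXn2 _ 2)// ?cabs_ge0// h1 expr1n.
- by apply/unitarymxP; rewrite tA; exact: mulmx1C.
- by rewrite h1 expr1n.
- by apply: mulmx1C; move/unitarymxP: h2; rewrite tA.
- by [].
Qed.

End equivalent_conditions.

Theorem theorem4p1 (R : realType) (N : nat) (hN : (0 < N)%N)
    (a1 : R[i]) (a0 : 'cV[R[i]]_N) (A : 'M[R[i]]_N)
    (ha1 : a1 != 0) (ha0 : unit_ball a0) (hA : A^T = A)
    (hphi : forall z, unit_ball z -> unit_ball (frac_map a0 A z)) :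
  (a0 <> 0 ->
    (hardy_unitary
       (weighted_composition (kernel_weight a0 a1) (frac_map a0 A)) <->
     [/\ exists2 lambda : R[i], `|lambda| = 1 &
           a1 = lambda * ((1 - enorm a0 ^+ 2) `^ (N%:R / 2))%:C,
         conj_mx A *m A - conj_mx a0 *m a0^T
           = ((1 - enorm a0 ^+ 2)%:C)%:M &
         A *m conj_mx a0 - a0 = 0])) /\
  (a0 = 0 ->
    (hardy_unitary
       (weighted_composition (kernel_weight a0 a1) (frac_map a0 A)) <->
     [/\ exists2 lambda : R[i], `|lambda| = 1 &
           forall z, unit_ball z -> kernel_weight a0 a1 z = lambda,
         forall z, unit_ball z -> frac_map a0 A z = - (A *m z),
         A \is unitarymx &
         A^T = A])).
Proof.
have a01 : enorm a0 < 1 by exact: ha0.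
have iff : hardy_unitary (weighted_composition (kernel_weight a0 a1) (frac_map a0 A)) <->
    unitary_conditions a1 a0 A.
  split; first exact: (conditions_of_unitary hN a01 hA hphi).
  exact: (unitary_of_conditions hN a01 hA hphi).
have c0 : 0 < 1 - enorm a0 ^+ 2 by rewrite subr_gt0 exprn_ilt1// enorm_ge0.
split=> [_|a00].
  apply: (iff_trans iff); have [u1 u2] := unimodular_factor N a1 c0.
  split=> -[h1 h2 h3]; split=> //; first exact: u2.
  - by rewrite h3 subrr.
  - exact: u1.
  - by apply/eqP; rewrite -subr_eq0 h3.
apply: (iff_trans iff); rewrite a00; apply: (iff_trans (unitary_conditions0 a1 hA)).
have z0 : conj_mx (0 : 'cV[R[i]]_N) = 0 by apply/matrixP => i j; rewrite !mxE rmorph0.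
have kw (z : 'cV[R[i]]_N) : kernel_weight 0 a1 z = a1 by rewrite /kernel_weight z0 dotc0r subr0 expr1n divr1.
split=> [[h1 h2]|[[l l1 hl] _ h2 _]]; split => //.
- by exists a1 => [|z _]; rewrite ?kw// normr_cabs h1.
- by move=> z _; rewrite /frac_map z0 dotc0r subr0 invr1 scale1r sub0r.
- have u0 : unit_ball (0 : 'cV[R[i]]_N) by rewrite /unit_ball /= enorm0.
  by apply: (@complexI R); rewrite -normr_cabs -(kw 0) hl.
Qed.
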